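(* Let $R$ be a (commutative) Noetherian local ring and let $M$ and $N$ be finitely generated $R$-modules with $q_R(M,N)<\infty$. Then: (1) If $R_{\mathfrak p}$ satisfies derived $(\mathbf{ldep})$ for all $\mathfrak p\in\operatorname{Spec}(R)$, then $$q_R(M,N)\le\sup\{\operatorname{depth}(R_{\mathfrak p})-\operatorname{depth}_{R_{\mathfrak p}}(M_{\mathfrak p})-\operatorname{depth}_{R_{\mathfrak p}}(N_{\mathfrak p})\mid \mathfrak p\in\operatorname{Supp}(M)\cap\operatorname{Supp}(N)\}.$$ (2) If $R_{\mathfrak p}$ satisfies derived $(\mathbf{rdep})$ for all $\mathfrak p\in\operatorname{Spec}(R)$, then $$q_R(M,N)\ge\sup\{\operatorname{depth}(R_{\mathfrak p})-\operatorname{depth}_{R_{\mathfrak p}}(M_{\mathfrak p})-\operatorname{depth}_{R_{\mathfrak p}}(N_{\mathfrak p})\mid \mathfrak p\in\operatorname{Supp}(M)\cap\operatorname{Supp}(N)\}.$$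
   Context: $q_R(M,N):=\sup\{i\mid\operatorname{Tor}^R_i(M,N)\ne0\}$ (with $\sup\emptyset=-\infty$). Complexes are complexes of finitely generated modules, graded homologically. For a local ring $(S,\mathfrak n,\ell)$ and an $S$-complex $X$ with injective resolution $I$ (a K-injective complex of injective modules quasi-isomorphic to $X$), $\operatorname{depth}_S(X):=\inf\{i\mid H_{-i}(\operatorname{Hom}_S(\ell,I))\ne0\}$; this agrees with the usual depth for modules. A Noetherian local ring $S$ satisfies derived $(\mathbf{ldep})$ (respectively derived $(\mathbf{rdep})$) if for all $S$-complexes $X,Y$ such that $X$, $Y$ and $X\otimes^{\mathbf L}_S Y$ have bounded homology, one has $\operatorname{depth}_S(X\otimes^{\mathbf L}_S Y)+\operatorname{depth}(S)\ge\operatorname{depth}_S(X)+\operatorname{depth}_S(Y)$ (respectively $\le$). *)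

(* Defs.v *)
From HB Require Import structures.
From mathcomp Require Import all_boot all_order all_algebra.
From mathcomp Require Import ring_quotient generic_quotient.
From mathcomp Require Import boolp classical_sets functions constructive_ereal.
From mathcomp Require Import ring.

Set Implicit Arguments.
Unset Strict Implicit.
Unset Printing Implicit Defensive.

Import Order.TTheory GRing.Theory Num.Theory.

Local Open Scope ring_scope.
Local Open Scope quotient_scope.

(* Every subset of [\bar int] has a least upper and a greatest lower bound, so
   the defaults are only used on the empty set. *)
Definition esup (A : set (\bar int)) : \bar int := supremum -oo%E A.
Definition einf (A : set (\bar int)) : \bar int := infimum +oo%E A.

Section SubQuotient.
Variables (R : pzRingType) (V : lmodType R) (W : submodClosed V).

Definition submod : Type := {x : V | x \in W}.
HB.instance Definition _ := [isSub of submod for @sval V (fun x => x \in W)].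
HB.instance Definition _ := [Choice of submod by <:].
HB.instance Definition _ := [SubChoice_isSubLmodule of submod by <:].

(* [Quotient.quot] only applies to a [zmodClosed] predicate, and a
   [submodClosed] one is not canonically so. *)
Definition zmod_of_submod : {pred V} := fun x => x \in W.

Let zmod_of_submod_closed : zmod_closed zmod_of_submod.
Proof. exact: GRing.submod_closedB (submodClosedP W). Qed.
HB.instance Definition _ :=
  GRing.isZmodClosed.Build V zmod_of_submod zmod_of_submod_closed.

Definition quotmod : Type := Quotient.quot zmod_of_submod.
HB.instance Definition _ := GRing.Zmodule.on quotmod.

Definition quotmod_pi (x : V) : quotmod := \pi_(Quotient.quot zmod_of_submod) x.

Lemma quotmod_piP (x y : V) : reflect (quotmod_pi x = quotmod_pi y) (x - y \in W).
Proof.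
have -> : (x - y \in W) = (x - y \in zmod_of_submod) by [].
rewrite Quotient.idealrBE; exact: eqP.
Qed.

Lemma quotmod_piB : zmod_morphism quotmod_pi.
Proof. by move=> x y; rewrite /quotmod_pi raddfB. Qed.

Lemma quotmod_ind (P : quotmod -> Prop) : (forall x, P (quotmod_pi x)) -> forall q, P q.
Proof. by move=> h q; rewrite -[q]reprK; exact: h. Qed.

Definition quotmod_scale (a : R) (q : quotmod) : quotmod :=
  quotmod_pi (a *: repr q).

Lemma quotmod_piZ (a : R) (x : V) :
  quotmod_pi (a *: x) = quotmod_scale a (quotmod_pi x).
Proof.
apply/quotmod_piP; rewrite -scalerBr rpredZ //.
by apply/quotmod_piP; rewrite /quotmod_pi reprK.
Qed.

Lemma quotmod_scaleA a b (q : quotmod) :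
  quotmod_scale a (quotmod_scale b q) = quotmod_scale (a * b) q.
Proof. by elim/quotmod_ind: q => x; rewrite -!quotmod_piZ scalerA. Qed.

Lemma quotmod_scale1 : left_id 1 quotmod_scale.
Proof. by elim/quotmod_ind => x; rewrite -quotmod_piZ scale1r. Qed.

Lemma quotmod_piD (x y : V) : quotmod_pi (x + y) = quotmod_pi x + quotmod_pi y.
Proof. by rewrite /quotmod_pi raddfD. Qed.

Lemma quotmod_scaleDr : right_distributive quotmod_scale +%R.
Proof.
move=> a; elim/quotmod_ind => x; elim/quotmod_ind => y.
by rewrite -quotmod_piD -!quotmod_piZ -quotmod_piD scalerDr.
Qed.

Lemma quotmod_scaleDl (q : quotmod) : {morph quotmod_scale^~ q : a b / a + b}.
Proof.
elim/quotmod_ind: q => x a b.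
by rewrite -!quotmod_piZ -quotmod_piD scalerDl.
Qed.

HB.instance Definition _ := GRing.Zmodule_isLmodule.Build R quotmod
  quotmod_scaleA quotmod_scale1 quotmod_scaleDr quotmod_scaleDl.

End SubQuotient.

Definition fin_gen (R : pzRingType) (V : lmodType R) : Prop :=
  exists s : seq V, forall x : V,
    exists c : 'I_(size s) -> R, x = \sum_(i < size s) c i *: s`_i.

Definition noetherian (R : pzRingType) : Prop :=
  forall I : submodClosed R^o, fin_gen (submod I).

(* [idealr_closed] includes properness. *)
Definition maximal_ideal (R : nzRingType) (m : {pred R}) : Prop :=
  idealr_closed m /\
  forall J : {pred R}, idealr_closed J -> {subset m <= J} -> m =i J.

HB.mixin Record isLocalRing R of GRing.ComNzRing R := {
  maxid : {pred R};
  maxid_maximal : maximal_ideal maxid;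
  maxid_unique : forall J : {pred R}, maximal_ideal J -> J =i maxid
}.

#[short(type="localRingType")]
HB.structure Definition LocalRing := {R of isLocalRing R & GRing.ComNzRing R}.

Section ResidueField.
Variable S : localRingType.

Definition maxid_submod : {pred S^o} := fun x => x \in @maxid S.

Let maxid_submod_closed : submod_closed maxid_submod.
Proof. by case: (@maxid_maximal S) => -[h0 _ hS] _. Qed.
HB.instance Definition _ := GRing.isSubmodClosed.Build S S^o maxid_submod
  (GRing.submod_closed_semi maxid_submod_closed).

Definition residue : Type := quotmod maxid_submod.
HB.instance Definition _ := GRing.Lmodule.on residue.
End ResidueField.

Section Localization.
Variables (R : comNzRingType) (p : prime_idealr R).

Definition compl : Type := {s : R | s \notin p}.
HB.instance Definition _ := [isSub of compl for @sval R (fun s => s \notin p)].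
HB.instance Definition _ := [Choice of compl by <:].

Lemma compl1_subproof : 1 \notin p. Proof. by rewrite idealr1. Qed.
Definition compl1 : compl := exist (fun s => s \notin p) 1 compl1_subproof.

Lemma compl_mul_subproof (s t : compl) : val s * val t \notin p.
Proof. by rewrite prime_idealrM negb_or (valP s) (valP t). Qed.
Definition compl_mul (s t : compl) : compl :=
  exist (fun s => s \notin p) (val s * val t) (compl_mul_subproof s t).

Section LocalizedModule.
Variable M : lmodType R.

(* Equality of the fractions x.1 / x.2 and y.1 / y.2. *)
Definition frac_eq (x y : M * compl) : bool :=
  `[< exists u : compl,
        (val u * val y.2) *: x.1 = (val u * val x.2) *: y.1 >].

Lemma frac_eq_is_equiv : equiv_class_of frac_eq.
Proof.
have h a b c (m n : M) : a *: m = b *: n -> (c * a) *: m = (c * b) *: n.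
  by move=> e; rewrite -!scalerA e.
split=> [x|x y|y x z].
- by apply/asboolP; exists compl1.
- by apply/asboolP/asboolP => -[u e]; exists u.
- move=> /asboolP[u e] /asboolP[v f]; apply/asboolP.
  exists (compl_mul (compl_mul u v) y.2) => /=.
  have e' := h _ _ (val v * val z.2) _ _ e.
  have f' := h _ _ (val u * val x.2) _ _ f.
  move: e' f'; rewrite (_ : val v * val z.2 * (val u * val x.2) =
    val u * val x.2 * (val v * val z.2)); last by ring.
  move=> e' f'.
  rewrite (_ : sval _ * sval _ * sval _ * val z.2 =
    val v * val z.2 * (val u * val y.2)); last by rewrite /=; ring.
  rewrite e' f'; congr (_ *: _); rewrite /=; ring.
Qed.
Canonical frac_equiv := EquivRelPack frac_eq_is_equiv.

Definition loc : Type := {eq_quot frac_eq}.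
HB.instance Definition _ := Choice.on loc.
HB.instance Definition _ := EqQuotient.on loc.

Definition mkfrac (m : M) (s : compl) : loc := \pi_loc (m, s).

Lemma mkfracP m s n t : reflect
  (exists u : compl, (val u * val t) *: m = (val u * val s) *: n)
  (mkfrac m s == mkfrac n t).
Proof. by rewrite /mkfrac piE; apply: asboolP. Qed.

Lemma loc_ind (P : loc -> Prop) : (forall m s, P (mkfrac m s)) -> forall x, P x.
Proof. by move=> h x; rewrite -[x]reprK; case: (repr x) => m s; exact: h. Qed.

Lemma mkfrac_repr (m : M) (s : compl) :
  mkfrac (repr (mkfrac m s)).1 (repr (mkfrac m s)).2 = mkfrac m s.
Proof. by rewrite /mkfrac -surjective_pairing reprK. Qed.

Definition loc_zero : loc := mkfrac 0 compl1.
Definition loc_opp (x : loc) : loc := mkfrac (- (repr x).1) (repr x).2.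
Definition loc_add (x y : loc) : loc :=
  mkfrac (val (repr y).2 *: (repr x).1 + val (repr x).2 *: (repr y).1)
         (compl_mul (repr x).2 (repr y).2).

Lemma loc_oppE m s : loc_opp (mkfrac m s) = mkfrac (- m) s.
Proof.
rewrite /loc_opp; have /eqP/mkfracP[u e] := mkfrac_repr m s.
by apply/eqP/mkfracP; exists u; rewrite !scalerN e.
Qed.

Lemma loc_addE m s n t : loc_add (mkfrac m s) (mkfrac n t) =
  mkfrac (val t *: m + val s *: n) (compl_mul s t).
Proof.
rewrite /loc_add; have /eqP/mkfracP := mkfrac_repr m s.
have /eqP/mkfracP := mkfrac_repr n t.
case: (repr (mkfrac n t)) => n' t'; case: (repr (mkfrac m s)) => m' s' /=.
move=> -[v f] [u e]; apply/eqP/mkfracP; exists (compl_mul u v) => /=.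
rewrite !scalerDr !scalerA; congr (_ + _).
- transitivity ((val v * val t * val t') *: ((val u * val s) *: m')).
    by rewrite scalerA; congr (_ *: _); rewrite /=; ring.
  by rewrite e scalerA; congr (_ *: _); rewrite /=; ring.
- transitivity ((val u * val s * val s') *: ((val v * val t) *: n')).
    by rewrite scalerA; congr (_ *: _); rewrite /=; ring.
  by rewrite f scalerA; congr (_ *: _); rewrite /=; ring.
Qed.

Lemma mkfrac_eq m s n t : val t *: m = val s *: n -> mkfrac m s = mkfrac n t.
Proof. by move=> e; apply/eqP/mkfracP; exists compl1; rewrite !mul1r. Qed.

Lemma loc_addA : associative loc_add.
Proof.
elim/loc_ind => m s; elim/loc_ind => n t; elim/loc_ind => k w.
rewrite !loc_addE; apply: mkfrac_eq; rewrite !scalerDr !scalerA addrA.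
by congr (_ *: _ + _ *: _ + _ *: _); rewrite /=; ring.
Qed.

Lemma loc_addC : commutative loc_add.
Proof.
elim/loc_ind => m s; elim/loc_ind => n t.
rewrite !loc_addE; apply: mkfrac_eq; rewrite addrC !scalerDr !scalerA.
by congr (_ *: _ + _ *: _); rewrite /=; ring.
Qed.

Lemma loc_add0 : left_id loc_zero loc_add.
Proof.
elim/loc_ind => m s; rewrite loc_addE scaler0 add0r.
by apply: mkfrac_eq; rewrite scalerA; congr (_ *: _); rewrite /=; ring.
Qed.

Lemma loc_addN : left_inverse loc_zero loc_opp loc_add.
Proof.
elim/loc_ind => m s; rewrite loc_oppE loc_addE; apply: mkfrac_eq.
by rewrite scalerN addNr !scaler0.
Qed.

HB.instance Definition _ := GRing.isZmodule.Build loc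
  loc_addA loc_addC loc_add0 loc_addN.

End LocalizedModule.

Definition loc_ring : Type := loc R^o.
HB.instance Definition _ := GRing.Zmodule.on loc_ring.

Section Action.
Variable M : lmodType R.

Definition loc_scale (x : loc_ring) (y : loc M) : loc M :=
  mkfrac (((repr x).1 : R) *: (repr y).1) (compl_mul (repr x).2 (repr y).2).

Lemma loc_scaleE (a : R) s (m : M) t :
  loc_scale (mkfrac (a : R^o) s) (mkfrac m t) = mkfrac (a *: m) (compl_mul s t).
Proof.
rewrite /loc_scale; have /eqP/mkfracP := mkfrac_repr m t.
have /eqP/mkfracP := mkfrac_repr (a : R^o) s.
case: (repr (mkfrac _ t)) => m' t'; case: (repr (mkfrac _ s)) => a' s' /=.
move=> -[u e] [v f]; apply/eqP/mkfracP; exists (compl_mul u v) => /=.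
have e' : val u * val s * a' = val u * val s' * a by exact: e.
rewrite !scalerA.
transitivity ((val u * val s * a') *: ((val v * val t) *: m')).
  by rewrite scalerA; congr (_ *: _); rewrite /=; ring.
by rewrite e' f scalerA; congr (_ *: _); rewrite /=; ring.
Qed.

Lemma loc_scaleDr : right_distributive loc_scale +%R.
Proof.
elim/loc_ind => a s; elim/loc_ind => m t; elim/loc_ind => n w.
rewrite [mkfrac m t + _]loc_addE !loc_scaleE [RHS]loc_addE.
apply: mkfrac_eq; rewrite !scalerDr !scalerA.
by congr (_ *: _ + _ *: _); rewrite /=; ring.
Qed.

Lemma loc_scaleDl (y : loc M) : {morph loc_scale^~ y : a b / a + b}.
Proof.
move: y; elim/loc_ind => m w; elim/loc_ind => a s; elim/loc_ind => b t.
rewrite [mkfrac a s + _]loc_addE !loc_scaleE [RHS]loc_addE.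
apply: mkfrac_eq; rewrite !scalerDl !scalerDr !scalerA -scalerDl.
by rewrite -scalerDl; congr (_ *: _); rewrite /= /GRing.scale /=; ring.
Qed.

End Action.

Definition loc_one : loc_ring := mkfrac (1 : R^o) compl1.
Definition loc_mul (x y : loc_ring) : loc_ring := @loc_scale R^o x y.

Lemma loc_scaleA (M : lmodType R) (x y : loc_ring) (z : loc M) :
  loc_scale x (loc_scale y z) = loc_scale (loc_mul x y) z.
Proof.
move: x y z; elim/loc_ind => a s; elim/loc_ind => b t; elim/loc_ind => m w.
rewrite /loc_mul (loc_scaleE a s (b : R^o) t) (loc_scaleE b t m w) !loc_scaleE.
apply: mkfrac_eq; rewrite !scalerA.
by congr (_ *: _); rewrite /= -[a *: _]/((a : R) * (b : R)); ring.
Qed.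

Lemma loc_scale1 (M : lmodType R) : left_id loc_one (@loc_scale M).
Proof.
elim/loc_ind => m s; rewrite loc_scaleE; apply: mkfrac_eq.
by rewrite !scalerA; congr (_ *: _); rewrite /=; ring.
Qed.

Lemma loc_mulC : commutative loc_mul.
Proof.
elim/loc_ind => a s; elim/loc_ind => b t; rewrite /loc_mul !loc_scaleE.
by apply: mkfrac_eq; rewrite /GRing.scale /=; ring.
Qed.

Lemma loc_mulA : associative loc_mul.
Proof. by move=> x y z; rewrite {1}/loc_mul loc_scaleA. Qed.

Lemma loc_mul1 : left_id loc_one loc_mul.
Proof. exact: loc_scale1. Qed.

Lemma loc_mulDl : left_distributive loc_mul +%R.
Proof. by move=> x y z; exact: loc_scaleDl. Qed.

Lemma loc_one_neq0 : loc_one != 0 :> loc_ring.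
Proof.
apply/negP => /mkfracP[u] e.
have /eqP : val u * 1 * 1 = val u * 1 * 0 :> R by exact: e.
by rewrite mulr0 !mulr1 => /eqP u0; have := valP u; rewrite /= u0 rpred0.
Qed.

HB.instance Definition _ := GRing.Zmodule_isComNzRing.Build loc_ring
  loc_mulA loc_mulC loc_mul1 loc_mulDl loc_one_neq0.

HB.instance Definition _ (M : lmodType R) :=
  GRing.Zmodule_isLmodule.Build loc_ring (loc M)
    (@loc_scaleA M) (@loc_scale1 M) (@loc_scaleDr M) (@loc_scaleDl M).

Definition loc_maxid : {pred loc_ring} := fun x =>
  `[< exists (a : R) (s : compl), a \in p /\ x = mkfrac (a : R^o) s >].

Lemma loc_maxidE (a : R) s :
  ((mkfrac (a : R^o) s : loc_ring) \in loc_maxid) = (a \in p).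
Proof.
apply/asboolP/idP => [[b [t [pb /eqP/mkfracP[u e]]]]|pa]; last by exists a, s.
have {}e : val u * val t * a = val u * val s * b :> R by exact: e.
have : val u * val t * a \in p by rewrite e prime_idealrM pb orbT.
by rewrite 2!prime_idealrM (negPf (valP u)) (negPf (valP t)).
Qed.

Lemma loc_maxid_closed : idealr_closed loc_maxid.
Proof.
split; first by rewrite (loc_maxidE 0 compl1) rpred0.
  by rewrite (loc_maxidE 1 compl1) idealr1.
elim/loc_ind => a s; elim/loc_ind => x t; elim/loc_ind => y w.
rewrite (loc_maxidE x t) (loc_maxidE y w) => px py.
rewrite -[X in X \in _]/(loc_add (loc_scale (mkfrac a s) (mkfrac x t))
  (mkfrac y w)).
rewrite (loc_scaleE a s x t) loc_addE loc_maxidE.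
by rewrite rpredD // idealMr // idealMr.
Qed.

Lemma loc_maxid_sup (J : {pred loc_ring}) :
  idealr_closed J -> {subset J <= loc_maxid}.
Proof.
case=> J0 J1 JD; elim/loc_ind => a s Jx; rewrite loc_maxidE.
apply: contraT => pa; case/negP: J1.
have -> : 1 = (mkfrac (val s : R^o) (exist _ a pa : compl) : loc_ring)
              * mkfrac (a : R^o) s + 0.
  rewrite addr0 [_ * _]loc_scaleE; apply: mkfrac_eq.
  by rewrite /= /GRing.scale /=; ring.
exact: JD.
Qed.

Lemma loc_maxid_maximal : maximal_ideal loc_maxid.
Proof.
split=> [|J JI sJ x]; first exact: loc_maxid_closed.
by apply/idP/idP; [exact: sJ | exact: loc_maxid_sup].
Qed.

Lemma loc_maxid_unique (J : {pred loc_ring}) :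
  maximal_ideal J -> J =i loc_maxid.
Proof.
by case=> JI Jmax; apply: Jmax; [exact: loc_maxid_closed|exact: loc_maxid_sup].
Qed.

HB.instance Definition _ := isLocalRing.Build loc_ring
  loc_maxid_maximal loc_maxid_unique.

End Localization.


Definition in_supp (R : comNzRingType) (M : lmodType R) (p : prime_idealr R) :
    Prop :=
  exists x : loc p M, x <> 0.

(* Homological grading. The differential is given for every pair of degrees,
   and vanishes unless the degree drops by one: this avoids casts between
   [X (i - 1 + 1)] and [X i]. *)
Record complex (R : pzRingType) := Complex {
  obj :> int -> lmodType R;
  diff : forall i j : int, {linear obj i -> obj j};
  diff_shape : forall (i j : int), i != j + 1 -> forall x, diff i j x = 0;
  diffK : forall (i j k : int) x, diff j k (diff i j x) = 0
}.
Arguments diff {R} c i j.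

Section Homology.
Variables (R : pzRingType) (X : complex R) (n : int).

Definition cycles : {pred X n} := fun x => diff X n (n - 1) x == 0.

Let cycles_closed : submod_closed cycles.
Proof.
split=> [|a x y]; rewrite /cycles !unfold_in ?linear0 // => /eqP x0 /eqP y0.
by rewrite linearP x0 y0 scaler0 addr0.
Qed.
HB.instance Definition _ := GRing.isSubmodClosed.Build R (X n) cycles
  (GRing.submod_closed_semi cycles_closed).

Definition boundaries : {pred submod cycles} := fun z =>
  `[< exists y : X (n + 1), diff X (n + 1) n y = val z >].

Let boundaries_closed : submod_closed boundaries.
Proof.
split=> [|a x y]; first by apply/asboolP; exists 0; rewrite linear0.
move=> /asboolP[x' ex] /asboolP[y' ey]; apply/asboolP; exists (a *: x' + y').
by rewrite linearP ex ey.
Qed.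
HB.instance Definition _ := GRing.isSubmodClosed.Build R (submod cycles)
  boundaries (GRing.submod_closed_semi boundaries_closed).

Definition homology : Type := quotmod boundaries.
HB.instance Definition _ := GRing.Lmodule.on homology.

Definition nonzero_homology : Prop := exists h : homology, h <> 0.

End Homology.
Arguments cycles {R} X n _.
Arguments boundaries {R} X n _.

Definition acyclic (R : pzRingType) (X : complex R) : Prop :=
  forall n, ~ nonzero_homology X n.

Definition bounded_homology (R : pzRingType) (X : complex R) : Prop :=
  exists b : int, forall n, b < `|n| -> ~ nonzero_homology X n.

Record chain_map (R : pzRingType) (X Y : complex R) := ChainMap {
  chain :> forall i : int, {linear X i -> Y i};
  chain_diff : forall i j x, chain j (diff X i j x) = diff Y i j (chain i x)
}.

Section HomologyMap.
Variables (R : pzRingType) (X Y : complex R) (f : chain_map X Y) (n : int).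

Lemma chain_cycles (z : submod (cycles X n)) : f n (val z) \in cycles Y n.
Proof. by rewrite unfold_in -chain_diff (eqP (valP z)) linear0. Qed.

Definition cycles_map (z : submod (cycles X n)) : submod (cycles Y n) :=
  exist (fun y => y \in cycles Y n) (f n (val z)) (chain_cycles z).

Definition homology_map (h : homology X n) : homology Y n :=
  quotmod_pi (boundaries Y n) (cycles_map (repr h)).

Lemma homology_mapE (z : submod (cycles X n)) :
  homology_map (quotmod_pi (boundaries X n) z) =
  quotmod_pi (boundaries Y n) (cycles_map z).
Proof.
apply/quotmod_piP; set z' := repr _.
have /quotmod_piP/asboolP[y ey] :
  quotmod_pi (boundaries X n) z' = quotmod_pi (boundaries X n) z.
  by rewrite /quotmod_pi reprK.
apply/asboolP; exists (f (n + 1) y).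
by rewrite -chain_diff ey !raddfB.
Qed.

End HomologyMap.

Definition quasi_iso (R : pzRingType) (X Y : complex R) (f : chain_map X Y) : Prop :=
  forall n, bijective (@homology_map R X Y f n).

Definition null_homotopic (R : pzRingType) (X Y : complex R) (f : chain_map X Y) :
    Prop :=
  exists h : forall i j : int, {linear X i -> Y j}, forall (i : int) (x : X i),
    f i x = diff Y (i + 1) i (h i (i + 1) x)
            + h (i - 1) i (diff X i (i - 1) x).

Section Stalk.
Variables (R : pzRingType) (M : lmodType R).

Definition stalk_obj (n : int) : lmodType R := if n == 0 then M else 'rV[R]_0.

Definition stalk : complex R.
Proof.
by refine (@Complex R stalk_obj (fun i j => \0) _ _).
Defined.
End Stalk.

Section HomModule.
Variables (R : comNzRingType) (U V : lmodType R).

Definition linear_pred : {pred (U -> V)} := fun f => `[< linear f >].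

Let linear_pred_closed : submod_closed linear_pred.
Proof.
split=> [|a f g]; first by apply/asboolP => b x y; rewrite scaler0 addr0.
move=> /asboolP lf /asboolP lg; apply/asboolP => b x y.
rewrite [LHS]/GRing.add /= [X in _ = _ *: X + _]/GRing.add /=.
rewrite [X in _ = _ + X]/GRing.add /= [LHS](_ : _ = a *: f (b *: x + y) + g (b *: x + y)) //.
rewrite [RHS](_ : _ = b *: (a *: f x + g x) + (a *: f y + g y)) //.
rewrite lf lg !scalerDr !scalerA [b * a]mulrC -!addrA; congr (_ + _).
by rewrite addrCA.
Qed.
HB.instance Definition _ := GRing.isSubmodClosed.Build R (U -> V)
  linear_pred (GRing.submod_closed_semi linear_pred_closed).

Definition hom : Type := submod linear_pred.
HB.instance Definition _ := GRing.Lmodule.on hom.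

Definition hom_fun (f : hom) : U -> V := val f.

Lemma hom_linear (f : hom) : linear (hom_fun f).
Proof. exact/asboolP/(valP f). Qed.

End HomModule.
Arguments linear_pred {R} U V _.

Section HomComplex.
Variables (R : comNzRingType) (L : lmodType R) (X : complex R).

Lemma hom_diff_subproof i j (f : hom L (X i)) :
  diff X i j \o hom_fun f \in linear_pred L (X j).
Proof.
by apply/asboolP => a x y /=; rewrite hom_linear linearP.
Qed.

Definition hom_diff i j (f : hom L (X i)) : hom L (X j) :=
  exist (fun g => g \in linear_pred L (X j))
    (diff X i j \o hom_fun f) (hom_diff_subproof j f).

Lemma hom_diff_linear i j : linear (@hom_diff i j).
Proof.
move=> a f g; apply/val_inj/funext => x /=.
rewrite /hom_fun (_ : val (a *: f + g) x = a *: val f x + val g x) //.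
by rewrite linearP.
Qed.
HB.instance Definition _ i j :=
  GRing.isLinear.Build R (hom L (X i)) (hom L (X j)) *:%R (@hom_diff i j)
    (@hom_diff_linear i j).

Lemma hom_diff_shape (i j : int) : i != j + 1 ->
  forall f : hom L (X i), hom_diff j f = 0.
Proof.
move=> ij f; apply/val_inj/funext => x /=; exact: diff_shape.
Qed.

Lemma hom_diffK (i j k : int) (f : hom L (X i)) :
  hom_diff k (hom_diff j f) = 0.
Proof. by apply/val_inj/funext => x /=; exact: diffK. Qed.

Definition hom_complex : complex R :=
  @Complex R (fun n => hom L (X n) : lmodType R)
    (fun i j => @hom_diff i j : {linear _ -> _}) hom_diff_shape hom_diffK.

End HomComplex.

Section SumOfTensors.
Variables (R : comNzRingType) (I : Type) (P : pred I) (A B : I -> lmodType R).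

Definition tgen : Type := {i : I & (A i * B i)%type}.
Definition tpair (i : I) (a : A i) (b : B i) : tgen :=
  existT (fun i => (A i * B i)%type) i (a, b).

(* [tens] is the direct sum of the [A i \otimes B i] over the [i] with [P i],
   presented by generators and relations: finite formal sums of pure tensors
   modulo bilinearity, where [trel_off] discards the summands outside of [P].
   The relation is between elements of a commutative monoid; opposites are given
   by [-1 *: _]. *)
Inductive trel : seq tgen -> seq tgen -> Prop :=
| trel_refl s : trel s s
| trel_sym s t : trel s t -> trel t s
| trel_trans s t u : trel s t -> trel t u -> trel s u
| trel_cat s s' t t' : trel s s' -> trel t t' -> trel (s ++ t) (s' ++ t')
| trel_comm s t : trel (s ++ t) (t ++ s)
| trel_addl i (a a' : A i) (b : B i) :
    trel [:: tpair (a + a') b] [:: tpair a b; tpair a' b]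
| trel_addr i (a : A i) (b b' : B i) :
    trel [:: tpair a (b + b')] [:: tpair a b; tpair a b']
| trel_scale i c (a : A i) (b : B i) :
    trel [:: tpair (c *: a) b] [:: tpair a (c *: b)]
| trel_zero i (b : B i) : trel [:: tpair 0 b] [::]
| trel_off i (a : A i) (b : B i) : ~~ P i -> trel [:: tpair a b] [::].

Definition tsum : Type := {classic (seq tgen)}.
HB.instance Definition _ := Choice.on tsum.
Definition trelb (s t : tsum) : bool := `[< trel s t >].

Lemma trelb_is_equiv : equiv_class_of trelb.
Proof.
split=> [s|s t|t s u].
- by apply/asboolP; exact: trel_refl.
- by apply/asboolP/asboolP => /trel_sym.
- by move=> /asboolP st /asboolP tu; apply/asboolP; exact: trel_trans st tu.
Qed.
Canonical trelb_equiv := EquivRelPack trelb_is_equiv.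

Definition tens : Type := {eq_quot trelb}.
HB.instance Definition _ := Choice.on tens.
HB.instance Definition _ := EqQuotient.on tens.

Definition tclass (s : seq tgen) : tens := \pi_tens (s : tsum).

Lemma tclassP s t : tclass s = tclass t <-> trel s t.
Proof.
split=> [/eqP|st]; first by rewrite /tclass piE => /asboolP.
by apply/eqP; rewrite /tclass piE; apply/asboolP.
Qed.

Lemma trel_repr s : trel (repr (tclass s)) s.
Proof. by apply/tclassP; rewrite /tclass reprK. Qed.

Lemma tens_ind (Q : tens -> Prop) : (forall s, Q (tclass s)) -> forall x, Q x.
Proof. by move=> h x; rewrite -[x]reprK; exact: h. Qed.

Definition tgen_scale (c : R) (g : tgen) : tgen :=
  tpair (c *: (tagged g).1) (tagged g).2.

Definition tens_add (x y : tens) : tens := tclass (repr x ++ repr y).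
Definition tens_scale (c : R) (x : tens) : tens :=
  tclass (map (tgen_scale c) (repr x)).

Lemma tens_addE s t : tens_add (tclass s) (tclass t) = tclass (s ++ t).
Proof. by apply/tclassP; apply: trel_cat; exact: trel_repr. Qed.

Lemma trel_map c s t :
  trel s t -> trel (map (tgen_scale c) s) (map (tgen_scale c) t).
Proof.
elim=> {s t} /=; rewrite /tgen_scale /=.
- by move=> *; exact: trel_refl.
- by move=> *; exact: trel_sym.
- by move=> s t u _ + _; exact: trel_trans.
- by move=> s s' t t' _ ? _ ?; rewrite !map_cat; exact: trel_cat.
- by move=> s t; rewrite !map_cat; exact: trel_comm.
- by move=> i a a' b; rewrite scalerDr; exact: trel_addl.
- by move=> *; exact: trel_addr.
- move=> i d a b; rewrite scalerA mulrC -scalerA; exact: trel_scale.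
- by move=> i b; rewrite scaler0; exact: trel_zero.
- by move=> *; exact: trel_off.
Qed.

Lemma tens_scaleE c s : tens_scale c (tclass s) = tclass (map (tgen_scale c) s).
Proof. by apply/tclassP/trel_map/trel_repr. Qed.

Definition tens_zero : tens := tclass [::].
Definition tens_opp (x : tens) : tens := tens_scale (-1) x.

Lemma tens_addA : associative tens_add.
Proof.
elim/tens_ind=> s; elim/tens_ind=> t; elim/tens_ind=> u.
by rewrite !(tens_addE s, tens_addE t, tens_addE) catA.
Qed.

Lemma tens_addC : commutative tens_add.
Proof.
elim/tens_ind=> s; elim/tens_ind=> t; rewrite (tens_addE s) (tens_addE t).
by apply/tclassP; exact: trel_comm.
Qed.

Lemma tens_add0 : left_id tens_zero tens_add.
Proof. by elim/tens_ind=> s; rewrite (tens_addE [::]). Qed.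

Lemma trel_swap g h s t : trel (g :: s ++ h :: t) (g :: h :: s ++ t).
Proof.
apply: (@trel_cat [:: g] [:: g]); first exact: trel_refl.
rewrite -cat_rcons -cat_cons; apply: trel_cat; last exact: trel_refl.
by rewrite -cats1 -[h :: s]cat1s; exact: trel_comm.
Qed.

Lemma trel_scaleDl a b s :
  trel (map (tgen_scale a) s ++ map (tgen_scale b) s)
       (map (tgen_scale (a + b)) s).
Proof.
elim: s => [|[i [x y]] s IH] /=; first exact: trel_refl.
rewrite /tgen_scale /= scalerDl.
apply: (@trel_trans _ ([:: tpair (a *: x) y; tpair (b *: x) y] ++
   (map (tgen_scale a) s ++ map (tgen_scale b) s))); last first.
  rewrite -[X in trel _ X]cat1s; apply: trel_cat => //.
  by apply: trel_sym; exact: trel_addl.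
exact: trel_swap.
Qed.

Lemma tens_scaleDl (x : tens) a b :
  tens_scale (a + b) x = tens_add (tens_scale a x) (tens_scale b x).
Proof.
elim/tens_ind: x => s; rewrite !(tens_scaleE _ s) tens_addE.
by apply/tclassP/trel_sym/trel_scaleDl.
Qed.

Lemma tens_scale0 (x : tens) : tens_scale 0 x = tens_zero.
Proof.
elim/tens_ind: x => s; rewrite (tens_scaleE 0 s).
apply/(tclassP _ [::]); elim: s => [|[i [x y]] s IH] /=; first exact: trel_refl.
rewrite -cat1s; apply: (@trel_cat _ [::] _ [::] _ IH).
by rewrite /tgen_scale scale0r; exact: trel_zero.
Qed.

Lemma tens_scale1 : left_id 1 tens_scale.
Proof.
elim/tens_ind=> s; rewrite tens_scaleE; congr tclass.
rewrite -[RHS]map_id; apply: eq_map => -[i [x y]].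
by rewrite /tgen_scale /= scale1r.
Qed.

Lemma tens_addN : left_inverse tens_zero tens_opp tens_add.
Proof.
move=> x; rewrite /tens_opp -{2}[x]tens_scale1 -tens_scaleDl addNr.
exact: tens_scale0.
Qed.

HB.instance Definition _ := GRing.isZmodule.Build tens
  tens_addA tens_addC tens_add0 tens_addN.

Lemma tens_scaleA a b (x : tens) :
  tens_scale a (tens_scale b x) = tens_scale (a * b) x.
Proof.
elim/tens_ind: x => s; rewrite !(tens_scaleE _ s) tens_scaleE -map_comp.
congr tclass; apply: eq_map => -[i [x y]].
by rewrite /tgen_scale /= scalerA.
Qed.

Lemma tens_scaleDr : right_distributive tens_scale +%R.
Proof.
move=> a; elim/tens_ind=> s; elim/tens_ind=> t.
rewrite [tclass s + _]tens_addE !(tens_scaleE _ s, tens_scaleE _ t, tens_scaleE).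
by rewrite [RHS]tens_addE map_cat.
Qed.

HB.instance Definition _ := GRing.Zmodule_isLmodule.Build R tens
  tens_scaleA tens_scale1 tens_scaleDr (fun x a b => tens_scaleDl x a b).

Definition pure (i : I) (a : A i) (b : B i) : tens := tclass [:: tpair a b].

Lemma tclass_cat s t : tclass (s ++ t) = tclass s + tclass t.
Proof. by rewrite [RHS]tens_addE. Qed.

Lemma pureDl i (a a' : A i) (b : B i) : pure (a + a') b = pure a b + pure a' b.
Proof. by rewrite -tclass_cat; apply/tclassP; exact: trel_addl. Qed.

Lemma pureDr i (a : A i) (b b' : B i) : pure a (b + b') = pure a b + pure a b'.
Proof. by rewrite -tclass_cat; apply/tclassP; exact: trel_addr. Qed.

Lemma pureZl i c (a : A i) (b : B i) : pure (c *: a) b = c *: pure a b.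
Proof. by rewrite [RHS]tens_scaleE. Qed.

Lemma pureZr i c (a : A i) (b : B i) : pure a (c *: b) = c *: pure a b.
Proof. by rewrite -pureZl; apply/esym/tclassP; exact: trel_scale. Qed.

Lemma pure_off i (a : A i) (b : B i) : ~~ P i -> pure a b = 0.
Proof. by move=> Pi; apply/(tclassP _ [::]); exact: trel_off. Qed.

Lemma pure0l i (b : B i) : pure (0 : A i) b = 0.
Proof. by apply/(tclassP _ [::]); exact: trel_zero. Qed.

Lemma pure0r i (a : A i) : pure a (0 : B i) = 0.
Proof. by rewrite -(scale0r 0) pureZr scale0r. Qed.

Lemma tens_pure_ind (Q : tens -> Prop) : Q 0 -> (forall x y, Q x -> Q y -> Q (x + y)) ->
  (forall i (a : A i) (b : B i), Q (pure a b)) -> forall x, Q x.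
Proof.
move=> Q0 QD Qp; elim/tens_ind; elim=> [|[i [a b]] s IH]; first exact: Q0.
by rewrite -cat1s tclass_cat; apply: QD => //; exact: Qp.
Qed.

Section Lift.
Variables (W : lmodType R) (f : forall i, A i -> B i -> W).
Hypothesis fDl : forall i (a a' : A i) (b : B i), f (a + a') b = f a b + f a' b.
Hypothesis fDr : forall i (a : A i) (b b' : B i), f a (b + b') = f a b + f a b'.
Hypothesis fZl : forall i c (a : A i) (b : B i), f (c *: a) b = c *: f a b.
Hypothesis fZr : forall i c (a : A i) (b : B i), f a (c *: b) = c *: f a b.
Hypothesis foff : forall i (a : A i) (b : B i), ~~ P i -> f a b = 0.

Definition tens_lift (x : tens) : W :=
  \sum_(g <- repr x) f (tagged g).1 (tagged g).2.

Lemma trel_sum s t : trel s t ->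
  \sum_(g <- s) f (tagged g).1 (tagged g).2
  = \sum_(g <- t) f (tagged g).1 (tagged g).2.
Proof.
elim=> {s t} //=.
- by move=> s t u _ -> _ ->.
- by move=> s s' t t' _ es _ et; rewrite !big_cat es et.
- by move=> s t; rewrite !big_cat /= addrC.
- by move=> i a a' b; rewrite !big_cons !big_nil !addr0 fDl.
- by move=> i a b b'; rewrite !big_cons !big_nil !addr0 fDr.
- by move=> i c a b; rewrite !big_cons !big_nil !addr0 fZl fZr.
- by move=> i b; rewrite !big_cons !big_nil addr0 -(scale0r 0) fZl scale0r.
- by move=> i a b Pi; rewrite !big_cons !big_nil addr0 foff.
Qed.

Lemma tens_lift_class s :
  tens_lift (tclass s) = \sum_(g <- s) f (tagged g).1 (tagged g).2.
Proof. exact/trel_sum/trel_repr. Qed.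

Lemma tens_lift_linear : linear tens_lift.
Proof.
move=> c; elim/tens_ind=> s; elim/tens_ind=> t.
rewrite [c *: _]tens_scaleE -tclass_cat !tens_lift_class big_cat; congr (_ + _).
by rewrite big_map scaler_sumr; apply: eq_bigr => g _; rewrite fZl.
Qed.

Lemma tens_lift_pure i (a : A i) (b : B i) : tens_lift (pure a b) = f a b.
Proof. by rewrite tens_lift_class big_cons big_nil addr0. Qed.

End Lift.

End SumOfTensors.

(* In degree [n] this is the direct sum of the [X i \otimes Y j], i + j = n, with
   d (x \otimes y) = d x \otimes y + (-1) ^ i (x \otimes d y). *)
Section TensorComplex.
Variables (R : comNzRingType) (X Y : complex R).

Definition tensor_obj (n : int) : lmodType R :=
  tens (fun q : int * int => q.1 + q.2 == n) (fun q => X q.1) (fun q => Y q.2).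

Definition tensor_pure (n i j : int) (x : X i) (y : Y j) : tensor_obj n :=
  @pure R (int * int)%type _ (fun q => X q.1) (fun q => Y q.2) (i, j) x y.

Definition tensor_diff_pure (n m : int) (q : int * int) (x : X q.1) (y : Y q.2) :
    tensor_obj m :=
  if n == m + 1 then
    tensor_pure m (diff X q.1 (q.1 - 1) x) y
    + (-1) ^+ `|q.1|%N *: tensor_pure m x (diff Y q.2 (q.2 - 1) y)
  else 0.

Definition tensor_diff (n m : int) : tensor_obj n -> tensor_obj m :=
  tens_lift (tensor_diff_pure n m).

Section DiffPure.
Variables n m : int.

Let fDl q (x x' : X q.1) (y : Y q.2) : tensor_diff_pure n m (x + x') y =
  tensor_diff_pure n m x y + tensor_diff_pure n m x' y.
Proof.
rewrite /tensor_diff_pure /tensor_pure; case: eqP => _; last by rewrite addr0.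
by rewrite linearD !pureDl scalerDr addrACA.
Qed.

Let fDr q (x : X q.1) (y y' : Y q.2) : tensor_diff_pure n m x (y + y') =
  tensor_diff_pure n m x y + tensor_diff_pure n m x y'.
Proof.
rewrite /tensor_diff_pure /tensor_pure; case: eqP => _; last by rewrite addr0.
by rewrite linearD !pureDr scalerDr addrACA.
Qed.

Let fZl q c (x : X q.1) (y : Y q.2) :
  tensor_diff_pure n m (c *: x) y = c *: tensor_diff_pure n m x y.
Proof.
rewrite /tensor_diff_pure /tensor_pure; case: eqP => _; last by rewrite scaler0.
by rewrite linearZ !pureZl scalerDr !scalerA [c * _]mulrC.
Qed.

Let fZr q c (x : X q.1) (y : Y q.2) :
  tensor_diff_pure n m x (c *: y) = c *: tensor_diff_pure n m x y.
Proof.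
rewrite /tensor_diff_pure /tensor_pure; case: eqP => _; last by rewrite scaler0.
by rewrite linearZ !pureZr scalerDr !scalerA [c * _]mulrC.
Qed.

Let foff (q : int * int) (x : X q.1) (y : Y q.2) :
  ~~ (q.1 + q.2 == n) -> tensor_diff_pure n m x y = 0.
Proof.
rewrite /tensor_diff_pure /tensor_pure => h; case: eqP => // e.
rewrite !pure_off ?scaler0 ?addr0 //=; apply: contra h => /eqP h; apply/eqP.
  by rewrite e -h; ring.
by rewrite e -h; ring.
Qed.

Lemma tensor_diff_linear : linear (@tensor_diff n m).
Proof. exact: tens_lift_linear. Qed.

Lemma tensor_diffE i j (x : X i) (y : Y j) :
  tensor_diff m (tensor_pure n x y) = @tensor_diff_pure n m (i, j) x y.
Proof. exact: tens_lift_pure. Qed.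

End DiffPure.

HB.instance Definition _ n m :=
  GRing.isLinear.Build R (tensor_obj n) (tensor_obj m) *:%R (@tensor_diff n m)
    (@tensor_diff_linear n m).

Lemma tensor_diff_shape (n m : int) : n != m + 1 ->
  forall z : tensor_obj n, tensor_diff m z = 0.
Proof.
move=> nm; elim/tens_pure_ind => [|z w ez ew|[i j] x y]; first exact: linear0.
  by rewrite linearD [X in X + _]ez [X in _ + X]ew addr0.
by rewrite [LHS]tensor_diffE /tensor_diff_pure (negPf nm).
Qed.

Lemma tensor_diffK (n m k : int) (z : tensor_obj n) :
  tensor_diff k (tensor_diff m z) = 0.
Proof.
have [nm|nm] := eqVneq n (m + 1); last by rewrite (tensor_diff_shape nm) linear0.
have [mk|mk] := eqVneq m (k + 1); last by rewrite (tensor_diff_shape mk).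
move: z; elim/tens_pure_ind => [|z w ez ew|[i j] x y]; first by rewrite !linear0.
  by rewrite !linearD [X in X + _]ez [X in _ + X]ew addr0.
rewrite [tensor_diff m _]tensor_diffE /tensor_diff_pure nm eqxx.
rewrite linearD linearZ /= !tensor_diffE /tensor_diff_pure mk eqxx /=.
rewrite !diffK /tensor_pure pure0l pure0r add0r scaler0 addr0 -scalerDl.
suff -> : (-1) ^+ `|(i - 1)%R|%N + (-1) ^+ `|i|%N = 0 :> R by rewrite scale0r.
clear x y; case: i => [[|i]|i].
- by rewrite sub0r expr1 expr0 addNr.
- have -> : Posz i.+1 - 1 = Posz i by rewrite -addn1 PoszD addrK.
  rewrite !absz_nat.
  by rewrite exprSr mulrN1 subrr.
- have -> : Negz i - 1 = - Posz i.+2.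
    by rewrite NegzE -opprD -[in RHS]addn1 PoszD.
  rewrite NegzE !abszN !absz_nat.
  by rewrite [in X in X + _]exprSr mulrN1 addNr.
Qed.

Definition tensor : complex R :=
  @Complex R tensor_obj (fun n m => @tensor_diff n m : {linear _ -> _})
    tensor_diff_shape tensor_diffK.

End TensorComplex.

Section Resolutions.
Variable R : comNzRingType.

Definition injective_module (E : lmodType R) : Prop :=
  forall (U V : lmodType R) (f : {linear U -> V}) (g : {linear U -> E}),
    injective f -> exists h : {linear V -> E}, forall x, h (f x) = g x.

Definition projective_module (P : lmodType R) : Prop :=
  forall (U V : lmodType R) (f : {linear U -> V}) (g : {linear P -> V}),
    (forall y, exists x, f x = y) ->
    exists h : {linear P -> U}, forall x, f (h x) = g x.

Definition K_injective (I : complex R) : Prop :=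
  forall A : complex R, acyclic A -> forall f : chain_map A I, null_homotopic f.

Definition K_projective (P : complex R) : Prop :=
  forall A : complex R, acyclic A -> forall f : chain_map P A, null_homotopic f.

(* A quasi-isomorphism with a K-injective complex in the derived category is
   the class of a chain map into it, and dually for K-projective complexes. *)
Definition injective_resolution (X I : complex R) : Prop :=
  [/\ K_injective I, forall n, injective_module (I n)
    & exists f : chain_map X I, quasi_iso f].

Definition semiprojective_resolution (X P : complex R) : Prop :=
  [/\ K_projective P, forall n, projective_module (P n)
    & exists f : chain_map P X, quasi_iso f].

Definition projective_resolution (M : lmodType R) (P : complex R) : Prop :=
  [/\ forall n, n < 0 -> forall x : P n, x = 0,
      forall n, projective_module (P n)
    & exists f : chain_map P (stalk M), quasi_iso f].

(* Non-vanishing of Tor_i(M, N). It does not depend on the resolution, as any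
   two projective resolutions of [M] are homotopy equivalent; [tensor P (stalk N)]
   is the complex of the [P n \otimes N]. *)
Definition tor_nonzero (M N : lmodType R) (i : nat) : Prop :=
  exists P : complex R,
    projective_resolution M P /\ nonzero_homology (tensor P (stalk N)) i%:Z.

Definition q_tor (M N : lmodType R) : \bar int :=
  esup [set (i%:Z)%:E | i in [set i : nat | tor_nonzero M N i]]%classic.

End Resolutions.

Section Depth.
Variable S : localRingType.

(* Any two injective resolutions of [X] are homotopy equivalent, so the set below
   is the same as for any fixed one. *)
Definition depth (X : complex S) : \bar int :=
  einf [set i%:E | i in [set i : int | exists I : complex S,
    injective_resolution X I /\
    nonzero_homology (hom_complex (residue S) I) (- i)]]%classic.

Definition module_depth (M : lmodType S) : \bar int := depth (stalk M).

Definition ring_depth : \bar int := module_depth S^o.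

Definition fg_complex (X : complex S) : Prop := forall n, fin_gen (X n).

(* For a semiprojective resolution [P] of [X], [tensor P Y] is the derived tensor
   product of [X] and [Y]; all choices of [P] give homotopy equivalent complexes.
   No [+oo - oo] occurs: over a Noetherian local ring, the depth of [S] is finite,
   and homologically bounded complexes have depth > -oo. *)
Definition derived_ldep : Prop :=
  forall X Y : complex S, fg_complex X -> fg_complex Y ->
    bounded_homology X -> bounded_homology Y ->
  forall P : complex S, semiprojective_resolution X P ->
    bounded_homology (tensor P Y) ->
  (depth X + depth Y <= depth (tensor P Y) + ring_depth)%E.

Definition derived_rdep : Prop :=
  forall X Y : complex S, fg_complex X -> fg_complex Y ->
    bounded_homology X -> bounded_homology Y ->
  forall P : complex S, semiprojective_resolution X P ->
    bounded_homology (tensor P Y) ->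
  (depth (tensor P Y) + ring_depth <= depth X + depth Y)%E.

End Depth.

Definition sup_depth_defect (R : comNzRingType) (M N : lmodType R) : \bar int :=
  esup [set d | exists p : prime_idealr R,
    [/\ in_supp M p, in_supp N p
      & d = (ring_depth (loc_ring p)
             - module_depth (loc p M) - module_depth (loc p N))%E]]%classic.

(* Main.v *)
(* Write [q] for the largest degree in which [Tor(M, N)] is nonzero, and [T] for the
   complex computing it. Localizing at a prime [p], the inequalities (ldep) and (rdep)
   for [M_p] and [N_p] compare [depth R_p - depth M_p - depth N_p] with [- depth T_p].
   Since [T_p] has no homology above degree [q], [depth T_p >= - q], which gives (2).
   For (1), take [p] associated to [H_q(T)]: the residue field of [R_p] embeds in the
   top homology of [T_p], so that [depth T_p <= - q]. Here one needs that [depth R_p]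
   is finite, and then (ldep) bounds [depth M_p] and [depth N_p], so that [p] lies in
   both supports.

   Both depth estimates come from one fact: if [I] is K-injective with no homology
   above degree [s], then [I] is contractible above [s] and the quotient map from the
   [s]-cycles to [H_s(I)] splits. The depth of a local ring is finite because otherwise
   an injective resolution [I] of the ring and its iterated mapping cones by generators
   of the maximal ideal are orthogonal to the residue field; but the last cone has a
   nonzero top homology module killed by the maximal ideal. *)

From HB Require Import structures.
Require Import Defs.
From mathcomp Require Import all_boot all_order all_algebra.
From mathcomp Require Import ring_quotient generic_quotient.
From mathcomp Require Import boolp classical_sets functions constructive_ereal.
From mathcomp Require Import ring zify.

Set Implicit Arguments.
Unset Strict Implicit.
Unset Printing Implicit Defensive.

Import Order.TTheory GRing.Theory Num.Theory.

Local Open Scope ring_scope.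
Local Open Scope quotient_scope.

(** * Linear maps and complexes *)

Section Linear.
Variable R : pzRingType.

(** [depth] is an infimum over all injective resolutions, and no two resolutions are ever compared
    up to homotopy. A lower bound must therefore hold for an arbitrary K-injective complex, possibly
    unbounded above; this is why the splitting is read off from a null homotopy and not from a
    bounded model. An upper bound needs a single resolution, and the one constructed is zero above
    degree [s]. Injective modules are never localized: the tensor complex is compared with its
    localization by clearing denominators, and injective resolutions are taken afterwards, over the
    local ring. In the proof that the depth is finite, Nakayama's lemma is avoided, as it would
    require finitely generated homology of the cones. Instead a functional from [H_0] to the residue
    field is carried along. It passes to the next cone because the homology in degree -1 vanishes
    and the new generator acts as zero on the residue field. The Noetherian hypothesis enters twice:
    prime ideals are finitely generated, and associated primes exist. *)

Definition mklin (U V : lmodType R) (f : U -> V) (hf : linear f) : {linear U -> V} :=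
  HB.pack f (GRing.isLinear.Build R U V *:%R f hf).

Section Image.
Variables (U V : lmodType R) (f : {linear U -> V}).

Definition image_pred : {pred V} := fun v => `[< exists u, f u = v >].

Let image_closed : submod_closed image_pred.
Proof.
split=> [|a x y]; first by apply/asboolP; exists 0; rewrite linear0.
by move=> /asboolP[u <-] /asboolP[v <-]; apply/asboolP; exists (a *: u + v); rewrite linearP.
Qed.
HB.instance Definition _ := GRing.isSubmodClosed.Build R V image_pred
  (GRing.submod_closed_semi image_closed).
End Image.

Lemma image_predP (U V : lmodType R) (f : {linear U -> V}) v :
  reflect (exists u, f u = v) (v \in image_pred f).
Proof. exact: asboolP. Qed.

Definition coker (U V : lmodType R) (f : {linear U -> V}) : lmodType R :=
  quotmod (image_pred f).

Lemma quotmod_pi_linear (V : lmodType R) (W : submodClosed V) :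
  linear (quotmod_pi W).
Proof. by move=> a x y; rewrite quotmod_piD quotmod_piZ. Qed.

Definition coker_pi (U V : lmodType R) (f : {linear U -> V}) :
  {linear V -> coker f} := locked (mklin (@quotmod_pi_linear V (image_pred f))).

Lemma coker_piE (U V : lmodType R) (f : {linear U -> V}) v :
  coker_pi f v = quotmod_pi (image_pred f) v.
Proof. by rewrite /coker_pi -lock. Qed.

Lemma quotmod_pi0 (V : lmodType R) (W : submodClosed V) x :
  quotmod_pi W x = 0 <-> x \in W.
Proof.
rewrite -[X in _ = X](linear0 (mklin (@quotmod_pi_linear V W))) /=.
by split=> [/quotmod_piP|xW]; [|apply/quotmod_piP]; rewrite subr0.
Qed.

Lemma coker_pi0 (U V : lmodType R) (f : {linear U -> V}) v :
  coker_pi f v = 0 <-> exists u, f u = v.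
Proof. by rewrite coker_piE quotmod_pi0; split => /image_predP. Qed.

Lemma coker_ind (U V : lmodType R) (f : {linear U -> V}) (P : coker f -> Prop) :
  (forall v, P (coker_pi f v)) -> forall q, P q.
Proof. by move=> h; apply: quotmod_ind => v; rewrite -coker_piE. Qed.

(** Two preimages under [d] differ by an element that [f] kills, so the value does not depend on the
    chosen preimage. *)
Lemma factor_image (U V W : lmodType R) (d : {linear U -> V}) (f : {linear U -> W}) :
  (forall u, d u = 0 -> f u = 0) ->
  exists g : {linear submod (image_pred d) -> W},
    forall u (hu : d u \in image_pred d), g (Sub (d u) hu) = f u.
Proof.
move=> h; have pre (v : submod (image_pred d)) : {u | d u = val v}.
  by apply: cid; exact/image_predP/(valP v).
have uniq u u' : d u = d u' -> f u = f u'.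
  by move=> e; apply/eqP; rewrite -subr_eq0 -linearB h // linearB e subrr.
have lin : linear (fun v => f (sval (pre v))).
  move=> a x y /=; rewrite -linearP; apply: uniq.
  by rewrite linearP (svalP (pre x)) (svalP (pre y)) (svalP (pre _)) linearP.
exists (mklin lin) => u hu /=; apply: uniq; exact: (svalP (pre _)).
Qed.

Lemma factor_quotmod (V W : lmodType R) (K : submodClosed V) (f : {linear V -> W}) :
  (forall v, v \in K -> f v = 0) ->
  exists g : {linear quotmod K -> W}, forall v, g (quotmod_pi K v) = f v.
Proof.
move=> h; have e v : f (repr (quotmod_pi K v)) = f v.
  apply/eqP; rewrite -subr_eq0 -linearB; apply/eqP/h/quotmod_piP.
  by rewrite /quotmod_pi /= reprK.
have lin : linear (fun q : quotmod K => f (repr q)).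
  move=> a; elim/quotmod_ind => x; elim/quotmod_ind => y.
  by rewrite -(@quotmod_pi_linear V K) !e linearP.
by exists (mklin lin) => v; exact: e.
Qed.

Lemma factor_coker (U V W : lmodType R) (d : {linear U -> V}) (f : {linear V -> W}) :
  (forall u, f (d u) = 0) ->
  exists g : {linear coker d -> W}, forall v, g (coker_pi d v) = f v.
Proof.
move=> h; have [v /image_predP[u <-] //|g hg] := @factor_quotmod _ _ (image_pred d) f.
by exists g => v; rewrite coker_piE hg.
Qed.

End Linear.

Section Factor.
Variable R : comNzRingType.

(** Injectivity of [E] is applied to the inclusion of the image of [d], through which [f] factors;
    [d] itself may have a kernel. *)
Lemma injective_factor (E U V : lmodType R) (d : {linear U -> V}) (f : {linear U -> E}) :
  injective_module E -> (forall u, d u = 0 -> f u = 0) ->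
  exists h : {linear V -> E}, forall u, h (d u) = f u.
Proof.
move=> hE /factor_image[g hg].
have lin : linear (fun v : submod (image_pred d) => val v).
  by move=> a x y; rewrite linearP.
have [h hh] := hE _ _ (mklin lin) g val_inj.
exists h => u; have hu : d u \in image_pred d by apply/image_predP; exists u.
by rewrite -(hg u hu) -hh.
Qed.

(** Projectivity is applied to [d] as a surjection onto its image, which contains the values of
    [f]. *)
Lemma projective_factor (P U V : lmodType R) (d : {linear U -> V}) (f : {linear P -> V}) :
  projective_module P -> (forall x, exists u, d u = f x) ->
  exists h : {linear P -> U}, forall x, d (h x) = f x.
Proof.
move=> hP hd.
have dP u : d u \in image_pred d by apply/image_predP; exists u.
have fP x : f x \in image_pred d by apply/image_predP.
have lin1 : linear (fun u => Sub (d u) (dP u) : submod (image_pred d)).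
  by move=> a x y; apply: val_inj; rewrite /= linearP.
have lin2 : linear (fun u => Sub (f u) (fP u) : submod (image_pred d)).
  by move=> a x y; apply: val_inj; rewrite /= linearP.
have surj y : exists u, mklin lin1 u = y.
  have /image_predP[u eu] := valP y; exists u; exact: val_inj.
have [h hh] := hP _ _ (mklin lin1) (mklin lin2) surj.
by exists h => x; have /(congr1 val) := hh x.
Qed.
End Factor.

Section Cast.
Variables (R : pzRingType) (T : eqType) (X : T -> lmodType R).

(** Zero between different indices, like [diff] between degrees that are not consecutive; identities
    between degrees thus become linear maps without side conditions. *)
Definition cast (i j : T) : {linear X i -> X j} :=
  match i =P j with
  | ReflectT e => match e in _ = k return {linear X i -> X k} with erefl => idfun end
  | ReflectF _ => \0
  end.

Lemma cast_id i x : cast i i x = x.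
Proof. by rewrite /cast; case: eqP => // e; rewrite (eq_axiomK e). Qed.

Lemma cast_neq i j x : i <> j -> cast i j x = 0.
Proof. by rewrite /cast; case: eqP. Qed.

Lemma castK i j x : i = j -> cast j i (cast i j x) = x.
Proof. by move=> <-; rewrite !cast_id. Qed.

End Cast.

Section Complexes.
Variable R : pzRingType.
Implicit Types X Y : complex R.

(* The degree of [y] is left free, as [diff X j n] vanishes for [j != n + 1]. *)
Definition is_boundary X n (x : X n) := exists j (y : X j), diff X j n y = x.
Definition is_cycle X n (x : X n) := forall j, diff X n j x = 0.

Lemma is_boundaryP X n (x : X n) m : m = n + 1 ->
  is_boundary x <-> exists y, diff X m n y = x.
Proof.
move=> ->; split=> [[j [y <-]]|[y <-]]; last by exists (n + 1), y.
case: (eqVneq j (n + 1)) y => [->|jn] y; first by exists y.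
by exists 0; rewrite linear0 diff_shape.
Qed.

Lemma is_cycleP X n (x : X n) m : m + 1 = n -> diff X n m x = 0 -> is_cycle x.
Proof.
move=> mn xm j; have [e|/diff_shape->//] := eqVneq n (j + 1).
by have -> : j = m by lia.
Qed.

Lemma boundaryD X n (x y : X n) : is_boundary x -> is_boundary y -> is_boundary (x + y).
Proof.
move=> /(is_boundaryP _ erefl)[x' <-] /(is_boundaryP _ erefl)[y' <-].
by exists (n + 1), (x' + y'); rewrite linearD.
Qed.

Lemma boundaryZ X n a (x : X n) : is_boundary x -> is_boundary (a *: x).
Proof. by move=> [j [y <-]]; exists j, (a *: y); rewrite linearZ. Qed.

Lemma boundaryN X n (x : X n) : is_boundary x -> is_boundary (- x).
Proof. by move=> /(boundaryZ (-1)); rewrite scaleN1r. Qed.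

Lemma boundary0 X n : is_boundary (0 : X n).
Proof. by exists n, 0; rewrite linear0. Qed.

Lemma boundary_cycle X n (x : X n) : is_boundary x -> is_cycle x.
Proof. by move=> [j [y <-]] k; exact: diffK. Qed.

Lemma boundariesP X n (z : submod (cycles X n)) :
  reflect (is_boundary (val z)) (z \in boundaries X n).
Proof.
by apply: (iffP (asboolP _)) => [[y e]|/(is_boundaryP _ erefl)//]; exists (n + 1), y.
Qed.

Lemma cyclesP X n (x : X n) : reflect (is_cycle x) (x \in cycles X n).
Proof.
apply: (iffP eqP) => [/is_cycleP|]; [apply; lia|exact].
Qed.

Lemma homology_neq0 X n (z : submod (cycles X n)) :
  quotmod_pi (boundaries X n) z <> 0 <-> ~ is_boundary (val z).
Proof. by rewrite quotmod_pi0; split=> h; apply: contra_not h => /boundariesP. Qed.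

Lemma nonzero_homologyP X n :
  nonzero_homology X n <-> exists x : X n, is_cycle x /\ ~ is_boundary x.
Proof.
split=> [[h]|[x [/cyclesP cx]]].
  by elim/quotmod_ind: h => z /homology_neq0 h; exists (val z); split=> //; exact/cyclesP/(valP z).
by move=> bx; exists (quotmod_pi (boundaries X n) (Sub x cx)); exact/homology_neq0.
Qed.

Lemma acyclicP X : acyclic X <-> forall n (x : X n), is_cycle x -> is_boundary x.
Proof.
split=> [aX n x cx|h n]; last by move=> /nonzero_homologyP[x [/h]].
by apply: contrapT => bx; apply: (aX n); apply/nonzero_homologyP; exists x.
Qed.

Lemma no_homologyP X n : ~ nonzero_homology X n <->
  (forall x : X n, is_cycle x -> is_boundary x).
Proof.
split=> [aX x cx|h]; last by move=> /nonzero_homologyP[x [/h]].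
by apply: contrapT => bx; apply: aX; apply/nonzero_homologyP; exists x.
Qed.

Lemma chain_cycle X Y (f : chain_map X Y) n (x : X n) : is_cycle x -> is_cycle (f n x).
Proof. by move=> cx j; rewrite -chain_diff cx linear0. Qed.

Lemma chain_boundary X Y (f : chain_map X Y) n (x : X n) :
  is_boundary x -> is_boundary (f n x).
Proof. by move=> [j [y <-]]; exists j, (f j y); rewrite chain_diff. Qed.

Lemma quasi_isoP X Y (f : chain_map X Y) : quasi_iso f <-> forall n,
  (forall x : X n, is_cycle x -> is_boundary (f n x) -> is_boundary x) /\
  (forall y : Y n, is_cycle y -> exists2 x : X n, is_cycle x & is_boundary (y - f n x)).
Proof.
split=> [qf n|h n].
  case: (qf n) => g gK Kg; split=> [x cx bfx|y cy].
    move/cyclesP: cx => cx; apply: contrapT => bx.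
    have /homology_neq0 := (bx : ~ is_boundary (val (Sub x cx : submod (cycles X n)))).
    apply; rewrite -[LHS]gK -[RHS]gK; congr g.
    rewrite homology_mapE -[0](_ : quotmod_pi (boundaries X n) 0 = 0).
      rewrite homology_mapE; apply/quotmod_piP/boundariesP.
      by rewrite linearB /= linear0 subr0.
    exact: (linear0 (mklin (@quotmod_pi_linear _ _ (boundaries X n)))).
  move/cyclesP: cy => cy.
  have := Kg (quotmod_pi _ (Sub y cy)).
  elim/quotmod_ind: (g _) => x; rewrite homology_mapE => /esym/quotmod_piP/boundariesP.
  by rewrite linearB /= => b; exists (val x) => //; exact/cyclesP/(valP x).
have inj : injective (@homology_map _ _ _ f n).
  elim/quotmod_ind => x; elim/quotmod_ind => y.
  rewrite !homology_mapE => /quotmod_piP/boundariesP; rewrite linearB /= => b.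
  apply/quotmod_piP/boundariesP; apply: (h n).1; last by rewrite !linearB.
  by apply/cyclesP/(valP (x - y)).
have surj y : exists x, @homology_map _ _ _ f n x = y.
  elim/quotmod_ind: y => y.
  have [|x /cyclesP cx b] := (h n).2 (val y); first exact/cyclesP/(valP y).
  exists (quotmod_pi _ (Sub x cx)); rewrite homology_mapE.
  apply/esym/quotmod_piP/boundariesP; by rewrite linearB.
have [g hg] := choice surj.
by exists g => // x; apply: inj; rewrite hg.
Qed.

Lemma quasi_iso_no_homology X Y (f : chain_map X Y) n : quasi_iso f ->
  ~ nonzero_homology X n -> ~ nonzero_homology Y n.
Proof.
move=> /quasi_isoP/(_ n)[_ sf] /no_homologyP hX; apply/no_homologyP => y cy.
have [x /hX/(chain_boundary f) bx b] := sf y cy.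
by rewrite -(subrK (f n x) y); exact: boundaryD.
Qed.

Lemma comp_chain_diff X Y Z (g : chain_map Y Z) (f : chain_map X Y) i j x :
  (g j \o f j) (diff X i j x) = diff Z i j ((g i \o f i) x).
Proof. by rewrite /= !chain_diff. Qed.

Definition comp_chain X Y Z (g : chain_map Y Z) (f : chain_map X Y) : chain_map X Z :=
  @ChainMap R X Z (fun i => g i \o f i : {linear _ -> _}) (comp_chain_diff g f).

Lemma comp_quasi_iso X Y Z (g : chain_map Y Z) (f : chain_map X Y) :
  quasi_iso g -> quasi_iso f -> quasi_iso (comp_chain g f).
Proof.
move=> /quasi_isoP qg /quasi_isoP qf; apply/quasi_isoP => n; split=> [x cx bx|z cz].
  by apply: (qf n).1 => //; apply: (qg n).1 => //; exact: chain_cycle.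
have [y cy by_] := (qg n).2 z cz; have [x cx bx] := (qf n).2 y cy.
exists x => //=; rewrite -(subrK (g n y) z) -addrA -linearB.
by apply: boundaryD => //; exact: chain_boundary.
Qed.

Lemma cast_diffl X i j n (x : X i) : i = j -> diff X j n (cast X i j x) = diff X i n x.
Proof. by move=> <-; rewrite cast_id. Qed.

Lemma cast_diffr X i j n (x : X n) : i = j -> cast X i j (diff X n i x) = diff X n j x.
Proof. by move=> <-; rewrite cast_id. Qed.

End Complexes.

(** * Bounded complexes of injective or projective modules *)

Section BoundedResolutions.
Variable R : comNzRingType.

Section Homotopy.
Variables (X Y : complex R) (f : chain_map X Y) (u v : nat -> int).
Variable h : forall k, {linear X (u k) -> Y (v k)}.
Variable idx : int -> nat.
Hypothesis idxK : forall k, idx (u k) = k.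

(** Spreads a family indexed by the steps of a recursion over all pairs of degrees. In a degree
    outside the range of [u] the inner cast is zero. *)
Definition glued_homotopy i j : {linear X i -> Y j} :=
  cast Y (v (idx i)) j \o (h (idx i) \o cast X i (u (idx i))).

Lemma glued_homotopyE i j k (e : i = u k) (x : X i) :
  glued_homotopy i j x = cast Y (v k) j (h k (cast X i (u k) x)).
Proof. by subst i; rewrite /= idxK. Qed.

End Homotopy.

(** The homotopy is built downwards. The part of [f] not yet accounted for vanishes on boundaries by
    the previous step, hence on cycles since [A] is acyclic; so it factors through the differential
    of [A] and extends along it by injectivity. *)
Theorem K_injective_bounded (s : int) (I : complex R) :
  (forall n, injective_module (I n)) -> (forall n, s < n -> forall x : I n, x = 0) ->
  K_injective I.
Proof.
move=> injI I0 A /acyclicP aA f.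
pose u := fix u k := if k is k'.+1 then u k' - 1 else s + 1.
have uE k : u k = s + 1 - k%:Z by elim: k => [|k IH] /=; lia.
pose rel k (h : {linear A (u k.+1) -> I (u k)}) (h' : {linear A (u k.+2) -> I (u k.+1)}) :=
  forall a, f _ a = diff I (u k) (u k.+1) (h a) + h' (diff A (u k.+1) (u k.+2) a).
(* The next map exists only if the previous relation holds. The default 0 keeps the recursion total,
   and [relh] shows that it does not matter. *)
pose step k h := if pselect (exists h', @rel k h h') is left e then sval (cid e) else \0.
pose h := nat_rect (fun k => {linear A (u k.+1) -> I (u k)}) \0 step.
have stepP k : (forall a, is_cycle a -> f _ a = diff I (u k) (u k.+1) (h k a)) ->
    rel k (h k) (h k.+1).
  move=> hk; rewrite /= /step; case: pselect => [e|ne]; first exact: (svalP (cid e)).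
  case: ne.
  have [a da|h' hh'] := @injective_factor _ _ _ _ (diff A (u k.+1) (u k.+2))
    (f (u k.+1) \- (diff I (u k) (u k.+1) \o h k)) (injI _).
    rewrite /= hk ?subrr //; apply: is_cycleP da; rewrite /=; lia.
  by exists h' => a; rewrite hh' [RHS]addrC; exact/esym/subrK.
have relh k : rel k (h k) (h k.+1).
  elim: k => [|k IH]; apply: stepP => a /aA/(is_boundaryP _ erefl) [].
    move=> a' <-; rewrite chain_diff /=.
    (* At the start the cycle bounds an element of degree [s + 1], where [f] is zero because [I]
       is. *)
    have s1 : s < u 1%N + 1 by rewrite uE; lia.
    by rewrite (I0 _ s1 (f _ a')) !linear0.
  have -> : u k.+2 + 1 = u k.+1 by rewrite /=; lia.
  move=> a' <-; rewrite chain_diff IH linearD diffK add0r; congr (diff _ _ _ _).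
pose idx i := `|s - i|%N.
have idxK k : idx (u k.+1) = k by rewrite /idx uE; lia.
exists (glued_homotopy (fun k => h k) idx) => i x.
have [si|is_] := boolP (s < i).
  by rewrite (I0 _ si (f i x)) [RHS](I0 _ si).
have ei : i = u (idx i).+1 by rewrite uE /idx; lia.
move: (idx i) ei x => k -> x.
rewrite (glued_homotopyE _ idxK _ (erefl _)) cast_id cast_diffl; last by rewrite /=; lia.
rewrite (@glued_homotopyE _ _ _ _ _ _ idxK _ _ k.+1 erefl) !cast_id; exact: relh.
Qed.

(** Dually, the homotopy is built upwards from degree [s - 1]: the remaining part of [f] takes
    values in cycles of [A], which are boundaries, and projectivity lifts it along the
    differential. *)
Theorem K_projective_bounded (s : int) (P : complex R) :
  (forall n, projective_module (P n)) -> (forall n, n < s -> forall x : P n, x = 0) ->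
  K_projective P.
Proof.
move=> projP P0 A /acyclicP aA f.
pose u := fix u k := if k is k'.+1 then u k' + 1 else s - 1.
have uE k : u k = s - 1 + k%:Z by elim: k => [|k IH] /=; lia.
pose rel k (h : {linear P (u k) -> A (u k.+1)}) (h' : {linear P (u k.+1) -> A (u k.+2)}) :=
  forall a, f _ a = diff A (u k.+2) (u k.+1) (h' a) + h (diff P (u k.+1) (u k) a).
pose step k h := if pselect (exists h', @rel k h h') is left e then sval (cid e) else \0.
pose h := nat_rect (fun k => {linear P (u k) -> A (u k.+1)}) \0 step.
have stepP k : (forall a, is_cycle (f _ a - h k (diff P (u k.+1) (u k) a))) ->
    rel k (h k) (h k.+1).
  move=> hk; rewrite /= /step; case: pselect => [e|ne]; first exact: (svalP (cid e)).
  case: ne.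
  have [a|h' hh'] := @projective_factor _ _ _ _ (diff A (u k.+2) (u k.+1))
    (f (u k.+1) \- (h k \o diff P (u k.+1) (u k))) (projP _).
    by have /(is_boundaryP _ erefl) := aA _ _ (hk a).
  by exists h' => a; rewrite hh'; exact/esym/subrK.
have relh k : rel k (h k) (h k.+1).
  elim: k => [|k IH]; apply: stepP => a.
    apply: (@is_cycleP _ _ _ _ (u 0%N)) => //; rewrite subr0 -chain_diff.
    have s1 : u 0%N < s by rewrite uE; lia.
    by rewrite -/(u 0%N) (P0 _ s1 (diff P (u 1%N) (u 0%N) _)) linear0.
  apply: (@is_cycleP _ _ _ _ (u k.+1)) => //.
  by rewrite linearB -chain_diff IH diffK linear0 addr0 subrr.
pose idx i := `|(i - (s - 1))%R|%N.
have idxK k : idx (u k) = k by rewrite /idx uE; lia.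
exists (glued_homotopy (fun k => h k) idx) => i x.
have [si|is_] := boolP (i < s).
  have i1 : i - 1 < s by lia.
  by rewrite (P0 _ si x) !linear0 addr0.
have ei : i = u (idx i).-1.+1 by rewrite uE /idx; lia.
move: (idx i).-1 ei x => k -> x.
rewrite (glued_homotopyE _ idxK _ (erefl _)) cast_id cast_diffl; last by rewrite /=; lia.
rewrite (@glued_homotopyE _ _ _ _ _ _ idxK _ _ k); last by rewrite /=; lia.
rewrite cast_diffr; last by rewrite /=; lia.
rewrite cast_id; exact: relh.
Qed.

End BoundedResolutions.

Lemma hom_ex (R : comNzRingType) (L V : lmodType R) (f : {linear L -> V}) :
  exists g : Defs.hom L V, hom_fun g = f.
Proof.
have h : (f : L -> V) \in linear_pred L V by apply/asboolP; exact: linearP.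
by exists (exist _ (f : L -> V) h).
Qed.

(** * Maps into a K-injective complex with homology bounded above *)

Section HomIntoInjective.
Variables (R : comNzRingType) (I : complex R) (s : int).
Hypothesis KI : K_injective I.
Hypothesis Is : forall n, s < n -> ~ nonzero_homology I n.

Let Q : lmodType R := coker (diff I (s + 1) s).
Let pi : {linear I s -> Q} := coker_pi (diff I (s + 1) s).

(* The acyclic complex [... -> I (s + 1) -> I s -> Q -> 0], with [b1] and [b2]
   standing for [s <= n] and [n == s - 1]. *)
Let trunc_obj (b1 b2 : bool) n : lmodType R :=
  if b1 then I n else if b2 then Q else 'rV[R]_0.

Let trunc_diff b1 b2 c1 c2 n m : {linear trunc_obj b1 b2 n -> trunc_obj c1 c2 m} :=
  if b1 as b return {linear trunc_obj b b2 n -> trunc_obj c1 c2 m} then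
    if c1 as c return {linear trunc_obj true b2 n -> trunc_obj c c2 m} then diff I n m
    else if c2 as c return {linear trunc_obj true b2 n -> trunc_obj false c m}
         then pi \o cast I n s else \0
  else \0.

Let tdiff (n m : int) := trunc_diff (s <= n) (n == s - 1) (s <= m) (m == s - 1) n m.

Let tdiff_shape (n m : int) : n != m + 1 -> forall x, tdiff n m x = 0.
Proof.
move=> nm; rewrite /tdiff; case: (boolP (s <= n)) => // sn x.
case: (boolP (s <= m)) => [sm|sm] /=; first exact: diff_shape.
case: eqP => // ms; rewrite /= cast_neq ?linear0 //; lia.
Qed.

Let tdiffK n m k x : tdiff m k (tdiff n m x) = 0.
Proof.
move: x; rewrite /tdiff; case: (boolP (s <= n)) => sn x; last first.
  by rewrite [X in trunc_diff _ _ _ _ _ _ X]/= linear0.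
case: (boolP (s <= m)) => //= sm.
case: (boolP (s <= k)) => [sk|sk] /=; first exact: diffK.
case: eqP => // ks; rewrite /=; have [ms|/eqP ms] := eqVneq m s; last by rewrite cast_neq ?linear0.
by rewrite cast_diffr //; apply/coker_pi0/(is_boundaryP _ erefl); exists n, x.
Qed.

Let trunc : complex R := @Complex R (fun n => trunc_obj (s <= n) (n == s - 1) n)
  tdiff tdiff_shape tdiffK.

Let dbar (n : int) : {linear Q -> I n} :=
  sval (cid (@factor_coker _ _ _ _ (diff I (s + 1) s) (diff I s n)
    (@diffK _ I (s + 1) s n))).

Let dbarE n v : dbar n (pi v) = diff I s n v.
Proof. by rewrite /dbar; case: cid => g hg; exact: hg. Qed.

Let trunc_incl b1 b2 n : {linear trunc_obj b1 b2 n -> I n} :=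
  if b1 as b return {linear trunc_obj b b2 n -> I n} then idfun
  else if b2 as b return {linear trunc_obj false b n -> I n} then dbar n else \0.

(** The identity in degrees at least [s] and the induced differential [dbar] on [Q] in degree
    [s - 1]. *)
Let tincl n := trunc_incl (s <= n) (n == s - 1) n.

Let tincl_diff n m (x : trunc n) : tincl m (diff trunc n m x) = diff I n m (tincl n x).
Proof.
move: x; rewrite /= /tincl /tdiff; case: (boolP (s <= n)) => sn x; last first.
  rewrite /= linear0; move: x; case: eqP => ns x; last by rewrite /= linear0.
  by elim/coker_ind: x => x; rewrite /= (dbarE n x) diffK.
case: (boolP (s <= m)) => [//|sm] /=.
case: eqP => [ms|ms] /=; last by rewrite diff_shape //; lia.
have [ns|/eqP ns] := eqVneq n s; last by rewrite cast_neq // !linear0 diff_shape //; lia.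
by rewrite (dbarE m (cast I n s x)) cast_diffl.
Qed.

(** Above degree [s] this is the hypothesis on [I]; in degree [s] the kernel of the projection to
    [Q] consists of boundaries; in degree [s - 1] the projection is onto. *)
Let trunc_acyclic : acyclic trunc.
Proof.
apply/acyclicP => n x cx; apply/(is_boundaryP _ erefl) => /=.
have := cx (n - 1); move: x {cx}; rewrite /= /tdiff => x cx.
have [sn1|sn1] := boolP (s <= n + 1); last first.
  move: x {cx}; rewrite (_ : (s <= n) = false); last by lia.
  rewrite (_ : (n == s - 1) = false); last by lia.
  by move=> x; exists 0; rewrite linear0 /=; apply/esym/thinmx0.
move: x cx; case: (boolP (s <= n)) => sn x cx; last first.
  have e : n + 1 = s by lia.
  move: x {cx}; rewrite (_ : (n == s - 1) = true); last by lia.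
  elim/coker_ind => v; exists (cast I s (n + 1) v).
  by rewrite /= castK.
have [y hy] : exists y, diff I (n + 1) n y = x.
  apply/(is_boundaryP _ erefl); have [ns|ns] := eqVneq n s.
    move: cx; rewrite (_ : (s <= n - 1) = false); last by lia.
    rewrite (_ : (n - 1 == s - 1) = true) /=; last by lia.
    move=> /coker_pi0/(is_boundaryP _ erefl)[j [y yx]]; exists j, y.
    by rewrite -(castK x ns) -yx cast_diffr.
  have /Is/no_homologyP : s < n by rewrite lt_def ns.
  apply; apply: (is_cycleP (m := n - 1)); first lia.
  by move: cx; rewrite (_ : (s <= n - 1) = true) //; lia.
by exists y.
Qed.

(* Read off a null homotopy of [tincl], which exists as [trunc] is acyclic. *)
Lemma top_split :
  (forall n, s < n -> exists h : {linear I n -> I (n + 1)},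
     forall x, is_cycle x -> x = diff I (n + 1) n (h x)) /\
  (exists h : {linear coker (diff I (s + 1) s) -> I s},
     forall x : I s, is_boundary (x - h (coker_pi (diff I (s + 1) s) x))).
Proof.
have [h hh] := KI trunc_acyclic (ChainMap tincl_diff).
split=> [n sn|].
  move: (h n (n + 1)) (h (n - 1) n) (hh n); rewrite /= /tincl /tdiff.
  rewrite (_ : (s <= n) = true); last by lia.
  rewrite (_ : (s <= n - 1) = true); last by lia.
  by move=> h1 h2 e; exists h1 => x cx; rewrite {1}[x]e cx linear0 addr0.
move: (h s (s + 1)) (h (s - 1) s) (hh s); rewrite /= /tincl /tdiff.
rewrite (_ : (s <= s) = true); last by lia.
rewrite (_ : (s <= s - 1) = false); last by lia.
rewrite (_ : (s - 1 == s - 1) = true); last by lia.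
(* In degree [s] the homotopy reads [x = d (h1 x) + h2 (pi x)], so [h2] is the splitting. *)
move=> h1 h2 e; exists h2 => x; exists (s + 1), (h1 x).
apply/esym/eqP; rewrite subr_eq; apply/eqP; by rewrite [LHS]e /= cast_id.
Qed.

Variable L : lmodType R.

(** A cycle takes values in cycles of [I], so composing it with the contraction of [I] above degree
    [s] gives a map that it bounds. *)
Lemma hom_no_homology n : s < n -> ~ nonzero_homology (hom_complex L I) n.
Proof.
move=> /(proj1 top_split)[h hh] /nonzero_homologyP[f [cf bf]]; apply: bf.
have [g hg] := hom_ex (h \o mklin (hom_linear f)).
exists (n + 1), g; apply/val_inj/funext => l /=; rewrite hg /= -hh // => j.
by have /(congr1 (fun f => hom_fun f l)) := cf j.
Qed.

(** The class is the composite of [e] with the splitting. Its values are homologous to the cycles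
    [z], hence are cycles; if it were a boundary, so would be every [z], and [e] would vanish. *)
Lemma hom_top_homology (e : {linear L -> coker (diff I (s + 1) s)}) :
  (forall l, exists2 z, is_cycle z & e l = coker_pi (diff I (s + 1) s) z) ->
  (exists l, e l <> 0) -> nonzero_homology (hom_complex L I) s.
Proof.
move=> he [l el]; have [h hh] := top_split.2.
have [g hg] := hom_ex (h \o e).
apply/nonzero_homologyP; exists g; split=> [j|[j [f fg]]].
  apply/val_inj/funext => l' /=; rewrite hg /=.
  have [z cz ->] := he l'; rewrite -[h _](subKr z) linearB cz.
  by rewrite (boundary_cycle (hh z)) subr0.
apply: el; have [z cz ez] := he l; rewrite ez; apply/coker_pi0/(is_boundaryP _ erefl).
rewrite -(subrK (h (coker_pi (diff I (s + 1) s) z)) z); apply: boundaryD (hh z) _.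
exists j, (hom_fun f l); rewrite -ez -[RHS]/((h \o e) l) -hg -fg //.
Qed.

End HomIntoInjective.

(** * Enough injectives and injective resolutions *)

Section DivisibleExtension.
Local Open Scope classical_set_scope.

Lemma zmod_morphismD (U V : zmodType) (h : U -> V) :
  zmod_morphism h -> {morph h : x y / x + y}.
Proof.
move=> hB x y; have h0 : h 0 = 0 by have := hB 0 0; rewrite !subrr.
have hN : h (- y) = - h y by have := hB 0 y; rewrite h0 !sub0r.
by rewrite -{1}[y]opprK hB hN opprK.
Qed.

Definition divisible (D : zmodType) :=
  forall (d : D) n, (0 < n)%N -> exists e : D, e *+ n = d.

(* Additive partial functions, given by their graphs. *)
Record partial_morphism (V D : zmodType) (G : set (V * D)) : Prop := {
  pmorph0 : G 0;
  pmorphB : forall x y, G x -> G y -> G (x - y);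
  pmorph_fun : forall d, G (0, d) -> d = 0
}.

Lemma pairMz (V D : zmodType) (x : V * D) k : x *~ k = (x.1 *~ k, x.2 *~ k).
Proof. by rewrite [LHS]surjective_pairing (raddfMz fst) (raddfMz snd). Qed.

Section PartialMorphism.
Variables (V D : zmodType) (G : set (V * D)).
Hypothesis hG : partial_morphism G.

Lemma pmorphN x : G x -> G (- x).
Proof. by rewrite -sub0r; apply: (pmorphB hG); exact: pmorph0. Qed.

Lemma pmorphD x y : G x -> G y -> G (x + y).
Proof. by move=> Gx /pmorphN; rewrite -{2}[y]opprK; exact: (pmorphB hG). Qed.

Lemma pmorphMn x n : G x -> G (x *+ n).
Proof.
by move=> Gx; elim: n => [|n IH]; [exact: (pmorph0 hG)|rewrite mulrS; exact: pmorphD].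
Qed.

Lemma pmorphMz x k : G x -> G (x *~ k).
Proof.
by case: k => n Gx; [exact: pmorphMn|rewrite NegzE mulrNz; apply/pmorphN/pmorphMn].
Qed.

Lemma pmorph_uniq v d d' : G (v, d) -> G (v, d') -> d = d'.
Proof.
move=> Gd Gd'; apply/eqP; rewrite -subr_eq0; apply/eqP/(pmorph_fun hG).
by have := pmorphB hG Gd Gd'; rewrite -[_ - _]/(v - v, d - d') subrr.
Qed.

(** Let [n] be the least positive integer with [v *+ n] in the domain. Divisibility supplies a value
    at [v] whose [n]-th multiple is the prescribed one; if there is no such [n], the value 0 is
    compatible. *)
Lemma pmorph_adjoin (v : V) : divisible D ->
  exists G', [/\ partial_morphism G', G `<=` G' & exists d, G' (v, d)].
Proof.
move=> divD.
have [d hd] : exists d : D, forall k e, G (v *~ k, e) -> e = d *~ k.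
  pose dom n := `[< (0 < n)%N /\ exists e, G (v *+ n, e) >].
  have [[n0 hn0]|none] := pselect (exists n, dom n); last first.
    exists 0 => k e Gk; rewrite mul0rz; have [k0|k0] := eqVneq k 0.
      by apply: (pmorph_fun hG); rewrite k0 in Gk.
    case: none; exists `|k|%N; apply/asboolP; split; first by rewrite absz_gt0.
    case: k Gk k0 => n Gn n0; first by exists e.
    by exists (- e); have := pmorphN Gn; rewrite NegzE mulrNz -[X in G X]/(- - _, - e) opprK.
  have [n /asboolP[n_gt0 [e0 Ge0]] nmin] := ex_minnP (ex_intro _ n0 hn0).
  have [d de] := divD e0 n n_gt0; exists d => k e Gk.
  have nz : n%:Z != 0 by lia.
  (* The remainder of [k] modulo [n] also brings [v] into the domain, so it is 0 by minimality of
     [n]. *)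
  have Gr : G (v *~ (k %% n)%Z, e - e0 *~ (k %/ n)%Z).
    have := pmorphB hG Gk (pmorphMz (k %/ n)%Z Ge0); rewrite pairMz.
    rewrite -[_ - _]/(v *~ k - v *~ n%:Z *~ (k %/ n)%Z, e - e0 *~ (k %/ n)%Z).
    by rewrite -mulrzA -mulrzBr /modz mulrC.
  have r0 : (k %% n)%Z = 0.
    have := modz_ge0 k nz; have := ltz_pmod k (_ : 0 < n%:Z); move: Gr.
    case: (k %% n)%Z => // -[//|r] Gr /(_ n_gt0) rn _; exfalso.
    suff : (n <= r.+1)%N by lia.
    by apply: nmin; apply/asboolP; split => //; eexists; exact: Gr.
  rewrite r0 in Gr; have /eqP := pmorph_fun hG Gr; rewrite subr_eq0 => /eqP ->.
  rewrite -de -[d *+ n]/(d *~ n%:Z) -mulrzA; congr (_ *~ _).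
  by rewrite [RHS](divz_eq k n) r0 addr0 mulrC.
exists [set x | exists k : int, G (x - (v, d) *~ k)]; split.
- split=> [|x y [k Gk] [l Gl]|e [k]].
  + by exists 0; rewrite subr0; exact: (pmorph0 hG).
  + exists (k - l); have := pmorphB hG Gk Gl; congr G.
    by rewrite mulrzBr !opprD !opprK addrACA.
  + rewrite pairMz -[_ - _]/(0 - v *~ k, e - d *~ k) sub0r -mulrNz => /hd/eqP.
    by rewrite mulrNz subr_eq addNr => /eqP.
- by move=> x Gx; exists 0; rewrite mulr0z subr0.
- by exists d, 1; rewrite subrr; exact: (pmorph0 hG).
Qed.
End PartialMorphism.

Lemma pmorph_extend (V D : zmodType) (G0 : set (V * D)) : divisible D ->
  partial_morphism G0 ->
  exists2 h : V -> D, zmod_morphism h & forall v d, G0 (v, d) -> h v = d.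
Proof.
(* Zorn's lemma ranges over the sets added to [G0], so that the empty chain has the upper bound [G0]
   itself. *)
move=> divD hG0; pose P A := partial_morphism (G0 `|` A).
have [F sF totF|A [hA maxA]] := @Zorn_bigcup _ P.
  have inF x : (G0 `|` \bigcup_(X in F) X) x ->
      G0 x \/ exists2 A, F A & (G0 `|` A) x.
    by case=> [|[A FA Ax]]; [left|right; exists A => //; right].
  have sub A : F A -> G0 `|` A `<=` G0 `|` \bigcup_(X in F) X.
    by move=> FA; apply: setUS; exact: bigcup_sup.
  have both x y : (G0 `|` \bigcup_(X in F) X) x -> (G0 `|` \bigcup_(X in F) X) y ->
      (G0 x /\ G0 y) \/ exists2 A, F A & (G0 `|` A) x /\ (G0 `|` A) y.
    move=> /inF[Gx|[A FA Ax]] /inF[Gy|[B FB By]]; first by left.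
    - by right; exists B => //; split=> //; left.
    - by right; exists A => //; split=> //; left.
    - right; have [AB|BA] := totF _ _ FA FB.
        by exists B => //; split=> //; exact: setUS AB _ Ax.
      by exists A => //; split=> //; exact: setUS BA _ By.
  split=> [|x y Gx Gy|d].
  - by left; exact: (pmorph0 hG0).
  - have [[G0x G0y]|[A FA [Ax Ay]]] := both _ _ Gx Gy.
      by left; exact: (pmorphB hG0).
    by apply: (sub _ FA); apply: (pmorphB (sF _ FA)).
  - by move=> /inF[/(pmorph_fun hG0)//|[A FA]]; exact: (pmorph_fun (sF _ FA)).
pose G := G0 `|` A.
have total v : exists d, G (v, d).
  have [G' [hG' sGG' [d G'd]]] := pmorph_adjoin hA v divD.
  exists d; apply: contrapT => Gd; apply: (maxA G').
    rewrite properEneq; split; last by move=> x Ax; apply: sGG'; right.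
    by apply/eqP => AG'; apply: Gd; right; rewrite AG'.
  by rewrite /P (_ : G0 `|` G' = G') //; apply/setUidPr => x G0x; apply: sGG'; left.
have [h hh] := choice total; exists h => [x y|v d G0d].
  by apply: (pmorph_uniq hA (hh (x - y))); exact: (pmorphB hA (hh x) (hh y)).
by apply: (pmorph_uniq hA (hh v)); left.
Qed.

End DivisibleExtension.

Section Coinduction.
Local Open Scope classical_set_scope.
Variables (R : comNzRingType) (D : zmodType).

Definition coind_pred : {pred R -> D} := fun f => `[< zmod_morphism f >].

Let coind_closed : zmod_closed coind_pred.
Proof.
split=> [|f g /asboolP hf /asboolP hg]; apply/asboolP => x y /=; first by rewrite subrr.
rewrite -[LHS]/(f (x - y) - g (x - y)) -[RHS]/((f x - g x) - (f y - g y)) hf hg.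
by rewrite !opprD !opprK addrACA.
Qed.
HB.instance Definition _ := GRing.isZmodClosed.Build (R -> D) coind_pred coind_closed.

(* The abelian group [Hom_Z(R, D)] with [R] acting on the source. *)
Definition coind : Type := {f : R -> D | f \in coind_pred}.
HB.instance Definition _ := [isSub of coind for @sval (R -> D) (fun f => f \in coind_pred)].
HB.instance Definition _ := [Choice of coind by <:].
HB.instance Definition _ := [SubChoice_isSubZmodule of coind by <:].

Lemma coind_morph (f : coind) : zmod_morphism (val f).
Proof. exact/asboolP/(valP f). Qed.

Lemma coind_scale_subproof a (f : coind) : (fun x => val f (x * a)) \in coind_pred.
Proof. by apply/asboolP => x y; rewrite mulrBl coind_morph. Qed.

Definition coind_scale a (f : coind) : coind :=
  exist (fun f => f \in coind_pred) _ (coind_scale_subproof a f).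

Let coind_scaleA a b f : coind_scale a (coind_scale b f) = coind_scale (a * b) f.
Proof. by apply/val_inj/funext => x /=; rewrite mulrA. Qed.

Let coind_scale1 : left_id 1 coind_scale.
Proof. by move=> f; apply/val_inj/funext => x /=; rewrite mulr1. Qed.

Let coind_scaleDr : right_distributive coind_scale +%R.
Proof. by move=> a f g; apply/val_inj/funext. Qed.

Let coind_scaleDl f : {morph coind_scale^~ f : a b / a + b}.
Proof.
move=> a b; apply/val_inj/funext => x /=.
by rewrite mulrDr (zmod_morphismD (coind_morph f)).
Qed.

HB.instance Definition _ := GRing.Zmodule_isLmodule.Build R coind
  coind_scaleA coind_scale1 coind_scaleDr coind_scaleDl.

(** Evaluation at 1 turns linear maps into [coind] into additive maps into [D], so it suffices to
    extend additive maps, which divisibility allows. *)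
Lemma coind_injective : divisible D -> injective_module coind.
Proof.
move=> divD U V f g injf.
pose G0 := [set (f u, val (g u) 1) | u in [set: U]].
have hG0 : partial_morphism G0.
  split=> [|_ _ [u _ <-] [v _ <-]|d [u _ [fu <-]]].
  - by exists 0 => //; rewrite !linear0.
  - by exists (u - v) => //; rewrite !linearB.
  - by rewrite (injf u 0) ?linear0.
have [h hB hh] := pmorph_extend divD hG0.
have lin v : (fun a : R => h (a *: v)) \in coind_pred.
  by apply/asboolP => a b; rewrite scalerBl hB.
have hl : linear (fun v => exist (fun f => f \in coind_pred) _ (lin v) : coind).
  move=> a x y; apply/val_inj/funext => b /=.
  rewrite -[RHS]/(h ((b * a) *: x) + h (b *: y)).
  by rewrite scalerDr scalerA (zmod_morphismD hB).
exists (mklin hl) => u; apply/val_inj/funext => a /=.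
by rewrite -linearZ (hh _ (val (g (a *: u)) 1)); [rewrite linearZ /= mul1r|exists (a *: u)].
Qed.

End Coinduction.

Section EnoughInjectives.
Local Open Scope classical_set_scope.

Definition rat_int : {pred rat} := fun x => x \is a Num.int.
Let rat_int_closed : zmod_closed rat_int.
Proof. by split=> [|x y]; rewrite /rat_int unfold_in; [exact: rpred0|exact: rpredB]. Qed.
HB.instance Definition _ := GRing.isZmodClosed.Build rat rat_int rat_int_closed.

Definition rat_mod_int : zmodType := Quotient.quot rat_int.

Lemma rat_mod_int_eq0 x : \pi_(Quotient.quot rat_int) x = 0 :> rat_mod_int <-> x \is a Num.int.
Proof.
rewrite -[0](raddf0 \pi_(Quotient.quot rat_int)).
split=> [/eqP|xi]; last (apply/eqP); by rewrite -Quotient.idealrBE subr0.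
Qed.

Lemma rat_mod_int_divisible : divisible rat_mod_int.
Proof.
move=> d n n0; exists (\pi_(Quotient.quot rat_int) (repr d / n%:R)).
rewrite -[RHS]reprK -raddfMn -(mulr_natr (_ / _)) divfK //.
by rewrite pnatr_eq0; lia.
Qed.

(** On the subgroup generated by [v], send [v] to the class of [1/n] if [v] has order [n], and to
    that of [1/2] if its order is infinite; then extend to [V]. Here [n > 1] because [v] is
    nonzero. *)
Lemma separating_character (V : zmodType) (v : V) : v != 0 ->
  exists2 h : V -> rat_mod_int, zmod_morphism h & h v != 0.
Proof.
move=> v0.
have [d [dv d0]] : exists d : rat_mod_int, (forall k, v *~ k = 0 -> d *~ k = 0) /\ d != 0.
  pose dom n := `[< (0 < n)%N /\ v *+ n = 0 >].
  pose e n : rat_mod_int := \pi_(Quotient.quot rat_int) (n%:R^-1).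
  have e0 n : (1 < n)%N -> e n != 0.
    move=> n1; apply/eqP => /rat_mod_int_eq0 /intrP[k ek].
    have : n%:R * k%:~R = 1 :> rat by rewrite -ek divff // pnatr_eq0; lia.
    rewrite -[n%:R]/(n%:Z%:~R) -intrM -[1]/(1%:~R) => /eqP; rewrite eqr_int => /eqP.
    move=> /(congr1 absz)/eqP; rewrite abszM muln_eq1 => /andP[/eqP]; lia.
  have [[n0 hn0]|none] := pselect (exists n, dom n); last first.
    exists (e 2%N); split; last exact: e0.
    move=> k vk; have [->|k0] := eqVneq k 0; first by rewrite mulr0z.
    case: none; exists `|k|%N; apply/asboolP; split; first by rewrite absz_gt0.
    case: k vk k0 => n; first by [].
    by rewrite NegzE mulrNz => /eqP; rewrite oppr_eq0 => /eqP.
  have [n /asboolP[n_gt0 vn] nmin] := ex_minnP (ex_intro _ n0 hn0).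
  exists (e n); split; last first.
    by apply: e0; case: n n_gt0 vn {nmin} => [|[|]] // _ /eqP; rewrite mulr1n (negPf v0).
  move=> k vk; have nz : n%:Z != 0 by lia.
  have vr : v *~ (k %% n)%Z = 0.
    by rewrite /modz mulrzBr mulrC mulrzA vk -[v *~ n]/(v *+ n) vn mul0rz subrr.
  have r0 : (k %% n)%Z = 0.
    have := modz_ge0 k nz; have := ltz_pmod k (_ : 0 < n%:Z); move: vr.
    case: (k %% n)%Z => // -[//|r] vr /(_ n_gt0) rn _; exfalso.
    suff : (n <= r.+1)%N by lia.
    by apply: nmin; apply/asboolP; split.
  rewrite (divz_eq k n) r0 addr0 mulrC mulrzA (_ : e n *~ n = 0) ?mul0rz //.
  rewrite -[_ *~ _]/(_ *+ _) -raddfMn; apply/rat_mod_int_eq0.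
  by rewrite -(mulr_natr _^-1) mulVf ?rpred1 // pnatr_eq0; lia.
pose G0 := [set x : V * rat_mod_int | exists k, x = (v, d) *~ k].
have hG0 : partial_morphism G0.
  split=> [|_ _ [k ->] [l ->]|e [k]]; first by exists 0; rewrite mulr0z.
    by exists (k - l); rewrite mulrzBr.
  by rewrite pairMz => -[/esym vk ->]; exact: dv.
have [h hB hh] := pmorph_extend rat_mod_int_divisible hG0.
by exists h => //; rewrite (hh v d) //; exists 1.
Qed.

(** The module embeds in the one coinduced from a power of Q/Z with one factor for each character
    [l] of [V], by sending [v] to [a |-> (l |-> l (a v))]. Evaluation at [a = 1] and a separating
    character give injectivity. *)
Theorem enough_injectives (R : comNzRingType) (V : lmodType R) :
  exists E : lmodType R, injective_module E /\
    exists f : {linear V -> E}, injective f.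
Proof.
pose L := {h : V -> rat_mod_int | zmod_morphism h}.
pose D : zmodType := L -> rat_mod_int.
have divD : divisible D.
  move=> d n n0; have [e he] := choice (fun l => rat_mod_int_divisible (d l) n0).
  exists e; apply/funext => l; rewrite -he.
  by elim: (n) => [//|k IH]; rewrite !mulrS -IH.
exists (coind R D); split; first exact: coind_injective.
have cP v : (fun a l => sval l (a *: v) : rat_mod_int) \in @coind_pred R D.
  by apply/asboolP => a b; apply/funext => l; rewrite scalerBl (svalP l).
have lin : linear (fun v => exist (fun f => f \in @coind_pred R D) _ (cP v) : coind R D).
  move=> a x y; apply/val_inj/funext => b; apply/funext => l /=.
  rewrite -[RHS]/(sval l ((b * a) *: x) + sval l (b *: y)).
  by rewrite scalerDr scalerA (zmod_morphismD (svalP l)).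
exists (mklin lin) => x y /= /(congr1 val) /= exy; apply/eqP; rewrite -subr_eq0.
apply: contraT => /separating_character[h hB].
have := congr1 (fun f => f 1 (exist _ h hB)) exy.
by rewrite /= !scale1r hB => ->; rewrite subrr eqxx.
Qed.

Theorem coker_injective (R : comNzRingType) (U V : lmodType R) (g : {linear U -> V}) :
  exists (E : lmodType R) (f : {linear V -> E}), injective_module E /\
    forall v, f v = 0 <-> exists u, g u = v.
Proof.
have [E [injE [f injf]]] := enough_injectives (coker g).
exists E, (f \o coker_pi g); split=> // v /=; rewrite -coker_pi0.
by split=> [|->]; rewrite ?linear0 // => e; apply: injf; rewrite e linear0.
Qed.

End EnoughInjectives.

Section DescendingComplex.
Variables (R : pzRingType) (A : nat -> lmodType R) (d : forall k, {linear A k -> A k.+1}).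
Hypothesis dd : forall k x, d k.+1 (d k x) = 0.
Variable t : int.

Definition int_obj (a : int) : lmodType R := if a is Posz k then A k else 'rV[R]_0.

Definition int_diff (a b : int) : {linear int_obj a -> int_obj b} :=
  match a, b with
  | Posz k, Posz l => cast A k.+1 l \o d k
  | _, _ => \0
  end.

Lemma int_diff_shape a b : b != a + 1 -> forall x, int_diff a b x = 0.
Proof. by case: a b => [k|k] [l|l] //= kl x; rewrite cast_neq //; lia. Qed.

Lemma int_diffK a b c x : int_diff b c (int_diff a b x) = 0.
Proof.
case: a b c x => [k|k] [l|l] [m|m] x //=; rewrite ?linear0 //.
have [<-|/eqP kl] := eqVneq k.+1 l; last by rewrite (cast_neq _ kl) !linear0.
by rewrite cast_id dd linear0.
Qed.

Let desc_shape (i j : int) : i != j + 1 -> forall x, int_diff (t - i) (t - j) x = 0.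
Proof. by move=> ij; apply: int_diff_shape; lia. Qed.

(* [A k] is placed in degree [t - k]. *)
Definition descending_complex : complex R :=
  @Complex R (fun i => int_obj (t - i)) (fun i j => int_diff (t - i) (t - j))
    desc_shape (fun i j k => @int_diffK (t - i) (t - j) (t - k)).

Lemma descending_boundary i (x : descending_complex i) b (y : int_obj b) :
  int_diff b (t - i) y = x -> is_boundary x.
Proof.
have eb : b = t - (t - b) by lia.
move: y; rewrite eb => y yx; by exists (t - b), y.
Qed.

Lemma descending_cycle i (x : descending_complex i) : is_cycle x ->
  forall b, int_diff (t - i) b x = 0.
Proof. by move=> cx b; have := cx (t - b); rewrite /= (_ : t - (t - b) = b) //; lia. Qed.

End DescendingComplex.

(** * Injective resolutions of complexes with homology bounded above *)

Section InjectiveResolution.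
Variables (R : comNzRingType) (X : complex R) (s : int).
Hypothesis Xs : forall n, s < n -> ~ nonzero_homology X n.

Definition pairlin (U V W : lmodType R) (f : {linear U -> V}) (g : {linear U -> W}) :
  {linear U -> (V * W)%type}.
Proof. by refine (@mklin _ _ _ (fun x => (f x, g x)) _) => a x y; rewrite !linearP. Defined.

Fixpoint res_deg k : int := if k is k'.+1 then res_deg k' - 1 else s + 1.

Lemma res_degE k : res_deg k = s + 1 - k%:Z.
Proof. by elim: k => [|k IH] /=; lia. Qed.

(* [stage_map] is a differential of the mapping cone of [X -> I], where [I] is built
   downwards from degree [s + 1]; embedding the cokernel of [stage_map] in an
   injective module gives the next term of [I] and keeps the cone exact. *)
Record stage k := Stage {
  stage_src : lmodType R;
  stage_obj : lmodType R;
  stage_map : {linear stage_src -> (X (res_deg k.+1) * stage_obj)%type}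
}.

Definition stage_env k (st : stage k) := cid (coker_injective (stage_map st)).
Definition stage_env_map k (st : stage k) := cid (svalP (stage_env st)).

Definition next_stage k (st : stage k) : stage k.+1 :=
  @Stage k.+1 (X (res_deg k.+1) * stage_obj st)%type (sval (stage_env st))
    (pairlin (\- (diff X (res_deg k.+1) (res_deg k.+2) \o fst)) (sval (stage_env_map st))).

(** The resolution is 0 in degree [s + 1], so its first injective module, in degree [s], receives
    the cokernel of the differential of [X] from degree [s + 1] to [s]. *)
Definition stage0 : stage 0 :=
  @Stage 0 (X (res_deg 0)) 'rV[R]_0 (pairlin (\- (diff X (res_deg 0%N) (res_deg 1%N))) \0).

Definition stages := nat_rect stage stage0 next_stage.
Definition res_obj k : lmodType R := stage_obj (stages k).
Definition res_proj k : {linear (X (res_deg k.+1) * res_obj k)%type -> res_obj k.+1} :=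
  sval (stage_env_map (stages k)).

Lemma res_obj_injective k : injective_module (res_obj k).
Proof.
case: k => [|k]; last exact: (proj1 (svalP (stage_env_map (stages k)))).
by move=> U V h g _; exists \0 => x; apply/esym/thinmx0.
Qed.

Lemma res_proj_eq0 k v : res_proj k v = 0 <-> exists w, stage_map (stages k) w = v.
Proof. exact: (proj2 (svalP (stage_env_map (stages k)))). Qed.

(** Consecutive differentials of the cone compose to zero. Taking [x = 0] shows that [res_diff] is a
    differential, taking [y = 0] that [res_map] is compatible with it. *)
Lemma res_proj_map k x y :
  res_proj k.+1 (- diff X (res_deg k.+1) (res_deg k.+2) x, res_proj k (x, y)) = 0.
Proof. by apply/res_proj_eq0; exists (x, y). Qed.

Definition res_diff k : {linear res_obj k -> res_obj k.+1} := res_proj k \o pairlin \0 idfun.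

Lemma res_diffK k x : res_diff k.+1 (res_diff k x) = 0.
Proof. by have := res_proj_map (0 : X (res_deg k.+1)) x; rewrite linear0 oppr0. Qed.

Definition res_map k : {linear X (res_deg k) -> res_obj k} :=
  match k return {linear X (res_deg k) -> res_obj k} with
  | 0 => \0
  | k'.+1 => res_proj k' \o pairlin idfun \0
  end.

Lemma res_map_diff k x :
  res_map k.+1 (diff X (res_deg k) (res_deg k.+1) x) = res_diff k (res_map k x).
Proof.
case: k x => [|k] x.
  rewrite linear0 /=; apply/res_proj_eq0; exists (- x) => /=.
  by rewrite linearN opprK.
have := res_proj_map x (0 : res_obj k); rewrite /res_map /res_diff /= => e.
apply/eqP; rewrite eq_sym -subr_eq0 -linearB; apply/eqP; rewrite -[RHS]e; congr (res_proj _ _).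
by rewrite -[LHS]/(_ - _, _ - _) subr0 sub0r.
Qed.

Lemma res_projD k x y : res_proj k (x, y) = res_map k.+1 x + res_diff k y.
Proof.
have -> : (x, y) = (x, 0) + (0, y) by rewrite -[RHS]/(_ + _, _ + _) addr0 add0r.
exact: linearD.
Qed.

(** By exactness of the cone [(x, - y)] comes from [stage_map], whose first component is minus the
    differential of [X]. *)
Lemma res_map_inj k (x : X (res_deg k.+1)) y :
  is_cycle x -> res_map k.+1 x = res_diff k y -> is_boundary x.
Proof.
move=> cx fx; have /res_proj_eq0 : res_proj k (x, - y) = 0 by rewrite res_projD fx linearN subrr.
case: k x y cx fx => [|k] x y cx fx [w].
  by case=> <- _; exists (res_deg 0), (- w); rewrite linearN.
by case: w => x' y' [<- _]; exists (res_deg k.+1), (- x'); rewrite linearN.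
Qed.

(** Exactness of the cone at [(0, y)] gives a preimage [(x, z)]: its first component says that [x]
    is a cycle, its second expresses [y]. *)
Lemma res_map_surj k (y : res_obj k.+1) : res_diff k.+1 y = 0 ->
  exists2 x : X (res_deg k.+1), is_cycle x & exists z, y = res_map k.+1 x + res_diff k z.
Proof.
move=> /res_proj_eq0[[x z]] [/eqP]; rewrite oppr_eq0 => /eqP dx <-.
exists x; last by exists z; rewrite res_projD.
by apply: is_cycleP dx; rewrite /=; lia.
Qed.

Definition res_complex := descending_complex res_diffK (s + 1).

(** The index [a] stands for [s + 1 - i]; it is kept independent of [i] so that cases on it are
    possible. *)
Definition res_chain i a : {linear X i -> int_obj res_obj a} :=
  match a return {linear X i -> int_obj res_obj a} with
  | Posz k => res_map k \o cast X i (res_deg k)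
  | Negz _ => \0
  end.

Lemma res_chain_diff i j x : res_chain j (s + 1 - j) (diff X i j x) =
  int_diff res_diff (s + 1 - i) (s + 1 - j) (res_chain i (s + 1 - i) x).
Proof.
have [ij|ij] := eqVneq i (j + 1); last first.
  by rewrite diff_shape // linear0 int_diff_shape //; lia.
case ei: (s + 1 - i) => [k|k]; last first.
  case ej: (s + 1 - j) => [[|l]|l] //; lia.
have -> : s + 1 - j = Posz k.+1 by lia.
have iu : i = res_deg k by rewrite res_degE; lia.
have ju : j = res_deg k.+1 by rewrite res_degE; lia.
clear ij; subst i; rewrite /= !cast_id cast_diffr //; exact: (res_map_diff x).
Qed.

Lemma res_chainE k x : res_chain (res_deg k.+1) (Posz k.+1) x = res_map k.+1 x.
Proof. by rewrite -[LHS]/(res_map k.+1 (cast X _ _ x)) cast_id. Qed.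

Lemma res_chain_inj k a b (x : X (res_deg k.+1)) (y : int_obj res_obj b) : a = Posz k.+1 ->
  is_cycle x -> int_diff res_diff b a y = res_chain (res_deg k.+1) a x -> is_boundary x.
Proof.
have h0 (z : X (res_deg k.+1)) : is_cycle z -> 0 = res_map k.+1 z -> is_boundary z.
  by move=> cz e; apply: (res_map_inj (y := 0) cz); rewrite -e linear0.
move=> -> cx; rewrite res_chainE; case: b y => [l|l] y; last exact: h0.
rewrite -[int_diff _ _ _ _]/(cast res_obj l.+1 k.+1 (res_diff l y)).
have [lk|/eqP lk] := eqVneq l.+1 k.+1; last by rewrite cast_neq //; exact: h0.
by case: lk => lk; subst l; rewrite cast_id => /esym; exact: res_map_inj.
Qed.

Lemma res_chain_surj k a (y : int_obj res_obj a) : a = Posz k.+1 ->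
  (forall b, int_diff res_diff a b y = 0) ->
  exists2 x : X (res_deg k.+1), is_cycle x &
    exists b (z : int_obj res_obj b), int_diff res_diff b a z = y - res_chain (res_deg k.+1) a x.
Proof.
move=> e; subst a => cy.
have [x cx [z ->]] : exists2 x : X (res_deg k.+1), is_cycle x &
    exists z, y = res_map k.+1 x + res_diff k z.
  by apply: res_map_surj; have := cy (Posz k.+2); rewrite /= cast_id.
exists x => //; exists (Posz k), z.
rewrite res_chainE addrAC subrr add0r -[LHS]/(cast res_obj k.+1 k.+1 (res_diff k z)).
by rewrite cast_id.
Qed.

Theorem injective_resolution_exists :
  exists (I : complex R) (f : chain_map X I),
  [/\ forall n, injective_module (I n), forall n, s < n -> forall x : I n, x = 0
    & quasi_iso f].
Proof.
have I0 n a (x : int_obj res_obj a) : s < n -> a = s + 1 - n -> x = 0.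
  by case: a x => [[|k]|k] x sn ea; [exact: thinmx0|lia|exact: thinmx0].
exists res_complex.
exists (@ChainMap _ X res_complex (fun i => res_chain i (s + 1 - i)) res_chain_diff).
split=> [n|n sn x|].
- rewrite /=; case: (s + 1 - n) => k; first exact: res_obj_injective.
  by move=> U V g h _; exists \0 => x; apply/esym/thinmx0.
- exact: I0 sn erefl.
apply/quasi_isoP => n.
have [sn|sn] := boolP (s < n).
  split=> [x cx _|y _]; first by move/no_homologyP: (Xs sn); exact.
  exists 0; first by move=> j; rewrite linear0.
  by rewrite (I0 _ _ y sn erefl) linear0 subrr; exact: boundary0.
have [k nk] : exists k, n = res_deg k.+1 by exists `|s - n|%N; rewrite res_degE; lia.
have ea : s + 1 - n = Posz k.+1 by rewrite nk res_degE; lia.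
subst n; split=> [x cx [j [y yx]]|y cy]; first exact: (res_chain_inj ea cx yx).
have [b|x cx [b [z zy]]] := res_chain_surj (y := y) ea; first exact: descending_cycle cy b.
by exists x => //; exact: descending_boundary zy.
Qed.

End InjectiveResolution.

(** * Finiteness of the depth of a local ring *)

Section Residue.
Variable S : localRingType.

Lemma maxid_residue (a : S) (l : residue S) : a \in @maxid S -> a *: l = 0.
Proof.
move=> ma; elim/quotmod_ind: l => b.
rewrite -(linearZ_LR (mklin (@quotmod_pi_linear _ _ (@maxid_submod S)))) /=.
apply/quotmod_pi0; rewrite -[_ *: _]/(a * b) mulrC -[b * a]/(b *: (a : S^o)).
exact: (rpredZ b (ma : (a : S^o) \in @maxid_submod S)).
Qed.

(** Multiples of [z] define a map from [S] to the cokernel of the differential that kills the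
    maximal ideal. It factors through the residue field and is nonzero at 1 because [z] is not a
    boundary. *)
Lemma residue_top_homology (J : complex S) (s : int) (z : J s) :
  K_injective J -> (forall n, s < n -> ~ nonzero_homology J n) ->
  is_cycle z -> ~ is_boundary z ->
  (forall a, a \in @maxid S -> is_boundary (a *: z)) ->
  nonzero_homology (hom_complex (residue S) J) s.
Proof.
move=> KJ Js cz bz mz.
pose p := coker_pi (diff J (s + 1) s).
have lin : linear (fun a : S^o => p (a *: z)).
  by move=> a x y; rewrite scalerDl linearD -scalerA linearZ.
have [a ma|e he] := @factor_quotmod _ _ _ (@maxid_submod S) (mklin lin).
  by rewrite /=; apply/coker_pi0/(is_boundaryP _ erefl)/mz.
apply: (hom_top_homology KJ Js (e := e)).
  elim/quotmod_ind => a; exists (a *: z); last exact: he.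
  by move=> j; rewrite linearZ /= cz scaler0.
exists (quotmod_pi _ 1); rewrite he /= scale1r => /coker_pi0/(is_boundaryP _ erefl).
exact: bz.
Qed.

End Residue.

(** * The mapping cone of multiplication by a ring element *)

Section Cone.
Variables (S : comNzRingType) (J : complex S) (c : S).

Let cone_obj n : lmodType S := (J (n - 1) * J n)%type.

Let cone_fun n m (p : cone_obj n) : cone_obj m :=
  (- diff J (n - 1) (m - 1) p.1, c *: cast J (n - 1) m p.1 + diff J n m p.2).

Let cone_linear n m : linear (@cone_fun n m).
Proof.
move=> a x y; apply: injective_projections; rewrite /= !(linearP (diff J _ _)).
  by rewrite opprD scalerN.
rewrite (linearP (cast J _ _)) !scalerDr !scalerA [c * a]mulrC -!addrA; congr (_ + _).
by rewrite addrCA.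
Qed.

Let cone_shape (n m : int) : n != m + 1 -> forall p, mklin (@cone_linear n m) p = 0.
Proof.
move=> nm p; rewrite /= /cone_fun !diff_shape ?cast_neq ?scaler0 ?addr0 ?oppr0 //; lia.
Qed.

Let coneK (n m k : int) p : mklin (@cone_linear m k) (mklin (@cone_linear n m) p) = 0.
Proof.
apply: injective_projections; rewrite /= /cone_fun /=.
  by rewrite (linearN (diff J _ _)) diffK !oppr0.
rewrite (linearN (cast J _ _)) (linearD (diff J _ _)) diffK addr0 (linearZ_LR (diff J _ _)).
rewrite -scalerDr.
have [nm|nm] := eqVneq n (m + 1); last first.
  rewrite (@diff_shape _ _ (n - 1) (m - 1)) ?(@cast_neq _ _ _ (n - 1) m) ?linear0
    ?addr0 ?oppr0 ?scaler0 //; lia.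
have [mk|mk] := eqVneq m (k + 1); last first.
  rewrite (@cast_neq _ _ _ (m - 1) k) ?(@diff_shape _ _ m k) ?oppr0 ?addr0 ?scaler0 //; lia.
rewrite cast_diffr ?cast_diffl ?addNr ?scaler0 //; lia.
Qed.

Definition cone : complex S := @Complex S cone_obj
  (fun n m => mklin (@cone_linear n m)) cone_shape coneK.

Lemma cone_cycleP n (u : J (n - 1)) (v : J n) : is_cycle ((u, v) : cone n) <->
  is_cycle u /\ c *: u + diff J n (n - 1) v = 0.
Proof.
split=> [cuv|[cu cv]].
  have := cuv (n - 1); rewrite /= /cone_fun /= cast_id => -[/eqP]; rewrite oppr_eq0.
  by move=> /eqP cu cv; split=> //; apply: is_cycleP cu; lia.
apply: (@is_cycleP _ _ _ _ (n - 1)); first lia.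
by rewrite /= /cone_fun /= cu cast_id cv oppr0.
Qed.

Lemma cone_boundaryP n (u : J (n - 1)) (v : J n) : is_boundary ((u, v) : cone n) <->
  exists (u' : J n) (v' : J (n + 1)),
    u = - diff J n (n - 1) u' /\ v = c *: u' + diff J (n + 1) n v'.
Proof.
have e1 : n + 1 - 1 = n by lia.
split=> [/(is_boundaryP _ erefl)[[u' v']]|[u' [v' [-> ->]]]].
  rewrite /= /cone_fun /= => -[<- <-].
  by exists (cast J (n + 1 - 1) n u'), v'; rewrite cast_diffl.
exists (n + 1), (cast J n (n + 1 - 1) u', v').
by rewrite /= /cone_fun /= cast_diffl ?castK.
Qed.

End Cone.

(** * Iterated cones on an injective resolution *)

Section KoszulInvariant.
Variable S : localRingType.

(** The neighbouring degrees are variables subject to equations, so that the relation applies to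
    degrees that are only provably equal to [i + 1] and [i - 1]. *)
Definition annihilates_up_to_homotopy (J : complex S) (a : S) :=
  exists h : forall i j, {linear J i -> J j}, forall i j k (x : J i),
    j = i + 1 -> k = i - 1 ->
    a *: x = diff J j i (h i j x) + h k i (diff J i k x).

(* [e] plays the role of a surjection from [H_0(J)] to the residue field. *)
Record koszul_invariant (J : complex S) (s : int) (e : J 0 -> residue S) : Prop := {
  kos_injective : forall n, injective_module (J n);
  kos_bounded : forall n, s < n -> forall x : J n, x = 0;
  kos_exact : forall n, n < 0 -> forall x : J n, is_cycle x -> is_boundary x;
  kos_linear : forall a (x y : J 0), is_cycle x -> is_cycle y ->
    e (a *: x + y) = a *: e x + e y;
  kos_boundary : forall x : J 0, is_boundary x -> e x = 0;
  kos_neq0 : exists2 z : J 0, is_cycle z & e z <> 0;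
  kos_hom : acyclic (hom_complex (residue S) J)
}.

Section ConeInvariant.
Variables (J : complex S) (s : int) (e : J 0 -> residue S) (c : S).

(** The homotopy acts on both components, with a sign on the shifted one; the two cross terms
    [c *: h u] cancel. *)
Lemma cone_annihilates a : annihilates_up_to_homotopy J a ->
  annihilates_up_to_homotopy (cone J c) a.
Proof.
move=> [h hh].
have lin i j : linear (fun p : cone J c i => (- h (i - 1) (j - 1) p.1, h i j p.2) : cone J c j).
  move=> b x y; apply: injective_projections; rewrite /= !(linearP (h _ _)) //.
  by rewrite opprD scalerN.
exists (fun i j => mklin (lin i j)) => i j k [u v] -> -> /=.
have e1 : i + 1 - 1 = i by lia.
apply: injective_projections; rewrite /= ?cast_id.
  rewrite !linearN !opprK (hh _ (i + 1 - 1) (i - 1 - 1)) //; lia.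
rewrite (hh _ (i + 1) (i - 1)) // (linearD (h _ _)) (linearZ_LR (h _ _)).
rewrite (linearN (cast J _ _)) scalerN.
have -> : cast J (i + 1 - 1) i (h (i - 1) (i + 1 - 1) u) = h (i - 1) i u.
  by rewrite e1 cast_id.
by rewrite addrACA addNr add0r.
Qed.

(** The homotopy is [(u, v) |-> (v, 0)]. *)
Lemma cone_self_annihilates : annihilates_up_to_homotopy (cone J c) c.
Proof.
have lin i j : linear (fun p : cone J c i => (cast J i (j - 1) p.2, 0) : cone J c j).
  by move=> b x y; apply: injective_projections; rewrite /= ?linearP ?scaler0 ?addr0.
exists (fun i j => mklin (lin i j)) => i j k [u v] -> -> /=.
have e1 : i = i + 1 - 1 by lia.
apply: injective_projections; rewrite /= ?cast_id.
  by rewrite cast_diffl // addrCA addNr addr0.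
by rewrite linear0 !addr0 castK.
Qed.

Hypotheses (hJ : koszul_invariant s e) (mc : c \in @maxid S).

(** Since [H_{-1}(J) = 0], the module [H_0] of the cone is [H_0(J) / c H_0(J)], and [e] vanishes on
    [c H_0(J)] because [c] kills the residue field. For the same reason the maps from the residue
    field to the cone form two shifted copies of those to [J]. *)
Lemma cone_invariant : exists e' : cone J c 0 -> residue S, koszul_invariant (s + 1) e'.
Proof.
(* If [u = d w], adding the boundary of [(w, 0)] to the cycle [(u, v)] gives [(0, v + c w)]; the
   functional evaluates [e] there. The default 0 concerns only [u] that are not boundaries. *)
pose w (u : J (0 - 1)) : J 0 :=
  if pselect (exists w, diff J 0 (0 - 1) w = u) is left ew then sval (cid ew) else 0.
have wP u : is_cycle u -> diff J 0 (0 - 1) (w u) = u.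
  move=> cu; rewrite /w; case: pselect => [ew|]; first exact: (svalP (cid ew)).
  case; have h0 : 0 - 1 < 0 :> int by [].
  by apply/(@is_boundaryP _ J _ u 0); last exact: (kos_exact hJ h0 cu).
pose e' (p : cone J c 0) := e (p.2 + c *: w p.1).
have cyc0 (x : J 0) : diff J 0 (0 - 1) x = 0 -> is_cycle x.
  by move=> dx; apply: is_cycleP dx.
(* Two choices of [w] differ by a cycle, whose multiple by [c] has value 0 under [e]. *)
have e'E (u : J (0 - 1)) (v x : J 0) : is_cycle ((u, v) : cone J c 0) ->
    diff J 0 (0 - 1) x = u -> e' (u, v) = e (v + c *: x).
  move=> /cone_cycleP[cu cuv] dx; rewrite /e' /=.
  have cwx : is_cycle (w u - x) by apply: cyc0; rewrite linearB wP // dx subrr.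
  have wE : w u = (w u - x) + x by rewrite subrK.
  rewrite wE scalerDr addrCA.
  rewrite (kos_linear hJ) // ?maxid_residue ?add0r //.
  by apply: cyc0; rewrite linearD linearZ /= dx [LHS]addrC.
exists e'; split=> [n|n sn [u v]|n n0 [u v]|a [u v] [u' v'] cx cy|[u v]||n].
- move=> U V f g injf.
  have [h1 hh1] := kos_injective hJ (n := n - 1) (fst \o g) injf.
  have [h2 hh2] := kos_injective hJ (n := n) (snd \o g) injf.
  exists (pairlin h1 h2) => x; apply: injective_projections => /=; [exact: hh1|exact: hh2].
- have [n1 n2] : s < n - 1 /\ s < n by lia.
  by rewrite (kos_bounded hJ n1 u) (kos_bounded hJ n2 v).
- move=> /cone_cycleP[cu cuv].
  have n1 : n - 1 < 0 by lia.
  have nn : n = n - 1 + 1 by lia.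
  have /(is_boundaryP _ nn)[u0 eu] := kos_exact hJ n1 cu.
  have : is_cycle (v + c *: u0).
    by apply: (@is_cycleP _ _ _ _ (n - 1)); [lia|rewrite linearD linearZ /= eu [LHS]addrC].
  move=> /(kos_exact hJ n0)/(is_boundaryP _ erefl)[v0 ev].
  apply/cone_boundaryP; exists (- u0), v0.
  by rewrite linearN opprK eu ev scalerN addrCA addNr addr0.
- have [/cone_cycleP[cu cuv] /cone_cycleP[cu' cuv']] := (cx, cy).
  rewrite -[X in e' X]/(a *: u + u', a *: v + v') (@e'E _ _ (a *: w u + w u')).
  + rewrite (e'E _ _ (w u)) ?wP // (e'E _ _ (w u')) ?wP //.
    rewrite -(kos_linear hJ); last 2 first.
    * by apply: cyc0; rewrite linearD linearZ /= wP // [LHS]addrC.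
    * by apply: cyc0; rewrite linearD linearZ /= wP // [LHS]addrC.
    congr (e _); rewrite !scalerDr !scalerA [c * a]mulrC -!addrA; congr (_ + _).
    by rewrite addrCA.
  + rewrite -[(_, _)]/(a *: ((u, v) : cone J c 0) + ((u', v') : cone J c 0)) => j.
    by rewrite linearP cx cy scaler0 addr0.
  + by rewrite linearP !wP.
- move=> buv; have cuv := boundary_cycle buv.
  have /cone_boundaryP[u' [v' [eu ev]]] := buv.
  rewrite (e'E _ _ (- u')) ?linearN // ev addrAC subrr add0r.
  by apply: (kos_boundary hJ); exists (0 + 1), v'.
- have [z cz ez] := kos_neq0 hJ; exists (0, z).
    by apply/cone_cycleP; split; [move=> j; rewrite linear0|rewrite scaler0 cz addr0].
  rewrite (e'E _ _ 0) ?linear0 ?scaler0 ?addr0 //.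
  by apply/cone_cycleP; split; [move=> j; rewrite linear0|rewrite scaler0 cz addr0].
- apply/no_homologyP => f cf.
  have /acyclicP homJ := kos_hom hJ.
  have [u hu] := hom_ex (fst \o mklin (hom_linear f)).
  have [v hv] := hom_ex (snd \o mklin (hom_linear f)).
  have fE l : hom_fun f l = (hom_fun u l, hom_fun v l) :> cone J c n.
    by rewrite hu hv /=; case: (hom_fun f l).
  have cc l V (g : Defs.hom (residue S) V) : c *: hom_fun g l = 0.
    by rewrite -[c *: _](linearZ_LR (mklin (hom_linear g))) maxid_residue // linear0.
  have cl l : is_cycle ((hom_fun u l, hom_fun v l) : cone J c n).
    by move=> j; rewrite -fE; have /(congr1 (fun f => hom_fun f l)) := cf j.
  have nn : n = n - 1 + 1 by lia.
  have /homJ/(is_boundaryP _ nn)[u' eu'] : is_cycle (u : hom_complex (residue S) J (n - 1)).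
    by move=> j; apply/val_inj/funext => l; have /cone_cycleP[+ _] := cl l; apply.
  have /homJ/(is_boundaryP _ erefl)[v' ev'] : is_cycle (v : hom_complex (residue S) J n).
    apply: (@is_cycleP _ _ _ _ (n - 1)); first lia.
    by apply/val_inj/funext => l; have /cone_cycleP[_] := cl l; rewrite cc add0r.
  (* The sign on [u'] undoes the one in the cone differential; the cross term [c *: u'] is zero by
     [cc]. *)
  have [g hg] := hom_ex (pairlin (\- (cast J n (n + 1 - 1) \o mklin (hom_linear u')))
    (mklin (hom_linear v')) : {linear residue S -> cone J c (n + 1)}).
  exists (n + 1), g; apply/val_inj/funext => l.
  rewrite -[RHS]/(hom_fun f l) fE -eu' -ev' /= hg /= linearN opprK.
  apply: injective_projections => /=.
    by rewrite cast_diffl //; lia.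
  rewrite linearN castK ?scalerN ?cc ?oppr0 ?add0r //; lia.
Qed.

End ConeInvariant.

Lemma koszul_iterate (xs : seq S) (J : complex S) s (e : J 0 -> residue S) :
  koszul_invariant s e -> {subset xs <= @maxid S} ->
  exists (J' : complex S) s' (e' : J' 0 -> residue S), koszul_invariant s' e' /\
    forall x, x \in xs -> annihilates_up_to_homotopy J' x.
Proof.
move=> hJ; elim: xs => [|x xs IH] mx; first by exists J, s, e.
have [|J' [s' [e' [hJ' ann]]]] := IH; first by move=> y yxs; rewrite mx // inE yxs orbT.
have [e'' he''] := cone_invariant hJ' (mx x (mem_head _ _)).
exists (cone J' x), (s' + 1), e''; split=> // y; rewrite inE => /predU1P[->|/ann].
  exact: cone_self_annihilates.
exact: cone_annihilates.
Qed.

Lemma annihilates_boundary (J : complex S) a n (z : J n) :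
  annihilates_up_to_homotopy J a -> is_cycle z -> is_boundary (a *: z).
Proof.
move=> [h hh] cz; rewrite (hh n (n + 1) (n - 1)) // cz linear0 addr0.
by exists (n + 1), (h n (n + 1) z).
Qed.

(** The elements acting null-homotopically form an ideal, so generators of the maximal ideal
    suffice. *)
Lemma annihilates_comb J a x y : annihilates_up_to_homotopy J x ->
  annihilates_up_to_homotopy J y -> annihilates_up_to_homotopy J (a * x + y).
Proof.
move=> [h hh] [g hg].
have lin i j : linear (fun z => a *: h i j z + g i j z).
  move=> b u v; rewrite (linearP (h _ _)) (linearP (g _ _)) !scalerDr !scalerA.
  by rewrite [a * b]mulrC addrACA.
exists (fun i j => mklin (lin i j)) => i j k z ej ek /=.
rewrite scalerDl -scalerA (hh i j k) // (hg i j k) // scalerDr linearD linearZ /=.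
by rewrite addrACA.
Qed.

Lemma annihilates0 J : annihilates_up_to_homotopy J 0.
Proof. by exists (fun i j => \0) => i j k z _ _ /=; rewrite scale0r linear0 addr0. Qed.

(** [H_0(J)] is nonzero and [J] is bounded above, so a top nonzero homology module exists. It is
    killed by the maximal ideal, hence yields a nonzero class of maps from the residue field,
    against [kos_hom]. *)
Lemma no_koszul_invariant (J : complex S) s (e : J 0 -> residue S) : koszul_invariant s e ->
  ~ forall a, a \in @maxid S -> annihilates_up_to_homotopy J a.
Proof.
move=> hJ ann.
(* Nonnegative degrees suffice for the search, as degree 0 is already nonzero. *)
pose nz n := `[< nonzero_homology J (Posz n) >].
have nz0 : exists n, nz n.
  exists 0%N; apply/asboolP/nonzero_homologyP; have [z cz ez] := kos_neq0 hJ.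
  by exists z; split=> // /(kos_boundary hJ).
have nz_le n : nz n -> (n <= `|s|)%N.
  move=> /asboolP/nonzero_homologyP[z [_ bz]]; rewrite leqNgt; apply/negP => sn.
  apply: bz; have sn' : s < Posz n by lia.
  by rewrite (kos_bounded hJ sn' z); exact: boundary0.
have [n /asboolP/nonzero_homologyP[z [cz bz]] nmax] := ex_maxnP nz0 nz_le.
apply: (kos_hom hJ (n := n)); apply: (residue_top_homology _ _ cz bz).
- exact: K_injective_bounded (kos_injective hJ) (kos_bounded hJ).
- move=> m; case: m => // m nm hm.
  have : (m <= n)%N by apply: nmax; apply/asboolP.
  by move: nm; lia.
- by move=> a ma; exact: annihilates_boundary (ann _ ma) cz.
Qed.

(* Otherwise the injective resolution of [S] satisfies the invariant, and passing
   to iterated mapping cones of generators of the maximal ideal contradicts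
   [no_koszul_invariant]. *)
Theorem ring_ext_nonzero (gs : seq S) : {subset gs <= @maxid S} ->
  (forall K : S -> Prop, K 0 -> (forall a x y, K x -> K y -> K (a * x + y)) ->
     (forall g, g \in gs -> K g) -> forall a, a \in @maxid S -> K a) ->
  exists (I : complex S) (n : int),
    injective_resolution (stalk (S^o : lmodType S)) I /\
    nonzero_homology (hom_complex (residue S) I) n.
Proof.
move=> gm hgs; pose X := stalk (S^o : lmodType S).
have bX n (x : X n) : is_boundary x -> x = 0 by move=> [j [y <-]].
have cX n (x : X n) : is_cycle x by [].
have X0 n (x : X n) : n != 0 -> x = 0.
  by rewrite /X /= in x *; move: x; rewrite /stalk_obj; case: eqP => // _ x _; exact: thinmx0.
have Xs n : 0 < n -> ~ nonzero_homology X n.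
  move=> n0 /nonzero_homologyP[x [_ bx]]; apply: bx.
  by rewrite (X0 _ x) ?gt_eqF //; exact: boundary0.
have [I [f [injI I0 qf]]] := injective_resolution_exists Xs.
have KI := K_injective_bounded injI I0.
have rI : injective_resolution X I by split=> //; exists f.
have qfP := (quasi_isoP f).1 qf.
have [[n hn]|nohom] := pselect (exists n, nonzero_homology (hom_complex (residue S) I) n).
  by exists I, n.
(* The inverse of [f] on [H_0], on representatives; it is determined on cycles because 0 is the only
   boundary of [X]. *)
pose pre (z : I 0) : S^o := if pselect (exists x : X 0, is_boundary (z - f 0 x)) is left h
  then sval (cid h) else 0.
have preP z : is_cycle z -> is_boundary (z - f 0 (pre z)).
  move=> cz; rewrite /pre; case: pselect => [h|]; first exact: (svalP (cid h)).
  by case; have [x _ bx] := (qfP 0).2 z cz; exists x.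
have preE z (x : X 0) : is_cycle z -> is_boundary (z - f 0 x) -> pre z = x.
  move=> cz bx; apply/eqP; rewrite -subr_eq0; apply/eqP/(bX 0).
  apply: (qfP 0).1 => //; rewrite linearB -[X in is_boundary X](subrKA z) -[f 0 (pre z) - z]opprB.
  by apply: boundaryD => //; apply: boundaryN; exact: preP.
pose e z := quotmod_pi (@maxid_submod S) (pre z) : residue S.
have inv : koszul_invariant 0 e.
  split=> // [n n0 x cx|a x y cx cy|x bx||n hn].
  - have [x' _ bx] := (qfP n).2 x cx; rewrite -(subr0 x) -(linear0 (f n)).
    by rewrite -(X0 n x') // lt_eqF.
  - rewrite /e -(@quotmod_pi_linear _ _ (@maxid_submod S)); congr quotmod_pi.
    apply: preE; first by move=> j; rewrite linearP cx cy scaler0 addr0.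
    rewrite linearP opprD addrACA -scalerBr.
    by apply: boundaryD; [apply: boundaryZ|]; exact: preP.
  - have -> : e x = quotmod_pi _ 0.
      by congr quotmod_pi; apply: preE (boundary_cycle bx) _; rewrite linear0 subr0.
    by apply/quotmod_pi0; exact: rpred0.
  - exists (f 0 (1 : S^o)); first exact: chain_cycle.
    have -> : e (f 0 (1 : S^o)) = quotmod_pi _ 1.
      congr quotmod_pi; apply: preE; first exact: chain_cycle.
      by rewrite subrr; exact: boundary0.
    move=> /quotmod_pi0; rewrite -[_ \in _]/(1 \in @maxid S).
    by apply/negP; have [[]] := @maxid_maximal S.
  - by apply: nohom; exists n.
have [J [s [e' [hJ ann]]]] := koszul_iterate inv gm.
(* [hgs] is applied to the predicate of annihilating [J] up to homotopy. *)
case: (no_koszul_invariant hJ); apply: hgs => // [|a x y].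
  exact: annihilates0.
exact: annihilates_comb.
Qed.

End KoszulInvariant.

(** * Localization *)

Section LocalizedModules.
Variables (R : comNzRingType) (p : prime_idealr R).
Notation Rp := (loc_ring p).

Definition emb (a : R) : Rp := mkfrac (a : R^o) (compl1 p).
Definition inv_emb (s : compl p) : Rp := mkfrac (1 : R^o) s.

Lemma fracD (M : lmodType R) (m n : M) (s t : compl p) :
  mkfrac m s + mkfrac n t = mkfrac (val t *: m + val s *: n) (compl_mul s t).
Proof. exact: loc_addE. Qed.

Lemma fracZ (M : lmodType R) (a : R) (m : M) (s t : compl p) :
  (mkfrac (a : R^o) s : Rp) *: mkfrac m t = mkfrac (a *: m) (compl_mul s t).
Proof. exact: loc_scaleE. Qed.

Lemma frac_eq0 (M : lmodType R) (m : M) (s : compl p) :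
  mkfrac m s = 0 <-> exists u : compl p, val u *: m = 0.
Proof.
split=> [/eqP/mkfracP[u]|[u um]].
  by rewrite /= mulr1 scaler0 => um; exists u.
by apply/eqP/mkfracP; exists u; rewrite /= mulr1 scaler0.
Qed.

Lemma embD a b : emb (a + b) = emb a + emb b.
Proof.
rewrite [RHS]fracD; apply: mkfrac_eq.
by rewrite /= mulr1 !scale1r.
Qed.

Lemma embM a b : emb (a * b) = emb a * emb b.
Proof. by rewrite [RHS](fracZ a (b : R^o)); apply: mkfrac_eq; rewrite /= mulr1. Qed.

Lemma emb1 : emb 1 = 1. Proof. by []. Qed.

Lemma inv_embK s : inv_emb s * emb (val s) = 1.
Proof.
rewrite [LHS](fracZ 1 (val s : R^o)); apply: mkfrac_eq.
by rewrite /GRing.scale /=; ring.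
Qed.

Lemma embK s : emb (val s) * inv_emb s = 1. Proof. by rewrite mulrC inv_embK. Qed.

Lemma inv_embM s t : inv_emb (compl_mul s t) = inv_emb s * inv_emb t.
Proof. by rewrite [RHS](fracZ 1 (1 : R^o)) scale1r. Qed.

Lemma fracE (M : lmodType R) (m : M) (s : compl p) :
  mkfrac m s = inv_emb s *: mkfrac m (compl1 p).
Proof. by rewrite fracZ; apply: mkfrac_eq; rewrite /= scale1r mulr1. Qed.

Section Restriction.
Variable V : lmodType Rp.

(** Restriction of scalars along [emb], on the same carrier so that elements can be read over either
    ring. *)
Definition restrict : Type := V.
HB.instance Definition _ := GRing.Zmodule.on restrict.

Definition restrict_scale (a : R) (x : restrict) : restrict := emb a *: (x : V).

Let restrict_scaleA a b x : restrict_scale a (restrict_scale b x) = restrict_scale (a * b) x.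
Proof. by rewrite /restrict_scale scalerA embM. Qed.

Let restrict_scale1 : left_id 1 restrict_scale.
Proof. by move=> x; rewrite /restrict_scale emb1 scale1r. Qed.

Let restrict_scaleDr : right_distributive restrict_scale +%R.
Proof. by move=> a x y; rewrite /restrict_scale scalerDr. Qed.

Let restrict_scaleDl x : {morph restrict_scale^~ x : a b / a + b}.
Proof. by move=> a b; rewrite /restrict_scale embD scalerDl. Qed.

HB.instance Definition _ := GRing.Zmodule_isLmodule.Build R restrict
  restrict_scaleA restrict_scale1 restrict_scaleDr restrict_scaleDl.

Lemma restrictZ a (x : restrict) : a *: x = emb a *: (x : V).
Proof. by []. Qed.
End Restriction.

Lemma unit_scale_inj (V : lmodType Rp) (s : compl p) (x y : V) :
  emb (val s) *: x = emb (val s) *: y -> x = y.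
Proof.
by move=> /(congr1 (fun z => inv_emb s *: z)); rewrite !scalerA inv_embK !scale1r.
Qed.

Lemma frac1_linear (M : lmodType R) :
  linear (fun m : M => mkfrac m (compl1 p) : restrict (loc p M)).
Proof.
move=> a m n; rewrite restrictZ.
rewrite [RHS](_ : _ = emb a *: mkfrac m (compl1 p) + mkfrac n (compl1 p)) //.
rewrite [emb a *: mkfrac m _]fracZ fracD; apply: mkfrac_eq.
by rewrite /= !mulr1 !scale1r.
Qed.

Definition frac1 (M : lmodType R) : {linear M -> restrict (loc p M)} :=
  mklin (@frac1_linear M).

Lemma frac1E (M : lmodType R) (m : M) : frac1 M m = mkfrac m (compl1 p). Proof. by []. Qed.

Section Lift.
Variables (M : lmodType R) (V : lmodType Rp) (f : {linear M -> restrict V}).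

Lemma restrict_linearZ a m : f (a *: m) = emb a *: (f m : V) :> V.
Proof. exact: (linearZ_LR f). Qed.

(** The universal property of localization: the adjoint of [f] under restriction of scalars. *)
Definition loc_lift_fun (x : loc p M) : V := inv_emb (repr x).2 *: (f (repr x).1 : V).

Lemma loc_lift_funE m s : loc_lift_fun (mkfrac m s) = inv_emb s *: (f m : V).
Proof.
rewrite /loc_lift_fun; have /eqP/mkfracP[u] := mkfrac_repr m s.
case: (repr (mkfrac m s)) => n t /= e.
(* The representatives agree only after multiplication by [u] and the denominators, which act
   invertibly on [V]. *)
apply: (@unit_scale_inj _ u); apply: (@unit_scale_inj _ s); apply: (@unit_scale_inj _ t).
rewrite !scalerA; have {}e := congr1 (fun x => f x : V) e; rewrite /= !restrict_linearZ !embM in e.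
transitivity ((inv_emb t * emb (val t)) *: ((emb (val u) * emb (val s)) *: (f n : V))).
  by rewrite scalerA; congr (_ *: _); ring.
rewrite e; transitivity ((inv_emb t * emb (val t)) * (emb (val u) * emb (val t)) *: (f m : V)).
  by rewrite scalerA.
rewrite inv_embK -(inv_embK s); congr (_ *: _); ring.
Qed.

Lemma loc_lift_linear : linear loc_lift_fun.
Proof.
elim/loc_ind => a s; elim/loc_ind => m t; elim/loc_ind => n w.
rewrite fracZ fracD !loc_lift_funE linearD -[X in _ *: X]/((f _ : V) + (f _ : V)).
rewrite !restrict_linearZ /= !inv_embM embM.
rewrite [mkfrac (a : R^o) s](fracE (a : R^o)) -[mkfrac (a : R^o) (compl1 p)]/(emb a).
rewrite -[inv_emb s *: _]/(inv_emb s * emb a) scalerDr !scalerA; congr (_ *: _ + _ *: _).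
  rewrite -[RHS]mulr1 -(inv_embK w); ring.
rewrite -[RHS]mul1r -[X in _ = X * _]mulr1 -{1}(inv_embK s) -(inv_embK t); ring.
Qed.

Definition loc_lift : {linear loc p M -> V} := mklin loc_lift_linear.

Lemma loc_liftE m s : loc_lift (mkfrac m s) = inv_emb s *: (f m : V).
Proof. exact: loc_lift_funE. Qed.
End Lift.

Section LocMap.
Variables (M N : lmodType R) (f : {linear M -> N}).
Definition locmap : {linear loc p M -> loc p N} := loc_lift (frac1 N \o f).
Lemma locmapE m s : locmap (mkfrac m s) = mkfrac (f m) s.
Proof. by rewrite /locmap loc_liftE /= [RHS]fracE. Qed.
End LocMap.

(** Localization is left adjoint to restriction of scalars, which preserves surjections. *)
Lemma loc_projective (P : lmodType R) : projective_module P -> projective_module (loc p P).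
Proof.
move=> projP U V f g surj.
have lin (W W' : lmodType Rp) (h : {linear W -> W'}) :
    linear (fun x : restrict W => h x : restrict W').
  by move=> a x y; rewrite !restrictZ linearP.
have [h hh] := projP _ _ (mklin (lin _ _ f)) (mklin (lin _ _ g) \o frac1 P) surj.
exists (loc_lift h); elim/loc_ind => m s.
by rewrite loc_liftE linearZ [f _](hh m) [in RHS]fracE linearZ.
Qed.

Lemma loc_fin_gen (M : lmodType R) : fin_gen M -> fin_gen (loc p M).
Proof.
case=> s hs; exists (map (fun m => mkfrac m (compl1 p)) s).
elim/loc_ind => m t; have [c ->] := hs m.
have sz : size [seq mkfrac m (compl1 p) | m <- s] = size s by rewrite size_map.
exists (fun i => inv_emb t * emb (c (cast_ord sz i))).
rewrite fracE -frac1E linear_sum scaler_sumr (reindex (cast_ord sz)) /=; last first.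
  exact/onW_bij/(Bijective (cast_ordK sz) (cast_ordKV sz)).
apply: eq_bigr => i _; rewrite (nth_map 0) ?(ltn_ord (cast_ord sz i)) // -scalerA.
by congr (_ *: _); exact: (linearZ_LR (frac1 M)).
Qed.

End LocalizedModules.

(** * Localization of complexes, of their homology and of tensor products *)

Section LocalizedComplexes.
Variables (R : comNzRingType) (p : prime_idealr R).
Notation Rp := (loc_ring p).

(* [l] exhibits the complex [X'] over the localization as the localization of [X]. *)
Record localization_map (X : complex R) (X' : complex Rp)
    (l : forall n, {linear X n -> restrict (X' n)}) : Prop := {
  locm_diff : forall n m x, l m (diff X n m x) = diff X' n m (l n x : X' n);
  locm_surj : forall n (x' : X' n), exists (s : compl p) x, emb p (val s) *: x' = l n x;
  locm_ker : forall n x, l n x = 0 -> exists s : compl p, val s *: x = 0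
}.

Lemma unit_boundary (X' : complex Rp) n (s : compl p) (x : X' n) :
  is_boundary (emb p (val s) *: x) -> is_boundary x.
Proof. by move=> /(boundaryZ (inv_emb s)); rewrite scalerA inv_embK scale1r. Qed.

Section LocalizationMap.
Variables (X : complex R) (X' : complex Rp) (l : forall n, {linear X n -> restrict (X' n)}).
Hypothesis hl : localization_map l.

Lemma locm_boundary n (x : X n) : is_boundary x -> is_boundary (l n x : X' n).
Proof. by move=> [j [y <-]]; exists j, (l j y); rewrite (locm_diff hl). Qed.

Lemma locm_cycle n (x : X n) : is_cycle x -> is_cycle (l n x : X' n).
Proof. by move=> cx j; rewrite -(locm_diff hl) cx linear0. Qed.

(** After clearing the denominator [s] the differential of the numerator vanishes only locally, so a
    further factor [u] is needed. *)
Lemma locm_cycle_lift n (x' : X' n) : is_cycle x' ->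
  exists (s : compl p) x, is_cycle x /\ emb p (val s) *: x' = l n x.
Proof.
move=> cx; have [s [x sx]] := locm_surj hl x'.
have [u ux] : exists u : compl p, val u *: diff X n (n - 1) x = 0.
  by apply: (locm_ker hl); rewrite (locm_diff hl) -sx linearZ /= cx scaler0.
exists (compl_mul u s), (val u *: x); split.
  by apply: (is_cycleP (m := n - 1)); [lia|rewrite linearZ].
by rewrite [RHS](linearZ_LR (l n)) restrictZ -sx scalerA -embM.
Qed.

Lemma locm_boundary_lift n (x : X n) : is_boundary (l n x : X' n) ->
  exists u : compl p, is_boundary (val u *: x).
Proof.
move=> [j [y' yx]]; have [s [y sy]] := locm_surj hl y'.
have [u ux] : exists u : compl p, val u *: (val s *: x - diff X j n y) = 0.
  apply: (locm_ker hl); rewrite linearB (linearZ_LR (l n)) (locm_diff hl) -sy restrictZ -yx.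
  by rewrite (linearZ_LR (diff X' j n)); exact: subrr.
exists (compl_mul u s), j, (val u *: y); apply/esym/eqP.
by rewrite linearZ -subr_eq0 -scalerA -scalerBr ux.
Qed.

Lemma locm_no_homology n : ~ nonzero_homology X n -> ~ nonzero_homology X' n.
Proof.
move=> /no_homologyP hX; apply/no_homologyP => x' /locm_cycle_lift[s [x [cx sx]]].
by apply: (unit_boundary (s := s)); rewrite sx; exact/locm_boundary/hX.
Qed.

End LocalizationMap.

(** Exactness of localization in elementary form: cycles and boundaries are lifted up to
    denominators, which are units downstairs. *)
Lemma locm_quasi_iso (X Y : complex R) (X' Y' : complex Rp)
    (l : forall n, {linear X n -> restrict (X' n)})
    (k : forall n, {linear Y n -> restrict (Y' n)})
    (f : chain_map X Y) (f' : chain_map X' Y') :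
  localization_map l -> localization_map k ->
  (forall n x, f' n (l n x) = k n (f n x)) -> quasi_iso f -> quasi_iso f'.
Proof.
move=> hl hk ff' /quasi_isoP qf; apply/quasi_isoP => n; split=> [x' cx' bx'|y' cy'].
  have [s [x [cx sx]]] := locm_cycle_lift hl cx'.
  have : is_boundary (k n (f n x) : Y' n).
    by rewrite -ff' -sx linearZ; exact: boundaryZ.
  move=> /(locm_boundary_lift hk)[u]; rewrite -linearZ => /(qf n).1.
  have cux : is_cycle (val u *: x) by move=> j; rewrite linearZ /= cx scaler0.
  move=> /(_ cux)/(locm_boundary hl); rewrite (linearZ_LR (l n)) restrictZ -sx.
  by move=> /unit_boundary/unit_boundary.
have [s [y [cy sy]]] := locm_cycle_lift hk cy'.
have [x cx bx] := (qf n).2 y cy; exists (inv_emb s *: (l n x : X' n)).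
  by move=> j; rewrite linearZ /= (locm_cycle hl cx) scaler0.
apply: (unit_boundary (s := s)); rewrite linearZ scalerBr sy scalerA embK scale1r ff'.
by have := locm_boundary hk bx; rewrite linearB.
Qed.

Section LocComplex.
Variable X : complex R.

Let locC_shape (n m : int) : n != m + 1 -> forall x, locmap p (diff X n m) x = 0.
Proof.
move=> nm; elim/loc_ind => x s; rewrite locmapE diff_shape //.
by apply/frac_eq0; exists s; rewrite scaler0.
Qed.

Let locCK n m k x : locmap p (diff X m k) (locmap p (diff X n m) x) = 0.
Proof.
by elim/loc_ind: x => x s; rewrite !locmapE diffK; apply/frac_eq0; exists s; rewrite scaler0.
Qed.

Definition locC : complex Rp := @Complex Rp (fun n => loc p (X n) : lmodType Rp)
  (fun n m => locmap p (diff X n m)) locC_shape locCK.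

Definition locC_map n : {linear X n -> restrict (locC n)} := frac1 p (X n).

Lemma locC_mapP : localization_map locC_map.
Proof.
split=> [n m x|n|n x /frac_eq0//]; first by rewrite /locC_map !frac1E; exact/esym/locmapE.
by elim/loc_ind => x s; exists s, x; rewrite fracE scalerA embK scale1r.
Qed.
End LocComplex.

Section LocChain.
Variables (X Y : complex R) (f : chain_map X Y).

Let locC_chain_diff i j x :
  locmap p (f j) (diff (locC X) i j x) = diff (locC Y) i j (locmap p (f i) x).
Proof.
elim/loc_ind: x => x s; rewrite -[diff (locC X) i j _]/(locmap p (diff X i j) _).
by rewrite -[RHS]/(locmap p (diff Y i j) _) !locmapE chain_diff.
Qed.

Definition locC_chain : chain_map (locC X) (locC Y) :=
  @ChainMap _ (locC X) (locC Y) (fun i => locmap p (f i)) locC_chain_diff.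

Lemma locC_quasi_iso : quasi_iso f -> quasi_iso locC_chain.
Proof.
apply: (locm_quasi_iso (locC_mapP X) (locC_mapP Y)) => n x.
by rewrite /locC_map !frac1E; exact: locmapE.
Qed.
End LocChain.

Section LocTensor.
Variables (X Y : complex R) (n : int).
Let T := tensor_obj X Y n.
Let T' := tensor_obj (locC X) (locC Y) n.

Definition tensor_frac (q : int * int) (a : loc p (X q.1)) (b : loc p (Y q.2)) : loc p T :=
  mkfrac (tensor_pure n (repr a).1 (repr b).1) (compl_mul (repr a).2 (repr b).2).

Lemma tensor_fracE q (x : X q.1) s (y : Y q.2) t :
  tensor_frac (mkfrac x s) (mkfrac y t) = mkfrac (tensor_pure n x y) (compl_mul s t).
Proof.
case: q x y => i j x y /=.
rewrite /tensor_frac; have /eqP/mkfracP := mkfrac_repr x s.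
have /eqP/mkfracP := mkfrac_repr y t.
case: (repr (mkfrac y t)) => y' t'; case: (repr (mkfrac x s)) => x' s' /=.
move=> -[v f] [u e]; apply/eqP/mkfracP; exists (compl_mul u v) => /=.
rewrite /tensor_pure.
transitivity (@pure R (int * int)%type (fun q => q.1 + q.2 == n)
  (fun q => X q.1) (fun q => Y q.2) (i, j)
  ((val u * val s) *: x') ((val v * val t) *: y')).
  by rewrite pureZl pureZr scalerA; congr (_ *: _); rewrite /=; ring.
by rewrite /= e f pureZl pureZr scalerA; congr (_ *: _); rewrite /=; ring.
Qed.

Let fDl q a a' b : @tensor_frac q (a + a') b = tensor_frac a b + tensor_frac a' b.
Proof.
case: q a a' b => i j a a' b.
elim/loc_ind: a => x s; elim/loc_ind: a' => x' s'; elim/loc_ind: b => y t.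
rewrite fracD !tensor_fracE fracD; apply: mkfrac_eq.
rewrite /tensor_pure pureDl !pureZl !scalerDr !scalerA.
by congr (_ *: _ + _ *: _); rewrite /=; ring.
Qed.

Let fDr q a b b' : @tensor_frac q a (b + b') = tensor_frac a b + tensor_frac a b'.
Proof.
case: q a b b' => i j a b b'.
elim/loc_ind: a => x s; elim/loc_ind: b => y t; elim/loc_ind: b' => y' t'.
rewrite fracD !tensor_fracE fracD; apply: mkfrac_eq.
rewrite /tensor_pure pureDr !pureZr !scalerDr !scalerA.
by congr (_ *: _ + _ *: _); rewrite /=; ring.
Qed.

Let fZl q c a b : @tensor_frac q (c *: a) b = c *: tensor_frac a b.
Proof.
case: q a b => i j a b.
elim/loc_ind: c => c r; elim/loc_ind: a => x s; elim/loc_ind: b => y t.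
rewrite fracZ !tensor_fracE fracZ; apply: mkfrac_eq.
by rewrite /tensor_pure pureZl !scalerA; congr (_ *: _); rewrite /=; ring.
Qed.

Let fZr q c a b : @tensor_frac q a (c *: b) = c *: tensor_frac a b.
Proof.
case: q a b => i j a b.
elim/loc_ind: c => c r; elim/loc_ind: a => x s; elim/loc_ind: b => y t.
rewrite fracZ !tensor_fracE fracZ; apply: mkfrac_eq.
by rewrite /tensor_pure pureZr !scalerA; congr (_ *: _); rewrite /=; ring.
Qed.

Let foff (q : int * int) (a : loc p (X q.1)) (b : loc p (Y q.2)) :
  ~~ (q.1 + q.2 == n) -> tensor_frac a b = 0.
Proof.
move=> qn; elim/loc_ind: a => x s; elim/loc_ind: b => y t.
rewrite tensor_fracE /tensor_pure pure_off //.
by apply/frac_eq0; exists s; rewrite scaler0.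
Qed.

(** Sends [x/s] tensor [y/t] to [(x tensor y)/(s t)]. It serves to bound the kernel of [loc_tensor]:
    what that map kills is zero in the localization. *)
Definition loc_tensor_inv : {linear T' -> loc p T} := mklin (tens_lift_linear fDl fDr fZl fZr foff).

Let gpure (q : int * int) (x : X q.1) (y : Y q.2) : restrict T' :=
  @tensor_pure _ (locC X) (locC Y) n q.1 q.2 (mkfrac x (compl1 p)) (mkfrac y (compl1 p)).

Let gDl (q : int * int) (x x' : X q.1) (y : Y q.2) : gpure (x + x') y = gpure x y + gpure x' y.
Proof. by rewrite /gpure -frac1E linearD /tensor_pure pureDl. Qed.

Let gDr (q : int * int) (x : X q.1) (y y' : Y q.2) : gpure x (y + y') = gpure x y + gpure x y'.
Proof. by rewrite /gpure -(frac1E _ (y + y')) linearD /tensor_pure pureDr. Qed.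

Let gZl (q : int * int) c (x : X q.1) (y : Y q.2) : gpure (c *: x) y = c *: gpure x y.
Proof. by rewrite /gpure -frac1E (linearZ_LR (frac1 p _)) restrictZ /tensor_pure pureZl. Qed.

Let gZr (q : int * int) c (x : X q.1) (y : Y q.2) : gpure x (c *: y) = c *: gpure x y.
Proof.
rewrite /gpure -(frac1E _ (c *: y)) (linearZ_LR (frac1 p _)) restrictZ.
by rewrite /tensor_pure pureZr.
Qed.

Let goff (q : int * int) (x : X q.1) (y : Y q.2) : ~~ (q.1 + q.2 == n) -> gpure x y = 0.
Proof. by move=> qn; rewrite /gpure /tensor_pure pure_off. Qed.

Definition loc_tensor : {linear T -> restrict T'} := mklin (tens_lift_linear gDl gDr gZl gZr goff).

Lemma loc_tensor_pure i j (x : X i) (y : Y j) : loc_tensor (tensor_pure n x y) =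
  @tensor_pure _ (locC X) (locC Y) n i j (mkfrac x (compl1 p)) (mkfrac y (compl1 p)).
Proof. exact: (tens_lift_pure gDl gDr gZl gZr goff (i := (i, j))). Qed.

Lemma loc_tensor_invP z : loc_tensor_inv (loc_tensor z) = mkfrac z (compl1 p).
Proof.
move: z; elim/tens_pure_ind => [|x y ex ey|[i j] x y].
- by rewrite !linear0; apply/esym/frac_eq0; exists (compl1 p); rewrite scaler0.
- by rewrite linearD linearD ex ey -!frac1E linearD.
rewrite [loc_tensor _](loc_tensor_pure x y).
rewrite [LHS](tens_lift_pure fDl fDr fZl fZr foff (i := (i, j))) tensor_fracE.
by apply: mkfrac_eq; rewrite /= mulr1.
Qed.

Lemma loc_tensor_surj (z' : T') : exists (s : compl p) z, emb p (val s) *: z' = loc_tensor z.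
Proof.
move: z'; elim/tens_pure_ind => [|x' y' [s [x ex]] [t [y ey]]|[i j]].
- by exists (compl1 p), 0; rewrite scaler0 linear0.
- exists (compl_mul s t), (val t *: x + val s *: y).
  rewrite (linearD loc_tensor) !(linearZ_LR loc_tensor) !restrictZ -ex -ey !scalerA -!embM.
  by rewrite [val t * _]mulrC -scalerDr.
elim/loc_ind => x s; elim/loc_ind => y t; exists (compl_mul s t), (tensor_pure n x y).
rewrite loc_tensor_pure /tensor_pure [mkfrac x s]fracE [mkfrac y t]fracE pureZl pureZr.
rewrite !scalerA (_ : _ * _ = 1) ?scale1r // embM.
rewrite -[RHS]mulr1 -{1}(embK s) -(embK t) /=; ring.
Qed.
End LocTensor.

Lemma loc_tensorP (X Y : complex R) : @localization_map (tensor X Y)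
  (tensor (locC X) (locC Y)) (loc_tensor X Y).
Proof.
split=> [n m|n|n z z0]; last first.
- by apply/(frac_eq0 z (compl1 p)); rewrite -loc_tensor_invP z0 linear0.
- exact: loc_tensor_surj.
elim/tens_pure_ind => [|x y ex ey|[i j] x y]; first by rewrite !linear0.
  by rewrite !linearD ex ey.
rewrite [diff (tensor X Y) n m _](tensor_diffE n m x y).
rewrite [loc_tensor X Y n _](loc_tensor_pure n x y).
rewrite [RHS](@tensor_diffE _ (locC X) (locC Y)) /tensor_diff_pure.
case: eqP => _; last exact: (linear0 (loc_tensor X Y m)).
rewrite (linearD (loc_tensor X Y m)) (linearZ_LR (loc_tensor X Y m)) !loc_tensor_pure restrictZ.
have locdE (Z : complex R) k h (z : Z k) :
    diff (locC Z) k h (mkfrac z (compl1 p)) = mkfrac (diff Z k h z) (compl1 p).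
  exact: locmapE.
rewrite !locdE (_ : emb p ((-1) ^+ `|i|%N) = (-1) ^+ `|i|%N) //.
(* The sign of the tensor differential is preserved by [emb]. *)
elim: (`|i|%N) => [|k IH]; first by rewrite !expr0 emb1.
rewrite !exprS embM IH; congr (_ * _).
apply/eqP; rewrite -subr_eq0 opprK -(emb1 p) -embD addNr.
by apply/eqP/frac_eq0; exists (compl1 p); rewrite scaler0.
Qed.
End LocalizedComplexes.

(** * Associated primes and projective resolutions *)

Section ExtendedIntegers.
Local Open Scope classical_set_scope.
Local Open Scope ereal_scope.

(** A set bounded above by an integer and containing an integer has a largest element; otherwise the
    supremum is infinite. *)
Lemma ereal_int_supremum (A : set (\bar int)) : supremums A !=set0.
Proof.
have [[b hb]|nob] := pselect (exists b : int, ubound A b%:E); last first.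
  exists +oo; split=> [x _|[u||] hu //]; first exact: leey.
    by case: nob; exists u.
  by case: nob; exists 0%R => x /hu; rewrite leeNy_eq => /eqP ->; exact: leNye.
have [[a0 Aa0]|noa] := pselect (exists a : int, A a%:E); last first.
  exists -oo; split=> [[a||]|x _] //; [|by move=> /hb|exact: leNye].
  by move=> Aa; case: noa; exists a.
pose dom n := `[< A (a0 + n%:Z)%R%:E >].
have dom0 : exists n, dom n by exists 0%N; apply/asboolP; rewrite addr0.
have dom_le n : dom n -> (n <= `|b - a0|)%N.
  by move=> /asboolP/hb; rewrite lee_fin; lia.
have [n /asboolP An nmax] := ex_maxnP dom0 dom_le.
exists (a0 + n%:Z)%R%:E; split=> [[a||] Ax|u]; last exact.
- rewrite lee_fin; have [|aa] := boolP (a <= a0)%R; first by lia.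
  suff : (`|a - a0| <= n)%N by lia.
  by apply: nmax; apply/asboolP; rewrite (_ : (a0 + _)%R = a) //; lia.
- by have := hb _ Ax.
- exact: leNye.
Qed.

Lemma ereal_int_infimum (A : set (\bar int)) : infimums A !=set0.
Proof.
have [y [ly uy]] := ereal_int_supremum [set - x | x in A].
exists (- y); split=> [x Ax|u hu].
  by rewrite leeNl; apply: ly; exists x.
by rewrite leeNr; apply: uy => _ [x Ax <-]; rewrite leeN2; exact: hu.
Qed.

Lemma esup_ub (A : set (\bar int)) x : A x -> x <= esup A.
Proof. by move=> Ax; apply: ge_supremum_Nmem => //; exact: ereal_int_supremum. Qed.

Lemma esup_le (A : set (\bar int)) b : (forall x, A x -> x <= b) -> esup A <= b.
Proof.
move=> hb; rewrite /esup /supremum; case: ifPn => [_|_]; first exact: leNye.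
have [y Ay] := ereal_int_supremum A.
by case: xgetP => [z _ [_ hz]|/(_ y)//]; exact: hz.
Qed.

Lemma einf_lb (A : set (\bar int)) x : A x -> einf A <= x.
Proof. by move=> Ax; apply: le_infimum_Nmem => //; exact: ereal_int_infimum. Qed.

Lemma einf_ge (A : set (\bar int)) b : (forall x, A x -> b <= x) -> b <= einf A.
Proof.
move=> hb; rewrite /einf /infimum; case: ifPn => [_|_]; first exact: leey.
have [y Ay] := ereal_int_infimum A.
by case: xgetP => [z _ [_ hz]|/(_ y)//]; exact: hz.
Qed.

End ExtendedIntegers.

(** * Existence of associated primes *)

Section AssociatedPrime.
Variable R : comNzRingType.
Hypothesis noethR : noetherian R.

Lemma noetherian_ideal (I : {pred R^o}) : submod_closed I -> exists s : seq R,
  {subset s <= (I : {pred R})} /\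
  forall a, a \in I -> exists c : 'I_(size s) -> R, a = \sum_(i < size s) c i * s`_i.
Proof.
move=> hI; pose W : submodClosed R^o := HB.pack_for (submodClosed R^o) I
  (GRing.isSubmodClosed.Build R R^o I (GRing.submod_closed_semi hI)).
have [s hs] := noethR W; exists (map val s); split=> [_ /mapP[x _ ->]|a Ia].
  exact: (valP x).
have lin : linear (fun x : submod W => val x : R^o) by move=> b x y; rewrite linearP.
have [c /(congr1 (mklin lin)) e] := hs (exist _ a Ia).
have sz : size (map val s) = size s by rewrite size_map.
exists (c \o cast_ord sz); rewrite linear_sum /= in e.
rewrite e (reindex (cast_ord sz)) /=; last first.
  exact/onW_bij/(Bijective (cast_ordK sz) (cast_ordKV sz)).
by apply: eq_bigr => i _; rewrite (nth_map 0) ?(ltn_ord (cast_ord sz i)).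
Qed.

(** An annihilator that is maximal among those of nonzero elements is prime. Zorn's lemma is applied
    to the nonzero elements, preordered by inclusion of annihilators. *)
Lemma associated_prime (H : lmodType R) (h0 : H) : h0 <> 0 ->
  exists (p : prime_idealr R) (z : H), forall a, a \in p = (a *: z == 0).
Proof.
move=> h00; pose T := {h : H | h <> 0}.
pose le (x y : T) := `[< forall a, a *: sval x = 0 -> a *: sval y = 0 >].
have [//|x y z|C totC|[z z0] zmax] := @ZL_preorder T (exist _ h0 h00) le.
- by move=> t; exact/asboolP.
- by move=> /asboolP xy /asboolP yz; apply/asboolP => a /xy/yz.
- have [[c0 Cc0]|noC] := pselect (exists c, C c); last first.
    by exists (exist _ h0 h00) => c Cc; case: noC; exists c.
  (* The union of the annihilators along the chain is an ideal; its finitely many generators kill a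
     common member of the chain, which is then an upper bound. *)
  pose U : {pred R^o} := fun a => `[< exists2 c, C c & a *: sval c = 0 >].
  have hU : submod_closed U.
    split=> [|a x y]; first by apply/asboolP; exists c0; rewrite // scale0r.
    move=> /asboolP[c Cc xc] /asboolP[d Cd yd]; apply/asboolP.
    have [/asboolP cd|/asboolP dc] := totC _ _ Cc Cd.
      by exists d => //; rewrite scalerDl -[a *: x]/(a * x) -scalerA cd // scaler0 add0r.
    by exists c => //; rewrite scalerDl -[a *: x]/(a * x) -scalerA xc dc // scaler0 add0r.
  have [s [sU hs]] := noetherian_ideal hU.
  have [c Cc sc] : exists2 c, C c & forall a, a \in s -> a *: sval c = 0.
    elim: s sU {hs} => [|a s IH] sU; first by exists c0.
    have [|c Cc hc] := IH; first by move=> b bs; apply: sU; rewrite inE bs orbT.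
    have /asboolP[d Cd ad] := sU a (mem_head _ _).
    have [/asboolP cd|/asboolP dc] := totC _ _ Cc Cd.
      by exists d => // b; rewrite inE => /predU1P[->//|/hc/cd].
    by exists c => // b; rewrite inE => /predU1P[->|/hc//]; exact: dc.
  exists c => d Cd; apply/asboolP => a ad.
  have [|k ->] := hs a; first by apply/asboolP; exists d.
  rewrite scaler_suml big1 // => i _; rewrite -scalerA sc ?scaler0 //.
  by rewrite mem_nth.
pose P : {pred R} := fun a => a *: z == 0.
have PE a : (a \in P) = (a *: z == 0) by [].
have hP : idealr_closed P.
  split; rewrite ?PE ?scale0r ?scale1r ?eqxx //; first by apply/negP => /eqP.
  by move=> a x y; rewrite !PE scalerDl -scalerA => /eqP -> /eqP ->; rewrite scaler0 addr0.
have primeP : prime_idealr_closed P.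
  move=> a b; rewrite !PE => /eqP abz; have [//|bz] := eqVneq (b *: z) 0; first by rewrite orbT.
  have bz0 : b *: z <> 0 by exact/eqP.
  (* The annihilator of [b *: z] contains that of [z], so by maximality they are equal; it contains
     [a]. *)
  have /asboolP /= h : le (exist _ (b *: z) bz0) (exist _ z z0).
    by apply: zmax; apply/asboolP => c /= cz; rewrite scalerA mulrC -scalerA cz scaler0.
  by rewrite h ?eqxx // scalerA.
exists (HB.pack_for (prime_idealr R) P (isIdealr.Build R P hP)
  (isPrimeIdealrClosed.Build R P primeP)), z => a; exact: PE.
Qed.

End AssociatedPrime.

(** * Free modules and projective resolutions *)

Section ProjectiveResolution.
Variable R : comNzRingType.

(* The free module on [K], as a direct sum of copies of [R \otimes R]. *)
Definition free_module (K : Type) : lmodType R :=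
  @tens R K (fun _ => true) (fun _ => R^o) (fun _ => R^o).

Lemma free_module_lift (K : Type) (W : lmodType R) (w : K -> W) :
  exists f : {linear free_module K -> W},
    forall (k : K) (a b : R),
      f (@pure R K (fun _ => true) (fun _ => R^o) (fun _ => R^o) k a b) = (a * b) *: w k.
Proof.
pose f k (a b : R^o) := ((a : R) * b) *: w k.
have fDl k a a' b : f k (a + a') b = f k a b + f k a' b by rewrite /f mulrDl scalerDl.
have fDr k a b b' : f k a (b + b') = f k a b + f k a b' by rewrite /f mulrDr scalerDl.
have fZl k c a b : f k (c *: a) b = c *: f k a b by rewrite /f scalerA mulrA.
have fZr k c a b : f k a (c *: b) = c *: f k a b by rewrite /f scalerA mulrCA.
have foff k a b : ~~ true -> f k a b = 0 by [].
exists (mklin (tens_lift_linear fDl fDr fZl fZr foff)) => k a b.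
exact: (tens_lift_pure fDl fDr fZl fZr foff).
Qed.

Lemma free_projective (K : Type) : projective_module (free_module K).
Proof.
move=> U V f g surj.
have [u hu] := choice (fun k => surj
  (g (@pure R K (fun _ => true) (fun _ => R^o) (fun _ => R^o) k (1 : R) (1 : R)))).
have [h hh] := free_module_lift u; exists h.
elim/tens_pure_ind => [|x y ex ey|k a b]; first by rewrite !linear0.
  by rewrite !linearD ex ey.
rewrite hh linearZ hu -linearZ; congr (g _).
by rewrite -pureZr -[_ *: 1]/(_ * 1) mulr1 -{2}[a]mulr1 -[a * 1]/(a *: (1 : R^o)) pureZl -pureZr.
Qed.

(** The free module on all elements of the kernel maps onto it. *)
Lemma kernel_cover (U V : lmodType R) (g : {linear U -> V}) :
  exists (F : lmodType R) (f : {linear F -> U}), projective_module F /\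
    forall u, g u = 0 <-> exists x, f x = u.
Proof.
have [f hf] := free_module_lift (fun u : {u | g u = 0} => sval u).
exists (free_module {u | g u = 0}), f; split=> [|u]; first exact: free_projective.
split=> [gu|[x <-]]; last first.
  elim/tens_pure_ind: x => [|x y ex ey|k a b]; first by rewrite !linear0.
    by rewrite !linearD ex ey addr0.
  by rewrite hf linearZ /= (svalP k) scaler0.
exists (@pure R _ (fun _ => true) (fun _ => R^o) (fun _ => R^o) (exist _ u gu) (1 : R) (1 : R)).
by rewrite hf mulr1 scale1r.
Qed.

Record pstage := PStage {
  pstage_tgt : lmodType R;
  pstage_src : lmodType R;
  pstage_map : {linear pstage_src -> pstage_tgt}
}.

Section Construction.
Variable M : lmodType R.

Definition pstage_cover (st : pstage) := cid (kernel_cover (pstage_map st)).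
Definition pstage_cover_map (st : pstage) := cid (svalP (pstage_cover st)).
Definition next_pstage (st : pstage) : pstage :=
  @PStage (pstage_src st) (sval (pstage_cover st)) (sval (pstage_cover_map st)).
(** Starts with the zero map on [M], whose kernel is [M]: stage 1 is the augmentation and stage
    [k + 2] the differential into degree [k]. *)
Definition pstages := nat_rect (fun _ => pstage) (@PStage 'rV[R]_0 M \0) (fun _ => next_pstage).
Definition pres_obj k : lmodType R := pstage_src (pstages k.+1).
Definition pres_map k : {linear pres_obj k.+1 -> pres_obj k} := pstage_map (pstages k.+2).
Definition pres_aug : {linear pres_obj 0 -> M} := pstage_map (pstages 1).

Lemma pres_obj_projective k : projective_module (pres_obj k).
Proof. exact: (proj1 (svalP (pstage_cover_map (pstages k)))). Qed.

Lemma pres_map_exact k u : pres_map k u = 0 <-> exists x, pres_map k.+1 x = u.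
Proof. exact: (proj2 (svalP (pstage_cover_map (pstages k.+2)))). Qed.

Lemma pres_aug_exact u : pres_aug u = 0 <-> exists x, pres_map 0 x = u.
Proof. exact: (proj2 (svalP (pstage_cover_map (pstages 1)))). Qed.

Lemma pres_aug_surj u : exists x, pres_aug x = u.
Proof. exact/(proj2 (svalP (pstage_cover_map (pstages 0)))). Qed.

Lemma pres_mapK k x : pres_map k (pres_map k.+1 x) = 0.
Proof. by apply/pres_map_exact; exists x. Qed.

Definition pres_int_obj (a : int) : lmodType R := if a is Posz k then pres_obj k else 'rV[R]_0.

Definition pres_diff (a b : int) : {linear pres_int_obj a -> pres_int_obj b} :=
  match a, b with
  | Posz k, Posz l => pres_map l \o cast pres_obj k l.+1
  | _, _ => \0
  end.

Lemma pres_diff_shape (a b : int) : a != b + 1 -> forall x, pres_diff a b x = 0.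
Proof. by case: a b => [k|k] [l|l] //= kl x; rewrite cast_neq ?linear0 //; lia. Qed.

Lemma pres_diffK a b c x : pres_diff b c (pres_diff a b x) = 0.
Proof.
case: a b c x => [k|k] [l|l] [m|m] x //=; rewrite ?linear0 //.
have [lm|/eqP lm] := eqVneq l m.+1; last by rewrite (cast_neq _ lm) linear0.
by subst l; rewrite cast_id pres_mapK.
Qed.

Definition pres_complex : complex R :=
  @Complex R pres_int_obj pres_diff pres_diff_shape pres_diffK.

Definition pres_chain n : {linear pres_int_obj n -> stalk_obj M n} :=
  match n return {linear pres_int_obj n -> stalk_obj M n} with Posz 0 => pres_aug | _ => \0 end.

Lemma pres_chain_diff i j x :
  pres_chain j (diff pres_complex i j x) = diff (stalk M) i j (pres_chain i x).
Proof.
case: i j x => [k|k] [[|l]|l] x //=; rewrite ?linear0 //.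
by apply/pres_aug_exact; eexists.
Qed.

Theorem projective_resolution_exists : exists P, projective_resolution M P.
Proof.
exists pres_complex; split=> [[//|k] _ x|[k|k]|]; first exact: thinmx0.
- exact: pres_obj_projective.
- by move=> U V f g _; exists \0 => x; rewrite linear0 (thinmx0 x) linear0.
exists (@ChainMap _ pres_complex (stalk M) pres_chain pres_chain_diff).
apply/quasi_isoP => -[[|k]|k].
- split=> [x _ [j [y ex]]|y _].
    by have /pres_aug_exact[z <-] := esym ex; exists 1, z; rewrite /= cast_id.
  have [x <-] := pres_aug_surj y; exists x; last first.
    by rewrite (subrr (pres_aug x : stalk M 0)); exact: boundary0.
  by move=> [l|l] //=; rewrite cast_neq ?linear0.
- split=> [x cx _|y _].
    have := cx (Posz k); rewrite /= cast_id => /pres_map_exact[z <-].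
    by exists (Posz k.+2), z; rewrite /= cast_id.
  exists 0; first by move=> j; rewrite linear0.
  by rewrite (_ : _ - _ = 0); [exact: boundary0|exact: thinmx0].
- split=> [x _ _|y _]; first by rewrite (thinmx0 x); exact: boundary0.
  exists 0; first by move=> j; rewrite linear0.
  by rewrite (_ : _ - _ = 0); [exact: boundary0|exact: thinmx0].
Qed.

End Construction.
End ProjectiveResolution.

(** * Depth and Tor *)

Lemma iso_quasi_iso (R : pzRingType) (X Y : complex R) (f : chain_map X Y) (g : chain_map Y X) :
  (forall n x, g n (f n x) = x) -> (forall n y, f n (g n y) = y) -> quasi_iso f.
Proof.
move=> gf fg; apply/quasi_isoP => n; split=> [x _ /(chain_boundary g)|y cy]; first by rewrite gf.
by exists (g n y); [exact: chain_cycle|rewrite fg subrr; exact: boundary0].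
Qed.

Section StalkLocalization.
Variables (R : comNzRingType) (p : prime_idealr R) (M : lmodType R).
Notation Rp := (loc_ring p).

Lemma loc_eq0 (V : lmodType R) : (forall v : V, v = 0) -> forall x : loc p V, x = 0.
Proof. by move=> V0; elim/loc_ind => v s; apply/frac_eq0; exists s; rewrite (V0 v) scaler0. Qed.

(** The test [n == 0] is replaced by a boolean so that maps can be defined by cases; the localized
    zero module and the zero module over [Rp] are isomorphic but distinct. *)
Let src b : lmodType R := if b then M else 'rV[R]_0.
Let tgt b : lmodType Rp := if b then (loc p M : lmodType Rp) else 'rV[Rp]_0.

Let fwd b : {linear loc p (src b) -> tgt b} :=
  if b as b return {linear loc p (src b) -> tgt b} then idfun else \0.

Let bwd b : {linear tgt b -> loc p (src b)} :=
  if b as b return {linear tgt b -> loc p (src b)} then idfun else \0.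

Let diff0 i j x : diff (locC p (stalk M)) i j x = 0.
Proof.
elim/loc_ind: x => x s; rewrite [LHS](locmapE (diff (stalk M) i j) x s).
by apply/frac_eq0; exists s; rewrite scaler0.
Qed.

Let fwd_diff i j x : fwd (j == 0) (diff (locC p (stalk M)) i j x) =
  diff (stalk (loc p M)) i j (fwd (i == 0) x).
Proof. by rewrite diff0 linear0. Qed.

Let bwd_diff i j x : bwd (j == 0) (diff (stalk (loc p M)) i j x) =
  diff (locC p (stalk M)) i j (bwd (i == 0) x).
Proof. by rewrite diff0 linear0. Qed.

Definition locC_stalk : chain_map (locC p (stalk M)) (stalk (loc p M)) :=
  @ChainMap _ (locC p (stalk M)) (stalk (loc p M)) (fun n => fwd (n == 0)) fwd_diff.
Definition stalk_locC : chain_map (stalk (loc p M)) (locC p (stalk M)) :=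
  @ChainMap _ (stalk (loc p M)) (locC p (stalk M)) (fun n => bwd (n == 0)) bwd_diff.

Lemma locC_stalkK n x : stalk_locC n (locC_stalk n x) = x.
Proof.
move: x; rewrite /= /stalk_obj; case: (n == 0) => x //=.
by apply/esym/loc_eq0 => v; exact: thinmx0.
Qed.

Lemma stalk_locCK n x : locC_stalk n (stalk_locC n x) = x.
Proof.
move: x; rewrite /= /stalk_obj; case: (n == 0) => x //=.
exact/esym/thinmx0.
Qed.

Lemma locC_stalk_quasi_iso : quasi_iso locC_stalk.
Proof. exact: iso_quasi_iso locC_stalkK stalk_locCK. Qed.

Lemma stalk_locC_quasi_iso : quasi_iso stalk_locC.
Proof. exact: iso_quasi_iso stalk_locCK locC_stalkK. Qed.

End StalkLocalization.

Lemma stalk_eq0 (R : pzRingType) (M : lmodType R) n (x : stalk M n) : n <> 0 -> x = 0.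
Proof.
by move: x; rewrite /= /stalk_obj; case: eqP => // _ x _; exact: thinmx0.
Qed.

Lemma obj_eq0_no_homology (R : pzRingType) (X : complex R) n :
  (forall x : X n, x = 0) -> ~ nonzero_homology X n.
Proof. by move=> X0; apply/no_homologyP => x _; rewrite (X0 x); exact: boundary0. Qed.

Section Depth.
Variable S : localRingType.
Implicit Types X Y : complex S.
Local Open Scope ereal_scope.

(** A resolution of [Y] composed with [f] is one of [X]. The reverse inequality is obtained from a
    quasi-isomorphism in the other direction. *)
Lemma depth_le_quasi_iso X Y (f : chain_map X Y) : quasi_iso f -> depth X <= depth Y.
Proof.
move=> qf; apply: einf_ge => _ [i [I [[KI injI [g qg]] hI]] <-]; apply: einf_lb.
exists i => //; exists I; split=> //; split=> //.
by exists (comp_chain g f); exact: comp_quasi_iso.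
Qed.

(** Every resolution inherits the bound on homology, and [hom_no_homology] applies to each of
    them. *)
Lemma depth_ge X s : (forall n, (s < n)%R -> ~ nonzero_homology X n) -> (- s)%R%:E <= depth X.
Proof.
move=> Xs; apply: einf_ge => _ [i [I [[KI injI [g qg]] hI]] <-]; rewrite lee_fin.
have [//|si] := boolP (- s <= i)%R; have {}si : (s < - i)%R by lia.
have Is n : (s < n)%R -> ~ nonzero_homology I n.
  by move=> /Xs; exact: quasi_iso_no_homology.
by case: (hom_no_homology KI Is si hI).
Qed.

Lemma depth_acyclic X : acyclic X -> depth X = +oo.
Proof.
move=> aX; apply/eqP; rewrite -leye_eq; apply: einf_ge => _ [i hi <-].
have : (i + 1)%R%:E <= depth X by rewrite -[(i + 1)%R]opprK; apply: depth_ge => n _; exact: aX.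
have : depth X <= i%:E by apply: einf_lb; exists i.
by move=> h1 h2; have := le_trans h2 h1; rewrite lee_fin; lia.
Qed.

(** The bounded resolution constructed above is one competitor in the infimum; the image of [z]
    gives the class of maps from the residue field. *)
Lemma depth_le X (s : int) (z : X s) : (forall n, (s < n)%R -> ~ nonzero_homology X n) ->
  is_cycle z -> ~ is_boundary z ->
  (forall a, a \in @maxid S -> is_boundary (a *: z)%R) -> depth X <= (- s)%R%:E.
Proof.
move=> Xs cz bz mz; have [I [f [injI I0 qf]]] := injective_resolution_exists Xs.
have KI := K_injective_bounded injI I0.
apply: einf_lb; exists (- s)%R => //; exists I; split; first by split=> //; exists f.
rewrite opprK; apply: (residue_top_homology (z := f s z)) => //.
- by move=> n /I0 In0; exact: obj_eq0_no_homology.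
- exact: chain_cycle.
- by move=> bfz; apply: bz; exact: ((quasi_isoP f).1 qf s).1 cz bfz.
- by move=> a ma; rewrite -linearZ; exact/chain_boundary/mz.
Qed.

Lemma module_depth_ge0 (M : lmodType S) : 0 <= module_depth M.
Proof.
have := @depth_ge (stalk M) 0%R; rewrite oppr0; apply => n n0; apply: obj_eq0_no_homology => x.
by apply: stalk_eq0 => n0'; rewrite n0' ltxx in n0.
Qed.

End Depth.

Lemma module_depth_loc (R : comNzRingType) (p : prime_idealr R) (M : lmodType R) :
  depth (locC p (stalk M)) = module_depth (loc p M).
Proof.
apply/eqP; rewrite eq_le (depth_le_quasi_iso (locC_stalk_quasi_iso p M)).
exact: (depth_le_quasi_iso (stalk_locC_quasi_iso p M)).
Qed.

Lemma module_depth_notin_supp (R : comNzRingType) (p : prime_idealr R) (M : lmodType R) :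
  ~ in_supp M p -> module_depth (loc p M) = +oo%E.
Proof.
move=> nM; apply: depth_acyclic => n; apply: obj_eq0_no_homology => x.
have [n0|n0] := eqVneq n 0; last by apply: stalk_eq0; exact/eqP.
by subst n; apply: contrapT => x0; apply: nM; exists x.
Qed.

(** Generators of [p] generate the maximal ideal of the local ring at [p], so finitely many cones
    suffice. *)
Lemma ring_depth_loc_fin (R : comNzRingType) (p : prime_idealr R) :
  noetherian R -> (ring_depth (loc_ring p) < +oo)%E.
Proof.
move=> noethR.
have closed : submod_closed (fun x : R^o => x \in p).
  by split=> [|a x y xp yp]; rewrite unfold_in ?rpred0 // rpredD // idealMr.
have [s [sp hs]] := noetherian_ideal noethR closed.
have [||I [n [rI hn]]] := @ring_ext_nonzero (loc_ring p) (map (emb p) s).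
- move=> _ /mapP[g /sp gp ->]; rewrite -[_ \in _]/((emb p g : loc_ring p) \in @loc_maxid _ p).
  by rewrite loc_maxidE.
- move=> K K0 KD Kg; elim/loc_ind => a t.
  rewrite -[_ \in _]/((mkfrac (a : R^o) t : loc_ring p) \in @loc_maxid _ p) loc_maxidE.
  move=> /hs[c ->]; rewrite fracE -[X in _ *: X]/(emb p _).
  rewrite -[X in K X]addr0 -[_ *: _]/(inv_emb t * _); apply: (KD) => //.
  elim/big_rec: _ => [|i x _ Kx]; last first.
    by rewrite embD embM; apply: KD => //; apply/Kg/map_f/mem_nth.
  by rewrite (_ : emb p 0 = 0) //; apply/frac_eq0; exists t; rewrite scaler0.
apply: (@le_lt_trans _ _ (- n)%:E); last exact: ltry.
by apply: einf_lb; exists (- n) => //; exists I; rewrite opprK.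
Qed.

(** * Localizing the complex that computes Tor *)

Section TorLocalization.
Variables (R : comNzRingType) (M N : lmodType R) (P : complex R).
Hypothesis rP : projective_resolution M P.
Let T := tensor P (stalk N).

Lemma tensor_stalk_eq0 n (x : T n) : n < 0 -> x = 0.
Proof.
case: rP => P0 _ _ n0; elim/tens_pure_ind: x => [//|x y -> ->|[i j] x y]; first by rewrite addr0.
have [ij|ij] := boolP (i + j == n); last exact: pure_off.
have [j0|/eqP j0] := eqVneq j 0; last by rewrite (stalk_eq0 y j0) pure0r.
by rewrite (P0 i _ x) ?pure0l //; move: ij; rewrite j0 addr0 => /eqP ->.
Qed.

(** Nonzero homology for this [P] already witnesses [tor_nonzero]; in negative degrees the complex
    is zero. *)
Lemma no_tor_homology (q : int) :
  (forall i : nat, tor_nonzero M N i -> i%:Z <= q) ->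
  forall n, q < n -> ~ nonzero_homology T n.
Proof.
move=> hq [n|n] qn; last first.
  by apply: obj_eq0_no_homology => x; exact: tensor_stalk_eq0.
by move=> hn; have := hq n (ex_intro _ P (conj rP hn)); lia.
Qed.

Variable p : prime_idealr R.
Let T' := tensor (locC p P) (locC p (stalk N)).

Lemma loc_tensor_no_homology n : ~ nonzero_homology T n -> ~ nonzero_homology T' n.
Proof. exact: (locm_no_homology (loc_tensorP p P (stalk N)) (n := n)). Qed.

Lemma loc_tensor_bounded (q : int) :
  (forall n, q < n -> ~ nonzero_homology T n) -> bounded_homology T'.
Proof.
move=> hq; exists (`|q|%N : int) => n qn; apply: loc_tensor_no_homology.
have [n0|n0] := boolP (n < 0); first by apply: obj_eq0_no_homology => x; exact: tensor_stalk_eq0.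
by apply: hq; lia.
Qed.

Lemma loc_semiprojective : semiprojective_resolution (locC p (stalk M)) (locC p P).
Proof.
case: rP => P0 projP [f qf].
have proj' n : projective_module (locC p P n) by exact: loc_projective.
split=> //; last by exists (locC_chain p f); exact: locC_quasi_iso.
by apply: (K_projective_bounded (s := 0)) => // n n0; apply: loc_eq0; exact: P0.
Qed.

Lemma loc_stalk_fg (V : lmodType R) : fin_gen V -> fg_complex (locC p (stalk V)).
Proof.
move=> fV n; apply: loc_fin_gen; rewrite /= /stalk_obj; case: eqP => // _.
by exists [::] => x; exists (fun _ => 0); rewrite big_ord0; exact: thinmx0.
Qed.

Lemma loc_stalk_bounded (V : lmodType R) : bounded_homology (locC p (stalk V)).
Proof.
exists 0 => n n0; apply: obj_eq0_no_homology; apply: loc_eq0 => x; apply: stalk_eq0; lia.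
Qed.

(** The image of [w] is killed by the maximal ideal up to boundaries. If it were a boundary itself,
    some [u] outside [p] would make [u *: w] one, so [u] would annihilate [z]. *)
Lemma loc_tensor_depth_le (q : int) (z : homology T q) :
  (forall n, q < n -> ~ nonzero_homology T n) ->
  (forall a, (a \in p) = (a *: z == 0)) -> (depth T' <= (- q)%:E)%E.
Proof.
move=> Tq; elim/quotmod_ind: z => z pz; pose w : T q := val z.
have {}pz a : a \in p <-> is_boundary (a *: w).
  rewrite pz -(linearZ_LR (mklin (@quotmod_pi_linear _ _ (boundaries T q)))) /=.
  by split=> [/eqP/quotmod_pi0/boundariesP|bw]; last (apply/eqP/quotmod_pi0/boundariesP).
have hl := loc_tensorP p P (stalk N).
have cw : is_cycle w by apply/cyclesP/(valP z).
apply: (@depth_le _ T' q (loc_tensor p P (stalk N) q w)).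
- by move=> n /Tq; exact: loc_tensor_no_homology.
- exact: locm_cycle hl _ _ cw.
- move=> /(locm_boundary_lift hl)[u /pz]; apply/negP; exact: (valP u).
- elim/loc_ind => a s.
  rewrite -[_ \in _]/((mkfrac (a : R^o) s : loc_ring p) \in @loc_maxid _ p) loc_maxidE.
  move=> /pz/(locm_boundary hl) b; rewrite fracE -[_ *: mkfrac _ _]/(inv_emb s * emb p a).
  by rewrite -scalerA; apply: boundaryZ; move: b; rewrite (linearZ_LR (loc_tensor p P (stalk N) q)).
Qed.

End TorLocalization.

(* For [p] associated to the top homology [H_q], the maximal ideal of the local ring
   at [p] annihilates a nonzero element of the localized [H_q]. *)
Lemma top_tor_depth_le (R : comNzRingType) (noethR : noetherian R) (N : lmodType R)
    (P : complex R) (q : int) :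
  (forall n, q < n -> ~ nonzero_homology (tensor P (stalk N)) n) ->
  nonzero_homology (tensor P (stalk N)) q ->
  exists p : prime_idealr R,
    (depth (tensor (locC p P) (locC p (stalk N))) <= (- q)%:E)%E.
Proof.
move=> Tq [h h0]; have [p [z pz]] := associated_prime noethR h0.
by exists p; exact: loc_tensor_depth_le Tq pz.
Qed.

(** The right side [t + r] is below +oo, which forces the nonnegative [a] and [b] to be finite; the
    rest is integer arithmetic. *)
Lemma ldep_arith (q : int) (a b t r : \bar int) :
  (0 <= a -> 0 <= b -> r < +oo -> t <= (- q)%:E -> a + b <= t + r ->
   [/\ a <> +oo, b <> +oo & q%:E <= r - a - b])%E.
Proof.
case: a b t r => [a||] [b||] [t||] [r||] //=; rewrite ?lee_fin ?lte_fin // => a0 b0 _ tq.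
by move=> h; split=> //; lia.
Qed.

(** If [a] or [b] is +oo the difference is -oo, by the convention that +oo - +oo is -oo. If [r] is
    +oo, so is [t + r], hence [a] or [b]. *)
Lemma rdep_arith (q : int) (a b t r : \bar int) :
  (0 <= a -> 0 <= b -> (- q)%:E <= t -> t + r <= a + b -> r - a - b <= q%:E)%E.
Proof.
case: a b t r => [a||] [b||] [t||] [r||] //=; rewrite ?lee_fin // => a0 b0 tq h.
all: by [lia|exact: leNye].
Qed.

Theorem theorem1p3 (R : localRingType) (hR : noetherian R) (M N : lmodType R)
    (hM : fin_gen M) (hN : fin_gen N) (hq : (q_tor M N < +oo)%E) :
  ((forall p : prime_idealr R, derived_ldep (loc_ring p)) ->
     (q_tor M N <= sup_depth_defect M N)%E) /\
  ((forall p : prime_idealr R, derived_rdep (loc_ring p)) ->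
     (sup_depth_defect M N <= q_tor M N)%E).
Proof.
have torle (i : nat) : tor_nonzero M N i -> ((i%:Z)%:E <= q_tor M N)%E.
  by move=> hi; apply: esup_ub; exists i.
split=> [ldep|rdep].
- apply: esup_le => _ [i0 hi0 <-].
  pose nz n := `[< tor_nonzero M N n >].
  have [qb hqb] : exists b : int, forall i : nat, tor_nonzero M N i -> i%:Z <= b.
    case: (q_tor M N) hq torle => [b||] // _ hb; first by exists b => i /hb; rewrite lee_fin.
    by have := hb _ hi0.
  have nz0 : exists n, nz n by exists i0; exact/asboolP.
  have nz_le n : nz n -> (n <= `|qb|)%N by move=> /asboolP/hqb; lia.
  have [q /asboolP hTq qmax] := ex_maxnP nz0 nz_le.
  have le_q (i : nat) : tor_nonzero M N i -> i%:Z <= q%:Z.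
    by move=> hi; rewrite lez_nat; apply: qmax; exact/asboolP.
  apply: (@le_trans _ _ (q%:Z)%:E); first by rewrite lee_fin; exact: le_q.
  (* This [P] is the resolution that witnesses nonvanishing in degree [q]; the vanishing above [q]
     holds for it as for any other. *)
  have [P [rP hTP]] := hTq.
  have Tq := no_tor_homology rP le_q.
  have [p depT] := top_tor_depth_le hR Tq hTP.
  have := ldep p _ _ (loc_stalk_fg p hM) (loc_stalk_fg p hN) (loc_stalk_bounded p M)
    (loc_stalk_bounded p N) _ (loc_semiprojective rP p) (loc_tensor_bounded rP p Tq).
  rewrite !module_depth_loc.
  have rfin := ring_depth_loc_fin p hR.
  have aM := module_depth_ge0 (loc p M); have bN := module_depth_ge0 (loc p N).
  have sM := @module_depth_notin_supp _ p M; have sN := @module_depth_notin_supp _ p N.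
  move=> /(ldep_arith aM bN rfin depT)[Mfin Nfin qle]; apply: le_trans qle _.
  by apply: esup_ub; exists p; split=> //; apply: contrapT; [move/sM|move/sN].
- apply: esup_le => _ [p [sM sN ->]].
  have [P rP] := projective_resolution_exists M.
  have aM := module_depth_ge0 (loc p M); have bN := module_depth_ge0 (loc p N).
  (* The bound [c] is arbitrary because [q_tor] is -oo when all Tor vanish; the difference is then
     below every integer. *)
  have bound (c : int) : (forall i : nat, tor_nonzero M N i -> i%:Z <= c) ->
      (ring_depth (loc_ring p) - module_depth (loc p M) - module_depth (loc p N) <= c%:E)%E.
    move=> hc; have Tc := no_tor_homology rP hc.
    have := rdep p _ _ (loc_stalk_fg p hM) (loc_stalk_fg p hN) (loc_stalk_bounded p M)
      (loc_stalk_bounded p N) _ (loc_semiprojective rP p) (loc_tensor_bounded rP p Tc).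
    rewrite !module_depth_loc; apply: rdep_arith => //; apply: depth_ge => n /Tc.
    exact: loc_tensor_no_homology.
  case eq: (q_tor M N) hq torle => [c||] // _ torle.
    by apply: bound => i /torle; rewrite lee_fin.
  have : forall c : int, (ring_depth (loc_ring p) - module_depth (loc p M)
      - module_depth (loc p N) <= c%:E)%E.
    by move=> c; apply: bound => i /torle.
  case: (_ - _ - _)%E => [d||] // h; last by have := h 0.
  by have := h (d - 1); rewrite lee_fin; lia.
Qed.
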